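(* Let $K\subset\mathbb{R}^n$ be a convex body and let $p\in(0,1]$. Then $F_pK$ is an origin-symmetric convex body.
   Context: A convex body is a compact convex set with non-empty interior; a set $M$ is origin-symmetric if $M=-M$. The radial function of a star-shaped set $M$ (a set containing $0$ and, with each point $x$, the segment $[0,x]$) is $\rho_M(\theta)=\sup\{t>0:t\theta\in M\}$, $\theta\in\mathbb{S}^{n-1}$. For $p>0$ the Fourier $p$th mean body $F_pK$ is the origin-symmetric star-shaped set $\{t\theta:\theta\in\mathbb{S}^{n-1},\,0\le t<\infty,\,t\le\rho_{F_pK}(\theta)\}$ with radial function $$\rho_{F_pK}(\theta)=\left(\frac{p}{\mathrm{Vol}_n(K)}\int_0^\infty|\widehat{\chi_K}(r\theta)|^2r^{p-1}dr\right)^{1/p},\quad\theta\in\mathbb{S}^{n-1},$$ where $\chi_K$ is the indicator function of $K$ and $\hat f(y)=\int_{\mathbb{R}^n}e^{-i\langle x,y\rangle}f(x)dx$. *)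

(* Defs.v *)
From HB Require Import structures.
From mathcomp Require Import all_boot all_order all_algebra.
From mathcomp Require Import complex.
From mathcomp Require Import all_classical all_reals all_analysis.
Import Order.TTheory GRing.Theory Num.Theory.
Import numFieldNormedType.Exports.

Set Implicit Arguments.
Unset Strict Implicit.
Unset Printing Implicit Defensive.

Local Open Scope classical_set_scope.
Local Open Scope ring_scope.

(* The product sigma-algebra, generated by the coordinate maps; on 'rV[R]_n it
   is the Borel sigma-algebra. *)
Section measurable_rV.
Variables (R : realType) (n : nat).

Let coord (i : 'I_n) (v : 'rV[R]_n) : R := v ord0 i.

Let rV_set0 : g_sigma_preimage coord set0.
Proof. exact: sigma_algebra0. Qed.

Let rV_setC A : g_sigma_preimage coord A -> g_sigma_preimage coord (~` A).
Proof. exact: sigma_algebraC. Qed.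

Let rV_bigcup (F : (set 'rV[R]_n)^nat) :
  (forall i, g_sigma_preimage coord (F i)) ->
  g_sigma_preimage coord (\bigcup_i (F i)).
Proof. exact: sigma_algebra_bigcup. Qed.

HB.instance Definition _ := @isMeasurable.Build default_measure_display
  'rV[R]_n (g_sigma_preimage coord) rV_set0 rV_setC rV_bigcup.

Lemma measurable_coord (i : 'I_n) :
  measurable_fun [set: 'rV[R]_n] (fun v : 'rV[R]_n => v ord0 i).
Proof.
move=> _ Y mY; rewrite setTI; apply: sub_sigma_algebra => /=.
rewrite -bigcup_seq/=; exists i => /=; first by rewrite mem_index_enum.
by exists Y => //; rewrite setTI.
Qed.

Lemma measurable_fun_rV d (T : measurableType d) (f : T -> 'rV[R]_n) :
  (forall i, measurable_fun [set: T] (fun t => f t ord0 i)) ->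
  measurable_fun [set: T] f.
Proof.
move=> mf.
have H : g_sigma_preimage (fun i => coord i \o f) `<=` measurable.
  apply: smallest_sub; first exact: sigma_algebra_measurable.
  rewrite -bigcup_seq; apply: bigcup_sub => i _ A [B mB <-].
  exact: mf.
rewrite g_sigma_preimage_comp in H.
by move=> _ A mA; apply: H; exists A.
Qed.

End measurable_rV.

Section lebesgue_rV_step.
Variables (R : realType) (n : nat).

Definition consr (xv : measurableTypeR R * 'rV[R]_n) : 'rV[R]_n.+1 :=
  row_mx (xv.1%:M : 'rV[R]_1) xv.2.

Definition unconsr (v : 'rV[R]_n.+1) : measurableTypeR R * 'rV[R]_n :=
  (v ord0 ord0, @rsubmx R 1 1 n v).

Lemma consrK : cancel consr unconsr.
Proof.
case=> x v; rewrite /unconsr /consr row_mxKr; congr pair.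
have := row_mxEl (x%:M : 'rV[R]_1) v ord0 ord0; rewrite [RHS]mxE eqxx mulr1n.
by rewrite (_ : lshift n ord0 = ord0)//; exact/val_inj.
Qed.

Lemma measurable_consr : measurable_fun setT consr.
Proof.
apply: measurable_fun_rV => i.
have [j ij|j ij] := fintype.split_ordP (i : 'I_(1 + n)).
  rewrite (_ : (fun t => _) = fst); first exact: measurable_fst.
  apply/funext => t; rewrite ij; apply: etrans (row_mxEl _ _ _ _) _.
  by rewrite mxE !ord1 eqxx.
rewrite (_ : (fun t => _) = (fun v : 'rV[R]_n => v ord0 j) \o snd).
  by apply: measurableT_comp; [exact: measurable_coord|exact: measurable_snd].
by apply/funext => t; rewrite ij; exact: row_mxEr.
Qed.

Lemma measurable_unconsr : measurable_fun setT unconsr.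
Proof.
apply: measurable_fun_pair; first exact: measurable_coord.
apply: measurable_fun_rV => i.
rewrite (_ : (fun t => _) = (fun v : 'rV[R]_n.+1 => v ord0 (@rshift 1 n i))).
  exact: (@measurable_coord R n.+1).
by apply/funext => v; rewrite mxE.
Qed.

HB.instance Definition _ := isMeasurableFun.Build _ _ _ _ consr measurable_consr.

Variable mu : {sigma_finite_measure set 'rV[R]_n -> \bar R}.

Definition lebesgue_rV_step : set 'rV[R]_n.+1 -> \bar R :=
  pushforward (lebesgue_measure \x mu)%E consr.

Let step0 : lebesgue_rV_step set0 = 0%E.
Proof. exact: measure0. Qed.

Let step_ge0 A : (0 <= lebesgue_rV_step A)%E.
Proof. exact: measure_ge0. Qed.

Let step_sigma_additive : semi_sigma_additive lebesgue_rV_step.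
Proof. exact: measure_semi_sigma_additive. Qed.

HB.instance Definition _ := isMeasure.Build _ _ _ lebesgue_rV_step
  step0 step_ge0 step_sigma_additive.

Let step_sigma_finite : sigma_finite setT lebesgue_rV_step.
Proof.
have [F FT Foo] : sigma_finite setT (lebesgue_measure \x mu)%E.
  have /sigma_finiteP[F [FT ndF Foo]] := sigma_finiteT (@lebesgue_measure R).
  have /sigma_finiteP[G [GT ndG Goo]] := sigma_finiteT mu.
  exists (fun k => F k `*` G k).
    rewrite -setXTT FT GT predeqE => -[x y]; split=> [[/= [k _ Fx] [l _ Gy]]|].
      exists (maxn k l) => //; split.
      - by move: x Fx; exact/subsetPset/ndF/leq_maxl.
      - by move: y Gy; exact/subsetPset/ndG/leq_maxr.
    by move=> [k _ []/= ? ?]; split; exists k.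
  move=> k; have [? ?] := Foo k; have [? ?] := Goo k; split.
    exact: measurableX.
  by rewrite product_measure1E// lte_mul_pinfty// ge0_fin_numE.
exists (fun k => unconsr @^-1` F k).
  by rewrite -preimage_bigcup -FT preimage_setT.
move=> k; have [mF Fk] := Foo k; split.
  by rewrite -[X in measurable X]setTI; exact: measurable_unconsr.
rewrite /lebesgue_rV_step /pushforward -comp_preimage.
by rewrite (_ : unconsr \o consr = id) ?preimage_id//; exact/funext/consrK.
Qed.

HB.instance Definition _ := Measure_isSigmaFinite.Build _ _ _ lebesgue_rV_step
  step_sigma_finite.

End lebesgue_rV_step.

(* n-dimensional Lebesgue measure: the unit mass on R^0, and on R^(1+n) the
   image of (Lebesgue on R) x (Lebesgue on R^n) under (x, v) |-> row_mx x v. *)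
Fixpoint lebesgue_rV (R : realType) (n : nat) :
    {sigma_finite_measure set 'rV[R]_n -> \bar R} :=
  match n with
  | 0 => dirac (0 : 'rV[R]_0)
  | m.+1 => lebesgue_rV_step (lebesgue_rV R m)
  end.

Definition complex_integral d (T : measurableType d) (R : realType)
    (mu : {measure set T -> \bar R}) (f : T -> R[i]) : R[i] :=
  ((\int[mu]_x complex.Re (f x)) +i* (\int[mu]_x complex.Im (f x)))%C.

(* exp(i t) *)
Definition expi (R : realType) (t : R) : R[i] := (cos t +i* sin t)%C.

Definition dotr (R : realType) n (x y : 'rV[R]_n) : R :=
  \sum_(i < n) x ord0 i * y ord0 i.

Definition fourier (R : realType) n (f : 'rV[R]_n -> R) (y : 'rV[R]_n) : R[i] :=
  complex_integral (lebesgue_rV R n) (fun x => expi (- dotr x y) * (f x)%:C%C).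

(* The norm of 'rV[R]_n in the library is the sup norm, hence the explicit
   Euclidean condition. *)
Definition sphere (R : realType) n : set 'rV[R]_n :=
  [set theta | dotr theta theta = 1].

Definition origin_symmetric (R : realType) n (M : set 'rV[R]_n) :=
  M = [set - x | x in M].

Definition convex_body (R : realType) n (K : set 'rV[R]_n) :=
  [/\ compact K, convex_set K & K° !=set0].

(* Extended-real valued: the defining integral may be infinite a priori. *)
Definition fourier_mean_radial (R : realType) n (p : R) (K : set 'rV[R]_n)
    (theta : 'rV[R]_n) : \bar R :=
  ((p%:E / lebesgue_rV R n K *
    \int[lebesgue_measure]_(r in `]0%R, +oo[)
      (Normc.normc (fourier \1_K (r *: theta)) ^+ 2 * r `^ (p - 1))%R%:E)
   `^ p^-1)%E.

Definition fourier_mean_body (R : realType) n (p : R) (K : set 'rV[R]_n) :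
    set 'rV[R]_n :=
  [set x | exists theta t, [/\ sphere theta, 0 <= t,
    (t%:E <= fourier_mean_radial p K theta)%E & x = t *: theta]].

(* Main.v *)
(* Let [G y] be the integral over [r > 0] of [|chi_K^(r y)|^2 r^(p-1)].  The gauge of F_pK is a
   constant times [G^(-1/p)], so everything rests on the subadditivity of [G^(-1/p)].
   Let [0 < p < 1].  Writing [r^(p-1)] as an average of the exponentials [exp (- e r)] turns
   [G y] into the integral of [c(z) k(y.z)] over [z], where [c] is the covariogram of [K] and
   [k u], the integral of [e^(-p) e / (e^2 + u^2)] over [e > 0], is even, homogeneous of degree
   [-p] and decreasing in [|u|].  On the plane spanned by [xi] and [eta] only the
   two-dimensional marginal [f] of [c] matters; it is even, and log-concave by Prekopa.
   Homogeneity of [k] reduces [G ((1 + a kappa) xi + a eta)] to an integral of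
   [rho(x) k(x + a)] over the line, where [rho x] integrates [r^(1-p) f] along the ray through
   [(x, 1 - kappa x)].  By Ball's theorem [rho^(-1/(2-p))] is convex, so for a suitable [kappa]
   [rho] is unimodal about [0], and shifting a symmetric decreasing kernel by [a] and [-a] does
   not increase the sum of its integrals against [rho].  The resulting inequality
   [G ((1 + a kappa) xi + a eta) + G ((1 - a kappa) xi - a eta) <= 2 G xi] is the convexity of
   [G^(-1/p)] at [xi] in the direction [eta], in a form which a maximum principle makes global.
   The case [p = 1] is the limit [p -> 1]. *)

Require Import Defs.
From HB Require Import structures.
From mathcomp Require Import all_boot all_order all_algebra.
From mathcomp Require Import complex finmap.
From mathcomp Require Import all_classical all_reals all_analysis measurable_realfun.
From mathcomp Require Import ring lra.
Import Order.TTheory GRing.Theory Num.Theory.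
Import numFieldNormedType.Exports.

Set Implicit Arguments.
Unset Strict Implicit.
Unset Printing Implicit Defensive.

Local Open Scope classical_set_scope.
Local Open Scope ring_scope.

(** * Lebesgue measure on row vectors *)

(** The average over exponentials is chosen because each [exp (- e r)] turns the oscillating power
    spectrum into integration against an explicit nonnegative kernel, and Tonelli, level sets and
    shifts are all applied to nonnegative integrands. The normalizing constant of the average is
    [Gamma(1 - p)], infinite at [p = 1]; hence the limit. Log-concavity is the form of convexity of
    [K] that survives integrating out all coordinates but two. The function [G] cannot be compared
    at [xi + a eta] and [xi - a eta] directly, because [rho] need not peak at the origin of the
    untilted line. The slope [kappa] moves the peak there, but it depends on the base point and
    nothing is known about its size. After homogeneity the local inequality compares the gauge at a
    point [S + c T] with its values at two points of the same line, with weights [1 + a kappa] and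
    [1 - a kappa] and barycentre [c]. It thus acts as a second-order condition with unknown weights
    at each point, for a function known only to be continuous; this is why a maximum principle with
    a quadratic perturbation concludes. *)

Lemma integral_indicT d (T : measurableType d) (R : realType)
    (mu : {measure set T -> \bar R}) (A : set T) : measurable A ->
  (\int[mu]_x (\1_A x)%:E)%E = mu A.
Proof. by move=> mA; rewrite integral_indic// setIT. Qed.

Lemma measurable_EFin_indic d (T : measurableType d) (R : realType)
    (D A : set T) : measurable A ->
  measurable_fun D (fun x => (\1_A x : R)%:E).
Proof. by move=> mA; apply/measurable_EFinP; exact: measurable_indic. Qed.

Section affine_change.
Local Open Scope ereal_scope.
Context {R : realType}.
Local Notation mu := (@lebesgue_measure R).

Let aff (c a : R) : measurableTypeR R -> measurableTypeR R :=
  fun x => (c * x + a)%R.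

Let measurable_aff c a : measurable_fun setT (aff c a).
Proof. by apply: measurable_funD => //; exact: measurable_funM. Qed.

Let muaff c a : {measure set (measurableTypeR R) -> \bar R} :=
  measure_function_pushforward__canonical__measure_function_Measure mu (measurable_aff c a).

(** Both measures agree on the half-open intervals that determine Lebesgue measure. A negative [c]
    exchanges the open and the closed end, which does not change the length. *)
Lemma lebesgue_measure_affine (c a : R) (A : set (measurableTypeR R)) : c != 0%R -> measurable A ->
  mscale (NngNum (normr_ge0 c)) (muaff c a) A = mu A.
Proof.
move=> c0 mA; apply/esym/lebesgue_measure_unique => //= _ [[u v]] _ <-.
rewrite /mscale /= /pushforward /=.
have [cp|cn|] := ltgtP 0%R c; last by move=> /esym/eqP; rewrite (negbTE c0).
- rewrite (_ : aff c a @^-1` _ = `](u - a) / c, (v - a) / c]%classic)%R; last first.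
    apply/seteqP; split => x /=; rewrite /aff !in_itv/= ltr_pdivrMr// ler_pdivlMr// ltrBlDr lerBrDr [(x * c)%R]mulrC//.
  rewrite !lebesgue_measure_itv/= !lte_fin ltr_pM2r ?invr_gt0// ltrD2r.
  case: ifPn => uv; last by rewrite mule0.
  by rewrite gtr0_norm// -!EFinD -EFinM; congr EFin; field.
- rewrite (_ : aff c a @^-1` _ = `[(v - a) / c, (u - a) / c[%classic)%R; last first.
    apply/seteqP; split => x /=; rewrite /aff !in_itv/= ler_ndivrMr// ltr_ndivlMr// lerBrDr ltrBlDr [(x * c)%R]mulrC andbC//.
  rewrite !lebesgue_measure_itv/= !lte_fin ltr_nM2r ?invr_lt0// ltrD2r.
  case: ifPn => uv; last by rewrite mule0.
  by rewrite ltr0_norm// -!EFinD -EFinM; congr EFin; field.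
Qed.

Lemma ge0_integral_affine (c a : R) (f : R -> \bar R) : c != 0%R ->
  measurable_fun setT f -> (forall x, 0 <= f x) ->
  `|c|%:E * \int[mu]_x f (c * x + a)%R = \int[mu]_x f x.
Proof.
move=> c0 mf f0.
transitivity (\int[mscale (NngNum (normr_ge0 c)) (muaff c a)]_x f x).
  rewrite ge0_integral_mscale//=; congr (_ * _).
  by rewrite ge0_integral_pushforward.
by apply: eq_measure_integral => //= A mA _; exact: lebesgue_measure_affine.
Qed.

Lemma ge0_integral_shift (a : R) (f : R -> \bar R) :
  measurable_fun setT f -> (forall x, 0 <= f x) ->
  \int[mu]_x f (x + a)%R = \int[mu]_x f x.
Proof.
move=> mf f0; rewrite -(@ge0_integral_affine 1 a f)// ?oner_eq0// normr1 mul1e.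
by under [in RHS]eq_integral do rewrite mul1r.
Qed.

End affine_change.

Section whole_space.
Context d (T : measurableType d) (R : realType) (nu : {measure set T -> \bar R}).

Lemma ge0_integralZT (f : T -> \bar R) (k : R) : measurable_fun setT f ->
  (forall x, (0 <= f x)%E) -> 0 <= k ->
  (\int[nu]_x (k%:E * f x) = k%:E * \int[nu]_x f x)%E.
Proof. by move=> mf f0 k0; rewrite ge0_integralZl//. Qed.

Lemma ge0_integralDT (f g : T -> \bar R) : measurable_fun setT f ->
  measurable_fun setT g -> (forall x, (0 <= f x)%E) -> (forall x, (0 <= g x)%E) ->
  (\int[nu]_x (f x + g x) = \int[nu]_x f x + \int[nu]_x g x)%E.
Proof. by move=> mf mg f0 g0; rewrite ge0_integralD. Qed.

End whole_space.

(** The source of strict positivity for the radial function, for the Gamma constant and for the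
    power means. *)
Lemma integral_gt0_itv (R : realType) (f : R -> \bar R) (a b c : R) :
  measurable_fun setT f -> (forall x, (0 <= f x)%E) -> a < b -> 0 < c ->
  (forall x, a <= x -> x <= b -> (c%:E <= f x)%E) ->
  (0 < \int[lebesgue_measure]_x f x)%E.
Proof.
move=> mf f0 ab c0 cf; pose J : set R := `[a, b]%classic.
have mJ : measurable J by exact: measurable_itv.
have mi : measurable_fun setT (fun x => (\1_J x)%:E : \bar R) by exact: measurable_EFin_indic.
apply: (@lt_le_trans _ _ (\int[lebesgue_measure]_x (c%:E * (\1_J x)%:E))%E).
  rewrite (ge0_integralZT (@lebesgue_measure R) mi) ?(ltW c0)// (integral_indicT (@lebesgue_measure R) mJ) /J/= lebesgue_measure_itv/=.
  by rewrite lte_fin ab -EFinD -EFinM lte_fin mulr_gt0// subr_gt0.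
apply: ge0_le_integral => //.
- by move=> x _; rewrite mule_ge0 ?lee_fin ?(ltW c0).
- exact: measurable_funeM.
move=> x _; rewrite indicE; case: (boolP (x \in J)) => xJ; last by rewrite mule0.
by move: xJ; rewrite inE /J/= in_itv/= mule1 => /andP[]; exact: cf.
Qed.

Section lebesgue_rV_theory.
Local Open Scope ereal_scope.
Context {R : realType}.
Local Notation mu := (@lebesgue_measure R).

Lemma integral_rV0 (f : 'rV[R]_0 -> \bar R) :
  measurable_fun setT f -> \int[lebesgue_rV R 0]_v f v = f 0%R.
Proof. by move=> mf; rewrite integral_dirac// diracT mul1e. Qed.

Lemma ge0_integral_rVS n (f : 'rV[R]_n.+1 -> \bar R) :
  measurable_fun setT f -> (forall v, 0 <= f v) ->
  \int[lebesgue_rV R n.+1]_v f v =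
  \int[mu]_x \int[lebesgue_rV R n]_w f (consr (x, w)).
Proof.
move=> mf f0.
rewrite -(@fubini_tonelli1 _ _ _ _ _ mu (lebesgue_rV R n) (f \o @consr R n))//.
- rewrite -[RHS](@ge0_integral_pushforward _ _ _ _ R _ (@measurable_consr R n) _ setT f)//.
- by apply: measurableT_comp => //; exact: measurable_consr.
- by move=> x; exact: f0.
Qed.

Lemma measurable_rV_linear d (T : measurableType d) n m (f : T -> 'rV[R]_n) (M : 'M[R]_(n, m)) :
  measurable_fun setT f -> measurable_fun setT (fun x => f x *m M)%R.
Proof.
move=> mf; apply: measurable_fun_rV => i.
rewrite (_ : (fun _ => _) = (fun t => \sum_(j < n) f t ord0 j * M j i)%R); last first.
  by apply/funext => t; rewrite mxE.
apply: measurable_sum => j; apply: measurable_funM => //.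
exact: (measurableT_comp (measurable_coord j)).
Qed.

Lemma measurable_rVD d (T : measurableType d) n (f g : T -> 'rV[R]_n) :
  measurable_fun setT f -> measurable_fun setT g ->
  measurable_fun setT (fun x => f x + g x)%R.
Proof.
move=> mf mg; apply: measurable_fun_rV => i.
rewrite (_ : (fun _ => _) = (fun t => f t ord0 i + g t ord0 i)%R); last first.
  by apply/funext => t; rewrite mxE.
by apply: measurable_funD; exact: (measurableT_comp (measurable_coord i)).
Qed.

Lemma measurable_rVN d (T : measurableType d) n (f : T -> 'rV[R]_n) :
  measurable_fun setT f -> measurable_fun setT (fun x => - f x)%R.
Proof.
move=> mf; apply: measurable_fun_rV => i.
rewrite (_ : (fun _ => _) = (fun t => - f t ord0 i)%R); last first.
  by apply/funext => t; rewrite mxE.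
by apply: measurableT_comp => //; exact: (measurableT_comp (measurable_coord i)).
Qed.

Lemma consrD n (x y : R) (v w : 'rV[R]_n) :
  (consr (x, v) + consr (y, w))%R = consr ((x + y)%R, (v + w)%R).
Proof. by rewrite /consr /= (add_row_mx (x%:M) v) -raddfD. Qed.

Lemma consrZ n (c x : R) (v : 'rV[R]_n) :
  (c *: consr (x, v))%R = consr ((c * x)%R, (c *: v)%R).
Proof. by rewrite /consr /= (scale_row_mx c (x%:M)) scale_scalar_mx. Qed.

Lemma unconsrK n : cancel (@unconsr R n) (@consr R n).
Proof.
move=> v; apply/rowP => i; rewrite /consr /unconsr.
have [j ij|j ij] := fintype.split_ordP (i : 'I_(1 + n)).
  rewrite ij; apply: etrans (row_mxEl _ _ _ _) _.
  rewrite mxE !ord1 eqxx mulr1n; congr (v _ _); exact/val_inj.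
by rewrite ij; apply: etrans (row_mxEr _ _ _ _) _; rewrite mxE.
Qed.

Lemma consr_ord0 n (x : R) (v : 'rV[R]_n) : consr (x, v) ord0 ord0 = x.
Proof. by have /(congr1 fst) := consrK (x, v). Qed.

Lemma consr_lift n (x : R) (v : 'rV[R]_n) i : consr (x, v) ord0 (lift ord0 i) = v ord0 i.
Proof.
have /(congr1 (fun u : measurableTypeR R * 'rV[R]_n => u.2 ord0 i)) := consrK (x, v).
by rewrite /= mxE => <-; congr (consr _ _ _); exact/val_inj.
Qed.

Lemma measurable_consr_r n (x : R) : measurable_fun setT (fun v : 'rV[R]_n => consr (x, v)).
Proof. by apply: (measurableT_comp (@measurable_consr R n)); exact: measurable_pair1. Qed.

Lemma ge0_integral_rV_shift n (a : 'rV[R]_n) (f : 'rV[R]_n -> \bar R) :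
  measurable_fun setT f -> (forall v, 0 <= f v) ->
  \int[lebesgue_rV R n]_v f (v + a)%R = \int[lebesgue_rV R n]_v f v.
Proof.
elim: n a f => [a f mf f0|n IH a f mf f0].
  by congr (integral _ _ _); apply/funext => v; congr f; apply/rowP => -[].
have mfa : measurable_fun setT (fun v : 'rV[R]_n.+1 => f (v + a)%R).
  by apply: measurableT_comp => //; exact: measurable_rVD.
rewrite (ge0_integral_rVS mfa (fun v => f0 _)) (ge0_integral_rVS mf f0).
rewrite -(unconsrK a); case: (unconsr a) => a0 a'.
pose g x := \int[lebesgue_rV R n]_w f (consr (x, w)).
transitivity (\int[mu]_x g (x + a0)%R).
  apply: eq_integral => x _; rewrite /g.
  rewrite -[RHS](IH a' (fun w => f (consr ((x + a0)%R, w)))) => [|//|//].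
    by apply: eq_integral => w _; rewrite consrD.
  exact: (measurableT_comp mf (@measurable_consr_r n _)).
apply: ge0_integral_shift.
  apply: (measurable_fun_fubini_tonelli_F (f \o @consr R n)) => //.
    by apply: measurableT_comp => //; exact: measurable_consr.
  by move=> x; exact: f0.
by move=> x; apply: integral_ge0 => w _.
Qed.

End lebesgue_rV_theory.

Section cube.
Local Open Scope ereal_scope.
Context {R : realType}.
Local Notation mu := (@lebesgue_measure R).

Lemma integral_rV_indic n (A : set 'rV[R]_n) : measurable A ->
  \int[lebesgue_rV R n]_v (\1_A v)%:E = lebesgue_rV R n A.
Proof. exact: integral_indicT. Qed.

(** The open ball of the sup norm. Its volume is explicit and a matrix enlarges it by a bounded
    factor, so it measures both boundedness and interior. *)
Definition cube n (e : R) : set 'rV[R]_n := [set v | forall i, `|v ord0 i| < e]%R.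

Lemma measurable_cube n e : measurable (@cube n e).
Proof.
rewrite (_ : @cube n e = \big[setI/setT]_(i < n) ((fun v : 'rV[R]_n => v ord0 i) @^-1` `](- e)%R, e[%classic)).
  apply: bigsetI_measurable => i _; rewrite -[X in measurable X]setTI.
  exact: measurable_coord.
apply/seteqP; split => [v ve|v].
  rewrite -bigcap_seq => i _ /=.
  by rewrite in_itv/= -ltr_norml; exact: ve.
rewrite -bigcap_seq => ve i; have /= := ve i (mem_index_enum _).
by rewrite in_itv/= -ltr_norml.
Qed.

Arguments measurable_cube : clear implicits.

Lemma lebesgue_rV_cube n e : (0 < e)%R ->
  lebesgue_rV R n (@cube n e) = ((2 * e) ^+ n)%:E.
Proof.
move=> e0; elim: n => [|n IH].
  rewrite expr0 /= diracE mem_set//; first by case.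
have mS := measurable_cube n.+1 e; have mn := measurable_cube n e.
have mS1 : measurable_fun setT (EFin \o (\1_(@cube n.+1 e) : 'rV[R]_n.+1 -> R)).
  exact: measurable_EFin_indic.
rewrite -[LHS](integral_rV_indic mS).
rewrite (ge0_integral_rVS mS1) => [|v]; last by rewrite /= lee_fin.
transitivity (\int[mu]_x ((2 * e)%R ^+ n * \1_(`](- e)%R, e[%classic) x)%R%:E).
  apply: eq_integral => x _.
  rewrite (_ : (fun w => _) = (fun w => (\1_(`](- e)%R, e[%classic) x)%R%:E * (\1_(@cube n e) w)%:E)).
    rewrite ge0_integralZl//; last exact: measurable_EFin_indic.
    by rewrite [in LHS]integral_rV_indic// IH -EFinM mulrC.
  apply/funext => w /=; rewrite -EFinM; congr EFin.
  rewrite !indicE -natrM mulnb; congr (nat_of_bool _)%:R.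
  apply/idP/idP.
    rewrite inE => H; apply/andP; split; rewrite inE/=.
      by have := H ord0; rewrite consr_ord0 in_itv/= -ltr_norml.
    by move=> i; have := H (lift ord0 i); rewrite consr_lift.
  move=> /andP[]; rewrite !inE/= in_itv/= -ltr_norml => xe H i.
  have [j ->|->] := fintype.unliftP ord0 i; last by rewrite consr_ord0.
  by rewrite consr_lift; exact: H.
under eq_integral do rewrite EFinM.
rewrite ge0_integralZl//; last 2 first.
  - exact: measurable_EFin_indic.
  - by rewrite lee_fin exprn_ge0// mulr_ge0// ltW.
rewrite integral_indicT//= lebesgue_measure_itv/= lte_fin gtrN//.
by rewrite -EFinD opprK -EFinM exprSr; congr EFin; ring.
Qed.

Lemma cube_mulmx n m (M : 'M[R]_(n, m)) : exists2 D : R, (0 < D)%R &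
  forall e v, (0 < e)%R -> @cube n e v -> @cube m (D * e) (v *m M)%R.
Proof.
exists (1 + \sum_i \sum_j `|M i j|)%R.
  by rewrite ltr_pwDl// sumr_ge0// => i _; exact: sumr_ge0.
move=> e v e0 ve j; rewrite mxE (le_lt_trans (ler_norm_sum _ _ _))//.
rewrite mulrDl mul1r ltr_pwDl// mulr_suml ler_sum// => i _.
rewrite normrM mulrC ler_pM//; last exact/ltW/ve.
by rewrite (bigD1 j)//= lerDl sumr_ge0.
Qed.

End cube.
Arguments measurable_cube {R} n e.

(** * Linear changes of variable, up to a constant *)

Section haar.
Local Open Scope ereal_scope.
Context {R : realType} (n : nat).
Local Notation lam := (lebesgue_rV R n).

(* As in the uniqueness of Haar measure: evaluate the double integral of [f (xT) b (y + xT)] in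
   two ways. *)
Let haar_swap (T : 'M[R]_n) (f b : 'rV[R]_n -> \bar R) : T \in unitmx ->
  measurable_fun setT f -> (forall v, 0 <= f v) ->
  measurable_fun setT b -> (forall v, 0 <= b v) ->
  (\int[lam]_x f (x *m T)%R) * (\int[lam]_y b y) =
  (\int[lam]_x b (x *m T)%R) * (\int[lam]_y f (- y)%R).
Proof.
move=> uT mf f0 mb b0.
have mfT : measurable_fun setT (fun x : 'rV[R]_n => f (x *m T)%R).
  by apply: (measurableT_comp mf); exact: measurable_rV_linear.
have mbT : measurable_fun setT (fun x : 'rV[R]_n => b (x *m T)%R).
  by apply: (measurableT_comp mb); exact: measurable_rV_linear.
have mfN : measurable_fun setT (fun x : 'rV[R]_n => f (- x)%R).
  by apply: (measurableT_comp mf); exact: measurable_rVN.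
pose k (u : 'rV[R]_n * 'rV[R]_n) := f (u.1 *m T)%R * b (u.2 + u.1 *m T)%R.
have mk : measurable_fun setT k.
  apply: emeasurable_funM.
    apply: (measurableT_comp mf); apply: measurable_rV_linear; exact: measurable_fst.
  apply: (measurableT_comp mb); apply: measurable_rVD => //; exact: measurable_rV_linear.
have k0 u : 0 <= k u by rewrite mule_ge0.
pose l (u : 'rV[R]_n * 'rV[R]_n) := f (u.1 *m T - u.2)%R * b (u.1 *m T)%R.
have ml : measurable_fun setT l.
  apply: emeasurable_funM.
    apply: (measurableT_comp mf); apply: measurable_rVD.
      by apply: measurable_rV_linear; exact: measurable_fst.
    by apply: measurable_rVN; exact: measurable_snd.
  by apply: (measurableT_comp mb); exact: measurable_rV_linear.
have l0 u : 0 <= l u by rewrite mule_ge0.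
transitivity (\int[lam]_x \int[lam]_y k (x, y)).
  rewrite -ge0_integralZr//; last exact: integral_ge0.
  apply: eq_integral => x _; rewrite /k /=.
  rewrite ge0_integralZl//.
    by rewrite (ge0_integral_rV_shift _ mb b0).
  by apply: (measurableT_comp mb); apply: measurable_rVD.
rewrite (fubini_tonelli k)//.
transitivity (\int[lam]_y \int[lam]_x l (x, y)).
  apply: eq_integral => y _.
  rewrite -(@ge0_integral_rV_shift _ _ (- (y *m invmx T))%R (fun x => k (x, y)))//; last first.
    by apply: (measurableT_comp mk); exact: measurable_pair2.
  apply: eq_integral => x _; rewrite /k /l /=.
  by rewrite mulmxDl mulNmx mulmxKV// [(y + _)%R]addrC subrK.
rewrite -(fubini_tonelli l)//.
rewrite -ge0_integralZr//; last exact: integral_ge0.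
apply: eq_integral => x _; rewrite /l /=.
rewrite ge0_integralZr//.
  rewrite muleC; congr (_ * _).
  rewrite -[RHS](@ge0_integral_rV_shift _ _ (- (x *m T))%R _ mfN)//.
  by apply: eq_integral => y _; rewrite opprD opprK addrC.
apply: (measurableT_comp mf); apply: measurable_rVD => //.
exact: measurable_rVN.
Qed.

(** A test function of known finite nonzero integral, with which the proportionality constants in
    [haar_swap] are identified. *)
Let b := EFin \o (\1_(@cube R n 1) : 'rV[R]_n -> R).

Let mb : measurable_fun setT b.
Proof. by apply/measurable_EFinP; apply: measurable_indic; exact: measurable_cube. Qed.

Let b0 v : 0 <= b v. Proof. by rewrite /b/= lee_fin. Qed.

Let intb : \int[lam]_y b y = ((2 ^+ n) : R)%:E.
Proof.
rewrite [LHS](integral_rV_indic (@measurable_cube R n 1)).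
by rewrite lebesgue_rV_cube// mulr1.
Qed.

(** For [T] the identity, [haar_swap] carries the integral of [b] on both sides, and it cancels. *)
Lemma ge0_integral_rVN (f : 'rV[R]_n -> \bar R) :
  measurable_fun setT f -> (forall v, 0 <= f v) ->
  \int[lam]_y f (- y)%R = \int[lam]_y f y.
Proof.
move=> mf f0; have := haar_swap (unitmx1 _ _) mf f0 mb b0.
under eq_integral do rewrite mulmx1.
under [X in _ = X * _ -> _]eq_integral do rewrite mulmx1.
rewrite intb muleC => /(congr1 (fun x => (2 ^- n)%:E * x)).
by rewrite !muleA -EFinM mulVf ?expf_neq0// !mul1e.
Qed.

(** By [haar_swap] the two integrals are proportional, with a factor read off from the unit cube. It
    is not identified with a determinant: positivity and finiteness are what the sequel uses. *)
Lemma ge0_integral_rV_mulmx (T : 'M[R]_n) : T \in unitmx ->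
  exists2 c : R, (0 < c)%R & forall f : 'rV[R]_n -> \bar R,
    measurable_fun setT f -> (forall v, 0 <= f v) ->
    \int[lam]_x f (x *m T)%R = c%:E * \int[lam]_x f x.
Proof.
move=> uT; pose c := \int[lam]_x b (x *m T)%R.
have cE f : measurable_fun setT f -> (forall v, 0 <= f v) ->
    \int[lam]_x f (x *m T)%R = (2 ^- n)%:E * c * \int[lam]_x f x.
  move=> mf f0; have := haar_swap uT mf f0 mb b0.
  rewrite intb ge0_integral_rVN// muleC => E.
  rewrite -muleA -E muleA -EFinM mulVf ?expf_neq0// mul1e//.
have c0 : 0 <= c by exact: integral_ge0.
(* The preimage of the unit cube under [T] lies in a larger cube, of finite volume. *)
have cfin : c \is a fin_num.
  have [D D0 HD] := cube_mulmx (invmx T).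
  rewrite ge0_fin_numE//; apply: (@le_lt_trans _ _ (lam (@cube R n (D * 1)%R))); last first.
    by rewrite lebesgue_rV_cube ?ltry// mulr1.
  have mD := @measurable_cube R n (D * 1)%R.
  rewrite -[leRHS](integral_rV_indic mD).
  apply: ge0_le_integral => //.
  - by apply: (measurableT_comp mb); exact: measurable_rV_linear.
  - exact: measurable_EFin_indic.
  - move=> x _; rewrite /b/= lee_fin !indicE ler_nat.
    case: (boolP (_ *m _ \in _)) => //; rewrite inE => /(HD _ _ ltr01).
    by rewrite mulmxK// => ?; rewrite mem_set.
(* If [c] vanished, the constant function 1 would have integral zero, against the volume of the unit
   cube. *)
have cn0 : c != 0.
  apply/eqP => cE0; have := cE (cst 1) (@measurable_cst _ _ _ _ _ _) (fun=> lee01).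
  rewrite cE0 mule0 mul0e !integral_cst// mul1e => lam0.
  have := lebesgue_rV_cube n (@ltr01 R) => H.
  have : lam (@cube R n 1) <= lam setT by apply: le_measure; rewrite ?inE//; exact: measurable_cube.
  by rewrite lam0 H lee_fin mulr1 leNgt exprn_gt0.
exists (2 ^- n * fine c)%R.
  by rewrite mulr_gt0 ?invr_gt0 ?exprn_gt0// fine_gt0// lt0e cn0 c0 ltey_eq cfin.
by move=> f mf f0; rewrite EFinM fineK// cE.
Qed.

End haar.

(** * Convex sets between two cubes *)

Section solid.
Context {R : realType}.

Definition vconvex (V : lmodType R) (A : set V) := forall (a b : R) x y,
  0 <= a -> 0 <= b -> a + b = 1 -> A x -> A y -> A (a *: x + b *: y).

(** The part of being a convex body on which the estimates rest, in a form that passes directly to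
    preimages under invertible matrices. *)
Definition solid n (K : set 'rV[R]_n) :=
  [/\ measurable K, vconvex K, (exists2 D, 0 < D & K `<=` cube D) &
      exists c e, 0 < e /\ forall v, cube e v -> K (c + v)].

Lemma ball_cube n (c v : 'rV[R]_n) e : 0 < e -> ball c e v <-> cube e (v - c).
Proof.
move=> e0; split => [[_ H] i|H].
  by have := H ord0 i; rewrite /ball/= !mxE distrC.
by split => // i j; rewrite /ball/= ord1 distrC; have := H j; rewrite !mxE.
Qed.

(** The sigma-algebra is generated by the coordinates, so topological sets have to be rebuilt from
    cubes: a compact set is the intersection over [k] of finite unions of balls of radius
    [1 / (k + 1)]. *)
Lemma measurable_compact_rV n (K : set 'rV[R]_n) : compact K -> measurable K.
Proof.
move=> cK; have clK : closed K by exact: compact_closed.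
pose e (k : nat) : R := k.+1%:R^-1.
have e0 k : 0 < e k by rewrite invr_gt0.
have fK k : exists F : {fset 'rV[R]_n}, {subset F <= K} /\
    K `<=` \bigcup_(x in [set` F]) (ball x (e k)).
  move: cK; rewrite compact_cover => /(_ _ K (fun x => (ball x (e k))°)) [].
  - by move=> x _; exact: open_interior.
  - by move=> x Kx; exists x => //; exact: nbhsx_ballx.
  move=> F FK KF; exists F; split; first by move=> x /FK.
  by move=> x /KF[y Fy] /interior_subset xy; exists y.
pose F k := sval (cid (fK k)).
have [FK KF] : (forall k, {subset F k <= K}) /\
   (forall k, K `<=` \bigcup_(x in [set` F k]) (ball x (e k))).
  by split => k; rewrite /F; case: cid => ? [].
rewrite (_ : K = \bigcap_k \bigcup_(x in [set` F k]) (ball x (e k))); last first.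
  apply/seteqP; split => [x Kx k _|x Hx]; first exact: KF.
  apply: clK => /= U /nbhs_ballP[r /= r0 rU].
  have [k _ kr] : exists2 k, true & e k < r.
    exists (Num.truncn r^-1) => //; rewrite /e invf_plt ?posrE//; exact: truncnS_gt.
  have [y /= yF yx] := Hx k I; exists y; split.
    by have := FK k y yF; rewrite inE.
  apply: rU; apply: ball_sym; exact: le_ball (ltW kr) _ yx.
apply: bigcap_measurableType => k _.
apply: fin_bigcup_measurable => // x _.
rewrite (_ : ball x (e k) = (fun v : 'rV[R]_n => v + - x) @^-1` cube (e k)).
  rewrite -[X in measurable X]setTI.
  by apply: (measurable_rVD (@measurable_id _ _ setT) (@measurable_cst _ _ _ _ _ (- x))) => //; exact: measurable_cube.
by apply/seteqP; split => v /ball_cube; apply.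
Qed.

Lemma convex_body_solid n (K : set 'rV[R]_n) : convex_body K -> solid K.
Proof.
move=> [cK vK [c intc]]; split.
- exact: measurable_compact_rV.
- move=> a b x y a0 b0 ab Kx Ky.
  have a01 : 0 <= a <= 1 by rewrite a0 -ab lerDl.
  have := vK x y (@Itv01 R a a0 (andP a01).2) (mem_set Kx) (mem_set Ky).
  by rewrite inE => H; rewrite (_ : b = 1 - a); [exact: H|rewrite -ab addrAC subrr add0r].
- have /compact_bounded [M [Mr HM]] := cK.
  exists (`|M| + 2); first by rewrite ltr_wpDl.
  move=> x Kx i.
  have /(_ (`|M| + 1)) := HM _; rewrite (le_lt_trans (ler_norm M)) ?ltrDl// => /(_ isT x Kx) xM.
  apply: (@le_lt_trans _ _ `|x|); last by rewrite (le_lt_trans xM)// ltrD2l ltr1n.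
  rewrite [leRHS]/Num.Def.normr /= mx_normrE.
  by apply/bigmax_geP; right => /=; exists (ord0, i).
- move/nbhs_ballP: intc => [e /= e0 eK].
  by exists c, e; split => // v ve; apply: eK; apply/ball_cube => //; rewrite addrC addKr.
Qed.

Lemma solid_mulmx n (K : set 'rV[R]_n) (T : 'M[R]_n) : T \in unitmx ->
  solid K -> solid [set v | K (v *m T)].
Proof.
move=> uT [mK cK [D D0 KD] [c [e [e0 He]]]]; split.
- rewrite -[X in measurable X]setTI.
  by apply: (measurable_rV_linear T (@measurable_id _ _ setT)).
- by move=> a b x y a0 b0 ab Kx Ky /=; rewrite mulmxDl -!scalemxAl; exact: cK.
- have [E E0 HE] := cube_mulmx (invmx T); exists (E * D); first exact: mulr_gt0.
  by move=> v /KD /(HE _ _ D0); rewrite mulmxK.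
- have [E E0 HE] := cube_mulmx T.
  exists (c *m invmx T), (e / E); split; first exact: divr_gt0.
  move=> v /(HE _ _ (divr_gt0 e0 E0)); rewrite mulrCA divff ?gt_eqF// mulr1 => ve /=.
  by rewrite mulmxDl mulmxKV//; exact: He.
Qed.

Lemma cube_shift_measure n (c : 'rV[R]_n) (e : R) : 0 < e ->
  (lebesgue_rV R n [set v | cube e (v - c)%R] = ((2 * e) ^+ n)%:E)%E.
Proof.
move=> e0.
have mc : measurable [set v : 'rV[R]_n | cube e (v - c)].
  rewrite -[X in measurable X]setTI.
  by apply: (measurable_rVD (@measurable_id _ _ setT) (@measurable_cst _ _ _ _ _ (- c))) => //; exact: measurable_cube.
rewrite -integral_rV_indic// -lebesgue_rV_cube// -integral_rV_indic; last exact: measurable_cube.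
rewrite -[RHS](ge0_integral_rV_shift (- c)%R).
- by apply: eq_integral => v _; rewrite !indicE; congr (_%:R%:E)%E.
- by apply: measurable_EFin_indic; exact: measurable_cube.
- by move=> v; rewrite lee_fin.
Qed.

Lemma solid_measure n (K : set 'rV[R]_n) : solid K ->
  (0 < lebesgue_rV R n K < +oo)%E.
Proof.
move=> [mK cK [D D0 KD] [c [e [e0 He]]]]; apply/andP; split; last first.
  apply: (@le_lt_trans _ _ (lebesgue_rV R n (cube D))).
    by apply: le_measure; rewrite ?inE//; exact: measurable_cube.
  by rewrite lebesgue_rV_cube// ltry.
apply: (@lt_le_trans _ _ (lebesgue_rV R n [set v | cube e (v - c)])).
  by rewrite cube_shift_measure// lte_fin exprn_gt0// mulr_gt0.
apply: le_measure; rewrite ?inE//.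
  rewrite -[X in measurable X]setTI.
  by apply: (measurable_rVD (@measurable_id _ _ setT) (@measurable_cst _ _ _ _ _ (- c))) => //; exact: measurable_cube.
by move=> v /= /He; rewrite addrC subrK.
Qed.

End solid.

(** * Layer-cake formula and the Prekopa inequality *)

Section layer_cake.
Context d (T : measurableType d) (R : realType).
Variable m : {sigma_finite_measure set T -> \bar R}.
Local Notation mu := (@lebesgue_measure R).

Lemma measurable_superlevel (f : T -> R) y : measurable_fun setT f ->
  measurable [set x | y < f x].
Proof.
move=> mf; rewrite -[X in measurable X]setTI.
rewrite (_ : [set x | _] = f @^-1` `]y, +oo[); first exact: mf.
by apply/seteqP; split => x /=; rewrite in_itv/= andbT.
Qed.

Variables (D : set T) (f : T -> R).
Hypotheses (mD : measurable D) (mf : measurable_fun setT f) (f0 : forall x, 0 <= f x).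

Let A := [set u : T * measurableTypeR R | D u.1 /\ 0 < u.2 < f u.1].

Let mA : measurable A.
Proof.
rewrite (_ : A = (fst @^-1` D) `&` ((snd @^-1` `]0, +oo[%classic) `&`
   ((fun u : T * measurableTypeR R => f u.1 - u.2) @^-1` `]0, +oo[%classic))); last first.
  apply/seteqP; split => [[x y] /= [Dx /andP[y0 yf]]|[x y] /=].
    by rewrite !in_itv/= !andbT subr_gt0.
  by rewrite !in_itv/= !andbT subr_gt0 => -[Dx [y0 yf]]; split => //; apply/andP.
apply: measurableI; first by rewrite -[X in measurable X]setTI; exact: measurable_fst.
apply: measurableI; first by rewrite -[X in measurable X]setTI; exact: measurable_snd.
rewrite -[X in measurable X]setTI.
by apply: measurable_funB => //; exact: (measurableT_comp mf measurable_fst).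
Qed.

Let k (K : T -> \bar R) (u : T * measurableTypeR R) : \bar R := ((\1_A u)%:E * K u.1)%E.

Let mk K : measurable_fun setT K -> measurable_fun setT (k K).
Proof.
move=> mK; apply: emeasurable_funM; first exact: measurable_EFin_indic.
exact: (measurableT_comp mK).
Qed.

Let k0 K : (forall x, 0 <= K x)%E -> forall u, (0 <= k K u)%E.
Proof. by move=> K0 u; rewrite mule_ge0// lee_fin. Qed.

Let section_integral K y : 0 < y ->
  (\int[m]_x k K (x, y) = \int[m]_(x in D `&` [set x | (y < f x)%R]) K x)%E.
Proof.
move=> y0; rewrite [RHS]integral_mkcond; apply: eq_integral => x _.
rewrite patchE /k indicE /=.
have -> : ((x, y) \in A) = (x \in D `&` [set x | y < f x]).
  apply/idP/idP; rewrite !inE/=; first by move=> [Dx /andP[_ yf]].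
  by move=> [Dx yf]; split => //; apply/andP.
by case: ifP; rewrite ?mul1e ?mul0e.
Qed.

Lemma measurable_integral_superlevel K : measurable_fun setT K -> (forall x, 0 <= K x)%E ->
  measurable_fun (`]0, +oo[%classic : set R)
    (fun y : R => \int[m]_(x in D `&` [set x | (y < f x)%R]) K x)%E.
Proof.
move=> mK K0; apply: (eq_measurable_fun (fun y => \int[m]_x k K (x, y))%E).
  by move=> y; rewrite inE/= in_itv/= andbT => /section_integral.
apply: measurable_funTS.
exact: (@measurable_fun_fubini_tonelli_G _ _ _ _ R m (k K) (mk mK) (k0 K0)).
Qed.

(** Tonelli on the region [A] under the graph of [f]. The weight [K] is what allows
    [unimodal_kernel] to slice first the density and then the kernel. *)
Lemma layer_cake_mul K : measurable_fun setT K -> (forall x, 0 <= K x)%E ->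
  (\int[m]_(x in D) ((f x)%:E * K x) =
   \int[mu]_(y in `]0%R, +oo[) \int[m]_(x in D `&` [set x | (y < f x)%R]) K x)%E.
Proof.
move=> mK K0; rewrite [LHS]integral_mkcond [RHS]integral_mkcond.
have := @fubini_tonelli _ _ _ _ R m mu (k K) (mk mK) (k0 K0).
have -> : (\int[m]_x \int[mu]_y k K (x, y) = \int[m]_x ((fun x => (f x)%:E * K x) \_ D) x)%E.
  apply: eq_integral => x _; rewrite /k patchE /=.
  have mAx : measurable_fun setT (fun y : measurableTypeR R => (\1_A (x, y))%:E : \bar R).
    have mA1 : measurable_fun setT (fun u => (\1_A u)%:E : \bar R) by exact: measurable_EFin_indic.
    exact: (measurableT_comp mA1 (measurable_pair1 x)).
  rewrite ge0_integralZr//.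
  case: ifPn => xD.
    rewrite (_ : (fun y => _) = fun y => (\1_(`]0, f x[%classic) y)%:E); last first.
      apply/funext => y; congr (_%:E); rewrite !indicE; congr (nat_of_bool _)%:R.
      apply/idP/idP; rewrite !inE/= in_itv/=; first by case.
      by split => //; rewrite inE in xD.
    rewrite integral_indicT//= lebesgue_measure_itv/= lte_fin.
    case: ifPn; first by rewrite -EFinD subr0.
    rewrite -leNgt => fx; congr (_%:E * _)%E; apply/eqP; rewrite eq_le f0 fx//.
  rewrite integral0_eq ?mul0e// => y _; congr (_%:E); rewrite indicE memNset//= => -[xD'].
  by move/negP: xD; rewrite inE.
move=> ->; apply: eq_integral => y _; rewrite patchE.
case: ifPn; rewrite ?inE ?notin_setE/= in_itv/= andbT => y0.
  exact: section_integral.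
rewrite integral0_eq// => x _; rewrite /k indicE memNset ?mul0e//= => -[_ /andP[h _]].
by apply: y0.
Qed.

Let m_superlevel y : (\int[m]_(x in D `&` [set x | (y < f x)%R]) (cst 1 x) =
  m (D `&` [set x | (y < f x)%R]))%E.
Proof. by rewrite integral_cst ?mul1e//; apply: measurableI => //; exact: measurable_superlevel. Qed.

Lemma measurable_measure_superlevel :
  measurable_fun (`]0, +oo[%classic : set R) (fun y : R => m (D `&` [set x | (y < f x)%R])).
Proof.
apply: (eq_measurable_fun (fun y : R => \int[m]_(x in D `&` [set x | (y < f x)%R]) cst 1 x)%E).
  by move=> y _; exact: m_superlevel.
by apply: measurable_integral_superlevel => // x; rewrite lee_fin.
Qed.

Lemma layer_cake :
  (\int[m]_(x in D) (f x)%:E =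
   \int[mu]_(y in `]0%R, +oo[) m (D `&` [set x | (y < f x)%R]))%E.
Proof.
transitivity (\int[m]_(x in D) ((f x)%:E * cst 1 x))%E.
  by apply: eq_integral => x _; rewrite /= mule1.
rewrite layer_cake_mul => [|//|x]; last by rewrite lee_fin.
by apply: eq_integral => y _; exact: m_superlevel.
Qed.

End layer_cake.

(** * Lengths of intervals and one-dimensional Brunn-Minkowski *)

Section interval_length.
Context {R : realType}.
Local Notation mu := (@lebesgue_measure R).

(** The inclusions leave open whether the endpoints belong to [S]; the maximum with 0 covers the
    case [q <= p]. *)
Lemma lebesgue_measure_between (p q : R) (S : set R) : measurable S ->
  `]p, q[%classic `<=` S -> S `<=` `[p, q]%classic ->
  mu S = (Num.max 0 (q - p))%:E.
Proof.
move=> mS pS Sp; apply/eqP; rewrite eq_le; apply/andP; split.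
  apply: (@le_trans _ _ (mu `[p, q]%classic)).
    by apply: le_measure => //; rewrite inE.
  rewrite lebesgue_measure_itv/= lte_fin; case: ltP => pq.
    by rewrite -EFinD lee_fin le_max lexx orbT.
  by rewrite lee_fin le_max lexx.
apply: (@le_trans _ _ (mu `]p, q[%classic)); last first.
  by apply: le_measure => //; rewrite inE.
rewrite lebesgue_measure_itv/= lte_fin; case: ltP => pq.
  by rewrite -EFinD lee_fin ge_max lexx subr_ge0 ltW.
by rewrite lee_fin ge_max lexx subr_le0.
Qed.

Definition ivl (I : set R) := forall a b x, I a -> I b -> a <= x <= b -> I x.

Lemma ivl_length (I : set R) : measurable I -> ivl I -> I !=set0 ->
  has_sup I -> has_inf I -> mu I = (sup I - inf I)%:E.
Proof.
move=> mI iI [a Ia] hs hi.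
have sx x : I x -> inf I <= x <= sup I.
  by move=> Ix; apply/andP; split; [exact: (ge_inf hi.2)|exact: (ub_le_sup hs.2)].
rewrite (@lebesgue_measure_between (inf I) (sup I))//.
  rewrite maxEle subr_ge0; case: ifPn => //.
  by have /andP[/le_trans h /h ->] := sx a Ia.
- move=> x /=; rewrite in_itv/= => /andP[ix xs].
  have [u Iu ux] := inf_lt hi.1 ix; have [v Iv xv] := sup_gt hs.1 xs.
  by apply: (iI u v) => //; rewrite (ltW ux) (ltW xv).
Qed.

Lemma ivl_length_superadd (al be : R) (I J S : set R) : 0 <= al -> 0 <= be ->
  measurable I -> measurable J -> measurable S -> ivl I -> ivl J ->
  I !=set0 -> J !=set0 -> has_sup I -> has_inf I -> has_sup J -> has_inf J ->
  (forall x y, I x -> J y -> S (al * x + be * y)) ->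
  (al%:E * mu I + be%:E * mu J <= mu S)%E.
Proof.
move=> al0 be0 mI mJ mS iI iJ I0 J0 sI jI sJ jJ IJS.
rewrite (ivl_length mI iI I0 sI jI) (ivl_length mJ iJ J0 sJ jJ) -!EFinM -EFinD.
apply/lee_addgt0Pr => e e0.
(* The endpoint errors add up to at most [2 (al + be) e']; the extra 1 keeps the denominator
   positive. *)
pose e' := e / (2 * (al + be + 1)).
have ab1 : 0 < al + be + 1 by rewrite ltr_wpDl// addr_ge0.
have e'0 : 0 < e' by rewrite divr_gt0// mulr_gt0.
have [a1 Ia1 a1e] := inf_adherent e'0 jI; have [b1 Ib1 b1e] := sup_adherent e'0 sI.
have [a2 Ja2 a2e] := inf_adherent e'0 jJ; have [b2 Jb2 b2e] := sup_adherent e'0 sJ.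
pose A := al * a1 + be * a2; pose B := al * b1 + be * b2.
apply: (@le_trans _ _ (mu `[A, B]%classic + e%:E)%E); last first.
  rewrite leeD2r//; apply: le_measure; rewrite ?inE// => x/=; rewrite in_itv/= => /andP[x1 x2].
  have AB : A <= B by exact: le_trans x1 x2.
  have [AB0|AB0] := eqVneq A B.
    rewrite (_ : x = A); first exact: IJS.
    by apply/eqP; rewrite eq_le x1 andbT; move: x2; rewrite -AB0.
  have AB1 : 0 < B - A by rewrite subr_gt0 lt_neqAle AB0.
  pose t := (x - A) / (B - A).
  have t0 : 0 <= t by rewrite divr_ge0 ?subr_ge0.
  have t1 : t <= 1 by rewrite ler_pdivrMr// mul1r lerB.
  have -> : x = al * ((1 - t) * a1 + t * b1) + be * ((1 - t) * a2 + t * b2).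
    transitivity (A + t * (B - A)); first by rewrite mulfVK ?gt_eqF// addrC subrK.
    by rewrite /A /B; ring.
  (* Nothing forces [a1 <= b1] or [a2 <= b2]: the nearly extremal points may come in the wrong
     order. *)
  have mid (u v : R) : Num.min u v <= (1 - t) * u + t * v <= Num.max u v.
    have t1' : 0 <= 1 - t by rewrite subr_ge0.
    have [uv|uv] := leP u v.
      have vu : 0 <= v - u by rewrite subr_ge0.
      by have h1 := mulr_ge0 t0 vu; have h2 := mulr_ge0 t1' vu; apply/andP; split; lra.
    have uv' : 0 <= u - v by rewrite subr_ge0 ltW.
    by have h1 := mulr_ge0 t0 uv'; have h2 := mulr_ge0 t1' uv'; apply/andP; split; lra.
  apply: IJS.
    apply: (iI (Num.min a1 b1) (Num.max a1 b1)) => //.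
      by rewrite minEle; case: ifP.
    by rewrite maxEle; case: ifP.
  apply: (iJ (Num.min a2 b2) (Num.max a2 b2)) => //.
    by rewrite minEle; case: ifP.
  by rewrite maxEle; case: ifP.
have key : al * (sup I - inf I) + be * (sup J - inf J) <= B - A + e.
  have : al * (sup I - inf I) <= al * (b1 - a1 + 2 * e').
    by rewrite ler_wpM2l//; lra.
  have : be * (sup J - inf J) <= be * (b2 - a2 + 2 * e').
    by rewrite ler_wpM2l//; lra.
  have : e = 2 * (al + be + 1) * e' by rewrite /e' mulrC divfK// gt_eqF// mulr_gt0.
  rewrite /A /B; nra.
rewrite lebesgue_measure_itv/= lte_fin; case: ltP => h.
  by rewrite -!EFinD lee_fin.
by rewrite add0e lee_fin; lra.
Qed.

(* One-dimensional Brunn-Minkowski on the superlevel sets: both [f1] and [f2] have supremum [1],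
   so that the level sets at any height in [(0, 1)] are nonempty. *)
Lemma levelset_superadd (al be : R) (f1 f2 f3 : R -> R) : 0 <= al -> 0 <= be ->
  measurable_fun setT f1 -> measurable_fun setT f2 -> measurable_fun setT f3 ->
  (forall x, 0 <= f1 x <= 1) -> (forall x, 0 <= f2 x <= 1) -> (forall x, 0 <= f3 x) ->
  (forall y, 0 < y < 1 -> [/\ ivl [set x | y < f1 x], [set x | y < f1 x] !=set0 &
     exists D, forall x, y < f1 x -> `|x| <= D]) ->
  (forall y, 0 < y < 1 -> [/\ ivl [set x | y < f2 x], [set x | y < f2 x] !=set0 &
     exists D, forall x, y < f2 x -> `|x| <= D]) ->
  (forall x1 x2 y, 0 < y < 1 -> y < f1 x1 -> y < f2 x2 -> y < f3 (al * x1 + be * x2)) ->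
  (al%:E * \int[mu]_x (f1 x)%:E + be%:E * \int[mu]_x (f2 x)%:E <= \int[mu]_x (f3 x)%:E)%E.
Proof.
move=> al0 be0 m1 m2 m3 f1b f2b f3b H1 H2 H12.
have f1_0 x : 0 <= f1 x by have /andP[] := f1b x.
have f2_0 x : 0 <= f2 x by have /andP[] := f2b x.
have mlev f : measurable_fun setT f -> measurable_fun (`]0, +oo[%classic : set R)
    (fun y : R => mu ([set: R] `&` [set x | y < f x])).
  by move=> mf; exact: measurable_measure_superlevel.
rewrite !layer_cake//.
rewrite -!ge0_integralZl//; [|exact: mlev|exact: mlev].
rewrite -ge0_integralD//; last 4 first.
- by move=> y _; rewrite mule_ge0.
- by apply: measurable_funeM; exact: mlev.
- by move=> y _; rewrite mule_ge0.
- by apply: measurable_funeM; exact: mlev.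
apply: ge0_le_integral => //.
- by move=> y _; rewrite adde_ge0// mule_ge0.
- by apply: emeasurable_funD; apply: measurable_funeM; exact: mlev.
- exact: mlev.
move=> y; rewrite /= in_itv/= andbT => y0; rewrite !setTI.
have [y1|y1] := ltP y 1; last first.
  have E f : (forall x, 0 <= f x <= 1) -> mu [set x : R | y < f x] = 0%E.
    move=> fb; rewrite (_ : [set _ | _] = set0); first exact: measure0.
    apply/seteqP; split => x //=.
    by have /andP[_ fx] := fb x; rewrite ltNge (le_trans fx).
  by rewrite (E f1)// (E f2)// !mule0 adde0.
have [|i1 [a1 n1] [D1 b1]] := H1 y; first by rewrite y0.
have [|i2 [a2 n2] [D2 b2]] := H2 y; first by rewrite y0.
apply: ivl_length_superadd => //; try exact: measurable_superlevel.
- by exists a1.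
- by exists a2.
- by split; [exists a1|exists D1 => x /b1; rewrite ler_norml => /andP[]].
- by split; [exists a1|exists (- D1) => x /b1; rewrite ler_norml => /andP[]].
- by split; [exists a2|exists D2 => x /b2; rewrite ler_norml => /andP[]].
- by split; [exists a2|exists (- D2) => x /b2; rewrite ler_norml => /andP[]].
- by move=> x1 x2 /= h1 h2; apply: H12 => //; rewrite y0.
Qed.

End interval_length.

Section normalized_superlevels.
Context {R : realType}.
Local Notation mu := (@lebesgue_measure R).

(** The supremum is exactly [w] and the positive superlevel sets are bounded intervals, so after
    division by [w] the level set at each height in [(0, 1)] is a nonempty bounded interval. *)
Definition tent_like (f : R -> R) w := [/\ measurable_fun setT f,
  forall x, 0 <= f x <= w, forall y, y < w -> exists x, y < f x &
  forall y, 0 < y -> ivl [set x | y < f x] /\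
    exists D, forall x, y < f x -> `|x| <= D].

(** Each of [f1], [f2] is divided by its own supremum so that levels are compared at equal relative
    height. The height [w3] is left free: a geometric mean of [w1] and [w2] gives Prekopa's
    inequality, a power mean of negative exponent gives Ball's theorem. *)
Lemma superlevel_superadd (al be : R) (f1 f2 f3 : R -> R) w1 w2 w3 :
  0 <= al -> 0 <= be -> 0 < w1 -> 0 < w2 -> 0 < w3 ->
  tent_like f1 w1 -> tent_like f2 w2 ->
  measurable_fun setT f3 -> (forall x, 0 <= f3 x) ->
  (forall x1 x2 y, 0 < y < 1 -> w1 * y < f1 x1 -> w2 * y < f2 x2 ->
    w3 * y < f3 (al * x1 + be * x2)) ->
  ((al / w1)%:E * \int[mu]_x (f1 x)%:E + (be / w2)%:E * \int[mu]_x (f2 x)%:E <=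
   (w3^-1)%:E * \int[mu]_x (f3 x)%:E)%E.
Proof.
move=> al0 be0 w10 w20 w30 [m1 b1 s1 l1] [m2 b2 s2 l2] m3 f30 H.
have scal (f : R -> R) (w : R) : 0 < w -> measurable_fun setT f -> (forall x, 0 <= f x) ->
   (\int[mu]_x (w^-1 * f x)%:E = (w^-1)%:E * \int[mu]_x (f x)%:E)%E.
  move=> w0 mf f0; under eq_integral do rewrite EFinM.
  rewrite ge0_integralZl// ?lee_fin ?invr_ge0 ?ltW//.
    exact/measurable_EFinP.
  by move=> x _; rewrite lee_fin.
have f10 x : 0 <= f1 x by have /andP[] := b1 x.
have f20 x : 0 <= f2 x by have /andP[] := b2 x.
rewrite !EFinM -!muleA -(scal f1 w1)// -(scal f2 w2)// -(scal f3 w3)//.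
have lev (f : R -> R) (w : R) : 0 < w -> forall y x : R, (y < w^-1 * f x) = (w * y < f x).
  by move=> w0 y x; rewrite mulrC ltr_pdivlMr// mulrC.
apply: levelset_superadd => //; try exact: measurable_funM.
- move=> x; have /andP[p q] := b1 x; apply/andP; split.
    by rewrite mulr_ge0// invr_ge0 ltW.
  by rewrite mulrC ler_pdivrMr// mul1r.
- move=> x; have /andP[p q] := b2 x; apply/andP; split.
    by rewrite mulr_ge0// invr_ge0 ltW.
  by rewrite mulrC ler_pdivrMr// mul1r.
- by move=> x; rewrite mulr_ge0// invr_ge0 ltW.
- move=> y /andP[y0 y1]; have [i [D HD]] := l1 (w1 * y) (mulr_gt0 w10 y0).
  under eq_set do rewrite lev//.
  split => //; last by exists D => x; rewrite lev//; exact: HD.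
  by have [|x Hx] := s1 (w1 * y); [rewrite gtr_pMr|exists x].
- move=> y /andP[y0 y1]; have [i [D HD]] := l2 (w2 * y) (mulr_gt0 w20 y0).
  under eq_set do rewrite lev//.
  split => //; last by exists D => x; rewrite lev//; exact: HD.
  by have [|x Hx] := s2 (w2 * y); [rewrite gtr_pMr|exists x].
- by move=> x1 x2 y y01; rewrite !lev//; exact: H.
Qed.

End normalized_superlevels.

(** * Log-concave functions and Prekopa's inequality *)

Section logconcave.
Context {R : realType}.
Local Notation mu := (@lebesgue_measure R).

(** Bound [ln] by its tangent at the arithmetic mean [m]; the weighted first-order terms cancel. *)
Lemma powR_amgm (a b x y : R) : 0 < a -> 0 < b -> a + b = 1 -> 0 <= x -> 0 <= y ->
  x `^ a * y `^ b <= a * x + b * y.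
Proof.
move=> a0 b0 ab; rewrite le_eqVlt => /predU1P[<-|x0] y0.
  by rewrite powR0 ?gt_eqF// mul0r mulr0 add0r mulr_ge0// ltW.
move: y0; rewrite le_eqVlt => /predU1P[<-|y0].
  by rewrite powR0 ?gt_eqF// mulr0 mulr0 addr0 mulr_ge0// ltW.
set m := a * x + b * y; have m0 : 0 < m by rewrite addr_gt0// mulr_gt0.
have h z : 0 < z -> ln z <= ln m + (z / m - 1).
  move=> z0; have := @le_ln1Dx R (z / m - 1).
  rewrite ltrBDr addrC subrr divr_gt0// => /(_ isT).
  rewrite addrC subrK ln_div ?posrE//; lra.
rewrite -ler_ln ?posrE//; last by rewrite mulr_gt0 ?powR_gt0.
rewrite lnM ?posrE ?powR_gt0// !ln_powR.
have hx := ler_wpM2l (ltW a0) (h x x0); have hy := ler_wpM2l (ltW b0) (h y y0).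
have E : a * (x / m - 1) + b * (y / m - 1) = 0.
  by rewrite !mulrBr !mulr1 addrACA -opprD ab !mulrA -mulrDl divff ?gt_eqF// subrr.
have E2 : (a + b) * ln m = ln m by rewrite ab mul1r.
lra.
Qed.

(** Multiplicative form, so that zeros of [f] need no logarithm. The weights are strictly positive
    because zero to the power zero is one. *)
Definition logconcave (V : lmodType R) (f : V -> R) := forall (a b : R) x y,
  0 < a -> 0 < b -> a + b = 1 -> f x `^ a * f y `^ b <= f (a *: x + b *: y).

Lemma powRV (w c : R) : 0 < w -> w^-1 `^ c = (w `^ c)^-1.
Proof.
move=> w0; have wc := powR_gt0 c w0; apply: (mulIf (lt0r_neq0 wc)).
by rewrite mulVf ?gt_eqF// -powRM ?invr_ge0 ?ltW// mulVf ?gt_eqF// powR1.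
Qed.

Lemma powR_lt_mul (a b x y t s : R) : 0 < a -> 0 < b -> 0 < t -> 0 < s ->
  t < x -> s < y -> t `^ a * s `^ b < x `^ a * y `^ b.
Proof.
move=> a0 b0 t0 s0 tx sy.
have x0 := lt_trans t0 tx; have y0 := lt_trans s0 sy.
by apply: ltr_pM; rewrite ?powR_ge0// gt0_ltr_powR// ?nnegrE ltW.
Qed.

Lemma logconcave_ivl (f : R -> R) y : logconcave (f : R^o -> R) -> 0 < y ->
  ivl [set x | y < f x].
Proof.
move=> lf y0 u v x /= yu yv /andP[ux xv].
have [->//|uNx] := eqVneq x u; have [->//|vNx] := eqVneq x v.
have {}ux : u < x by rewrite lt_neqAle eq_sym uNx.
have {}xv : x < v by rewrite lt_neqAle vNx.
have vu : 0 < v - u by lra.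
have ab : (v - x) / (v - u) + (x - u) / (v - u) = 1.
  by rewrite -mulrDl addrA subrK divff// gt_eqF.
have a0 : 0 < (v - x) / (v - u) by rewrite divr_gt0// subr_gt0.
have b0 : 0 < (x - u) / (v - u) by rewrite divr_gt0// subr_gt0.
have -> : x = (v - x) / (v - u) *: (u : R^o) + (x - u) / (v - u) *: (v : R^o).
  by rewrite /GRing.scale/=; field; rewrite gt_eqF.
apply: lt_le_trans (lf _ _ _ _ a0 b0 ab).
rewrite -[X in X < _](powRr1 (ltW y0)) -ab powRD; last by rewrite (gt_eqF y0) implybT.
exact: powR_lt_mul.
Qed.

Lemma logconcave_tent (f : R^o -> R) :
  measurable_fun setT f -> (forall x, 0 <= f x) -> logconcave f ->
  (exists M, forall x, f x <= M) -> (exists D, forall x, 0 < f x -> `|x| <= D) ->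
  (exists x, 0 < f x) -> 0 < sup (range f) /\ tent_like f (sup (range f)).
Proof.
move=> mf f0 lf [M fM] [D fD] [z fz].
have hs : has_sup (range f).
  by split; [exists (f z), z|exists M => _ [x _ <-]].
have fs x : f x <= sup (range f) by apply: (ub_le_sup hs.2); exists x.
split; first exact: lt_le_trans (fs z).
split => //.
- by move=> x; rewrite f0 fs.
- by move=> y /(sup_gt hs.1)[_ [x _ <-]] yx; exists x.
- move=> y y0; split; first exact: logconcave_ivl.
  by exists D => x yx; apply: fD; exact: lt_trans yx.
Qed.

(** The normalized level sets give an inequality for the weighted arithmetic mean of [i1 / w1] and
    [i2 / w2], and the arithmetic-geometric inequality turns it into the product form. A function
    without positive values makes the left side zero. *)
Lemma prekopa1 (a b : R) (f1 f2 f3 : R^o -> R) : 0 < a -> 0 < b -> a + b = 1 ->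
  measurable_fun setT f1 -> measurable_fun setT f2 -> measurable_fun setT f3 ->
  (forall x, 0 <= f1 x) -> (forall x, 0 <= f2 x) -> (forall x, 0 <= f3 x) ->
  logconcave f1 -> logconcave f2 ->
  (exists M, forall x, f1 x <= M) -> (exists M, forall x, f2 x <= M) ->
  (exists D, forall x, 0 < f1 x -> `|x| <= D) -> (exists D, forall x, 0 < f2 x -> `|x| <= D) ->
  (forall x y, f1 x `^ a * f2 y `^ b <= f3 (a *: x + b *: y)) ->
  forall i1 i2 i3 : R,
  (\int[mu]_x (f1 x)%:E)%E = i1%:E -> (\int[mu]_x (f2 x)%:E)%E = i2%:E ->
  (\int[mu]_x (f3 x)%:E)%E = i3%:E -> i1 `^ a * i2 `^ b <= i3.
Proof.
move=> a0 b0 ab m1 m2 m3 p1 p2 p3 l1 l2 M1 M2 D1 D2 H i1 i2 i3 I1 I2 I3.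
have pos (f : R^o -> R) i : (forall x, 0 <= f x) -> (\int[mu]_x (f x)%:E)%E = i%:E -> 0 <= i.
  by move=> f0 fi; rewrite -lee_fin -fi; apply: integral_ge0 => x _; rewrite lee_fin.
have zero (f : R^o -> R) i : (forall x, 0 <= f x) -> ~ (exists x, 0 < f x) ->
    (\int[mu]_x (f x)%:E)%E = i%:E -> i = 0.
  move=> f0 fN; rewrite integral0_eq => [[] //|x _]; congr (_%:E).
  apply/eqP; rewrite eq_le f0 andbT leNgt; apply/negP => fx; apply: fN; by exists x.
have i10 := pos _ _ p1 I1; have i20 := pos _ _ p2 I2; have i30 := pos _ _ p3 I3.
have [e1|/(zero _ _ p1)/(_ I1)->] := pselect (exists x, 0 < f1 x); last first.
  by rewrite powR0 ?gt_eqF// mul0r.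
have [e2|/(zero _ _ p2)/(_ I2)->] := pselect (exists x, 0 < f2 x); last first.
  by rewrite powR0 ?gt_eqF// mulr0.
have [] := logconcave_tent m1 p1 l1 M1 D1 e1; set w1 := sup _ => w10 t1.
have [] := logconcave_tent m2 p2 l2 M2 D2 e2; set w2 := sup _ => w20 t2.
pose w3 := w1 `^ a * w2 `^ b.
have w30 : 0 < w3 by rewrite mulr_gt0 ?powR_gt0.
have := superlevel_superadd (ltW a0) (ltW b0) w10 w20 w30 t1 t2 m3 p3.
rewrite I1 I2 I3 -!EFinM -EFinD lee_fin => main.
have {}main : a / w1 * i1 + b / w2 * i2 <= w3^-1 * i3.
  apply: main => x1 x2 y /andP[y0 y1] h1 h2.
  apply: lt_le_trans (H _ _).
  rewrite (_ : w3 * y = (w1 * y) `^ a * (w2 * y) `^ b).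
    by apply: powR_lt_mul => //; exact: mulr_gt0.
  rewrite !powRM ?ltW// mulrACA -powRD ?ab ?powRr1 ?ltW//.
  by rewrite (gt_eqF y0) implybT.
have := @powR_amgm a b (i1 / w1) (i2 / w2) a0 b0 ab (divr_ge0 i10 (ltW w10)) (divr_ge0 i20 (ltW w20)).
have -> : (i1 / w1) `^ a * (i2 / w2) `^ b = w3^-1 * (i1 `^ a * i2 `^ b).
  rewrite powRM ?invr_ge0 ?(ltW w10)// powRM ?invr_ge0 ?(ltW w20)// !powRV// /w3 invfM; ring.
move=> /le_trans h.
rewrite -(@ler_pM2l _ w3^-1) ?invr_gt0//; apply: h.
by move: main; rewrite mulrAC (mulrAC b) ![_ * _ / _]mulrAC -!mulrA ![_^-1 * i1]mulrC ![_^-1 * i2]mulrC.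
Qed.

End logconcave.

Section prekopa.
Context {R : realType}.
Local Notation mu := (@lebesgue_measure R).

(** Bounded with bounded support, so that the integral is finite and the real number [rint] carries
    it faithfully. *)
Definition bounded_density n (f : 'rV[R]_n -> R) :=
  [/\ measurable_fun setT f, forall v, 0 <= f v, exists M, forall v, f v <= M &
      exists2 D, 0 < D & forall v, 0 < f v -> cube D v].

Definition rint n (f : 'rV[R]_n -> R) : R := fine (\int[lebesgue_rV R n]_v (f v)%:E)%E.

Lemma integral_bounded_density n (f : 'rV[R]_n -> R) M D :
  measurable_fun setT f -> (forall v, 0 <= f v <= M) -> 0 < D ->
  (forall v, 0 < f v -> cube D v) ->
  (\int[lebesgue_rV R n]_v (f v)%:E <= (M * (2 * D) ^+ n)%:E)%E.
Proof.
move=> mf fM D0 fD.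
have M0 : 0 <= M by have /andP[/le_trans h /h] := fM 0.
apply: (@le_trans _ _ (\int[lebesgue_rV R n]_v (M * \1_(cube D) v)%:E)%E).
  apply: ge0_le_integral => //.
  - by move=> v _; rewrite lee_fin; have /andP[] := fM v.
  - exact/measurable_EFinP.
  - apply/measurable_EFinP; apply: measurable_funM => //.
    by apply: measurable_indic; exact: measurable_cube.
  - move=> v _; rewrite lee_fin indicE; have /andP[p q] := fM v.
    case: (boolP (v \in _)); first by rewrite mulr1.
    rewrite notin_setE => vD; rewrite mulr0 leNgt; apply/negP => /fD; exact: vD.
under eq_integral do rewrite EFinM.
rewrite ge0_integralZl//; last by apply: measurable_EFin_indic; exact: measurable_cube.
by rewrite integral_rV_indic ?lebesgue_rV_cube//; exact: measurable_cube.
Qed.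

Lemma rintE n (f : 'rV[R]_n -> R) : bounded_density f ->
  (\int[lebesgue_rV R n]_v (f v)%:E)%E = (rint f)%:E.
Proof.
move=> [mf f0 [M fM] [D D0 fD]]; rewrite fineK// ge0_fin_numE.
  have fb v : 0 <= f v <= M by rewrite f0 fM.
  exact: le_lt_trans (integral_bounded_density mf fb D0 fD) (ltry _).
by apply: integral_ge0 => v _; rewrite lee_fin.
Qed.

Lemma rint_ge0 n (f : 'rV[R]_n -> R) : (forall v, 0 <= f v) -> 0 <= rint f.
Proof. by move=> f0; rewrite fine_ge0// integral_ge0// => v _; rewrite lee_fin. Qed.

Lemma bounded_density_slice n (f : 'rV[R]_n.+1 -> R) x : bounded_density f ->
  bounded_density (fun w => f (consr (x, w))).
Proof.
move=> [mf f0 [M fM] [D D0 fD]]; split => //.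
- exact: (measurableT_comp mf (@measurable_consr_r R n x)).
- by exists M.
- by exists D => // w /fD H i; have := H (lift ord0 i); rewrite consr_lift.
Qed.

Lemma rint_consr n (f : 'rV[R]_n.+1 -> R) : bounded_density f ->
  let g := fun x => rint (fun w => f (consr (x, w))) in
  [/\ measurable_fun setT g, forall x, 0 <= g x, exists M, forall x, g x <= M,
     exists D, forall x, 0 < g x -> `|x| <= D &
     (\int[mu]_x (g x)%:E)%E = (rint f)%:E].
Proof.
move=> bf g; have [mf f0 [M fM] [D D0 fD]] := bf.
have gE x : ((g x)%:E = \int[lebesgue_rV R n]_w (f (consr (x, w)))%:E)%E.
  by rewrite -rintE//; exact: bounded_density_slice.
have mfc : measurable_fun setT ((EFin \o f) \o @consr R n).
  by apply: measurableT_comp; [exact/measurable_EFinP|exact: measurable_consr].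
split.
- apply/measurable_EFinP; rewrite (_ : _ \o _ = fun x => \int[lebesgue_rV R n]_w (f (consr (x, w)))%:E)%E.
    apply: (measurable_fun_fubini_tonelli_F ((EFin \o f) \o @consr R n)) => // x.
    by rewrite /= lee_fin.
  by apply/funext => x /=; rewrite gE.
- by move=> x; exact: rint_ge0.
- exists (M * (2 * D) ^+ n) => x; rewrite -lee_fin gE.
  have [mx _ _ _] := bounded_density_slice x bf.
  apply: integral_bounded_density => //; first by move=> v; rewrite f0 fM.
  by move=> w /fD H i; have := H (lift ord0 i); rewrite consr_lift.
- exists D => x; apply: contraPP => /negP; rewrite -ltNge => xD.
  rewrite /g /rint integral0_eq ?ltxx// => w _; congr (_%:E).
  apply/eqP; rewrite eq_le f0 andbT leNgt; apply/negP => /fD /(_ ord0).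
  by rewrite consr_ord0 ltNge (ltW xD).
- have mEf : measurable_fun setT (fun v => (f v)%:E) by exact/measurable_EFinP.
  rewrite -rintE// (ge0_integral_rVS mEf) => [|v]; last by rewrite lee_fin.
  by apply: eq_integral => x _; rewrite gE.
Qed.

(** The parameter space is an arbitrary module so that the induction can move one coordinate from
    the integration variable into the parameter. The inner integral [g] is then jointly log-concave
    in the parameter and that coordinate, and [prekopa1] performs the last integration. *)
Theorem prekopa n (V : lmodType R) (f : V -> 'rV[R]_n -> R) :
  (forall u, bounded_density (f u)) ->
  (forall (a b : R) u1 u2 v1 v2, 0 < a -> 0 < b -> a + b = 1 ->
    f u1 v1 `^ a * f u2 v2 `^ b <= f (a *: u1 + b *: u2) (a *: v1 + b *: v2)) ->
  logconcave (fun u => rint (f u)).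
Proof.
elim: n V f => [|n IH] V f bf lf.
  have E u : rint (f u) = f u 0.
    by rewrite /rint integral_rV0//; apply/measurable_EFinP; have [] := bf u.
  by move=> a b x y a0 b0 ab; rewrite !E; have := lf a b x y 0 0 a0 b0 ab; rewrite !scaler0 addr0.
pose g (u : V * R^o) := rint (fun w => f u.1 (consr (u.2, w))).
have lg : logconcave (g : (V * R^o)%type -> R).
  apply: (IH (V * R^o)%type (fun u w => f u.1 (consr (u.2, w)))).
    by move=> u; exact: bounded_density_slice.
  move=> a b u1 u2 v1 v2 a0 b0 ab.
  apply: le_trans (lf _ _ _ _ _ _ a0 b0 ab) _.
  by rewrite !consrZ consrD.
have sl u : logconcave (fun x : R^o => g (u, x)).
  move=> a b x y a0 b0 ab; apply: le_trans (lg _ _ (u, x) (u, y) a0 b0 ab) _.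
  rewrite (_ : a *: _ + b *: _ = (a *: u + b *: u, a *: x + b *: y))//.
  by rewrite -scalerDl ab scale1r.
move=> a b u1 u2 a0 b0 ab; set u3 := a *: u1 + b *: u2.
have [m1 p1 M1 D1 E1] := rint_consr (bf u1).
have [m2 p2 M2 D2 E2] := rint_consr (bf u2).
have [m3 p3 M3 D3 E3] := rint_consr (bf u3).
apply: (@prekopa1 R a b _ _ _ a0 b0 ab m1 m2 m3 p1 p2 p3 (sl u1) (sl u2) M1 M2 D1 D2 _ _ _ _ E1 E2 E3).
by move=> x y; exact: (lg _ _ (u1, x) (u2, y) a0 b0 ab).
Qed.

End prekopa.

(** * Power weights and Ball's radial bodies *)

Section power_weight.
Context {R : realType}.
Local Notation mu := (@lebesgue_measure R).

(** The power weight extended by zero from the positive half-line, so that all integrals run over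
    the whole line. *)
Definition pw (s r : R) : R := \1_(`]0, +oo[%classic : set R) r * r `^ s.

Lemma pwE s r : 0 < r -> pw s r = r `^ s.
Proof. by move=> r0; rewrite /pw indicE mem_set ?mul1r//= in_itv/= r0. Qed.

Lemma pwN s r : r <= 0 -> pw s r = 0.
Proof.
move=> r0; rewrite /pw indicE memNset ?mul0r//= in_itv/= andbT.
by apply/negP; rewrite -leNgt.
Qed.

Lemma pw_ge0 s r : 0 <= pw s r.
Proof. by rewrite /pw mulr_ge0// powR_ge0. Qed.

Lemma measurable_pw s : measurable_fun setT (pw s).
Proof. by apply: measurable_funM; [exact: measurable_indic|exact: measurable_powR]. Qed.

Lemma measurable_EFin_pw s : measurable_fun setT (fun r => (pw s r)%:E).
Proof. by apply/measurable_EFinP; exact: measurable_pw. Qed.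

Lemma pwD s t r : pw s r * pw t r = pw (s + t) r.
Proof.
have [r0|r0] := leP r 0; first by rewrite !pwN// mul0r.
by rewrite !pwE// powRD// (gt_eqF r0) implybT.
Qed.

Lemma pwZ s c r : 0 < c -> pw s (c * r) = c `^ s * pw s r.
Proof.
move=> c0; have [r0|r0] := leP r 0; first by rewrite !pwN ?mulr0// pmulr_rle0.
by rewrite !pwE ?mulr_gt0// powRM// ltW.
Qed.

Lemma pwV s r : pw s r^-1 = pw (- s) r.
Proof.
have [r0|r0] := leP r 0; first by rewrite !pwN// invr_le0.
by rewrite !pwE ?invr_gt0// powRV// powRN.
Qed.

Local Open Scope ereal_scope.

Lemma integral_pw s (h : R -> \bar R) :
  \int[mu]_(r in `]0%R, +oo[) ((r `^ s)%:E * h r) = \int[mu]_r ((pw s r)%:E * h r).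
Proof.
rewrite integral_mkcond; apply: eq_integral => r _; rewrite patchE.
case: ifPn; rewrite ?inE ?notin_setE/= in_itv/= andbT.
  by move=> r0; rewrite pwE.
by move/negP; rewrite -leNgt => r0; rewrite pwN// mul0e.
Qed.

Lemma ge0_integral_scale (c : R) (h : R -> \bar R) : (0 < c)%R ->
  measurable_fun setT h -> (forall r, 0 <= h r) ->
  c%:E * \int[mu]_r h (c * r)%R = \int[mu]_r h r.
Proof.
move=> c0 mh h0; rewrite -(@ge0_integral_affine _ c 0 h)// ?gt_eqF// gtr0_norm//.
by under [in RHS]eq_integral do rewrite addr0.
Qed.

Lemma ge0_integral_pw_scale s (c : R) (h : R -> \bar R) : (0 < c)%R ->
  measurable_fun setT h -> (forall r, 0 <= h r) ->
  (c `^ (s + 1))%:E * \int[mu]_r ((pw s r)%:E * h (c * r)%R) =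
  \int[mu]_r ((pw s r)%:E * h r).
Proof.
move=> c0 mh h0.
have mk : measurable_fun setT (fun r => (pw s r)%:E * h r).
  by apply: emeasurable_funM => //; exact: measurable_EFin_pw.
have k0 r : 0 <= (pw s r)%:E * h r by rewrite mule_ge0// lee_fin pw_ge0.
rewrite -(ge0_integral_scale c0 mk k0).
have -> : (c `^ (s + 1))%:E = c%:E * (c `^ s)%:E :> \bar R.
  by rewrite -EFinM powRD ?(gt_eqF c0) ?implybT// powRr1 ?ltW// mulrC.
rewrite -muleA; congr (_ * _).
rewrite -ge0_integralZl.
- by apply: eq_integral => r _; rewrite pwZ// EFinM muleA.
- by [].
- apply: emeasurable_funM; first exact: measurable_EFin_pw.
  by apply: (measurableT_comp mh); exact: measurable_funM.
- by move=> r _; rewrite mule_ge0// lee_fin pw_ge0.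
- by rewrite lee_fin powR_ge0.
Qed.

Let scale1 (c : R) (h : R -> \bar R) : (0 < c)%R ->
  measurable_fun setT h -> (forall r, 0 <= h r) ->
  \int[mu]_r ((pw (-1) r)%:E * h (c * r)%R) = \int[mu]_r ((pw (-1) r)%:E * h r).
Proof.
move=> c0 mh h0; rewrite -[RHS](@ge0_integral_pw_scale (-1) c h c0 mh h0).
by rewrite addNr powRr0 mul1e.
Qed.

(** Inversion is discontinuous at 0; it is split into the two half-line powers. *)
Lemma measurable_invr : measurable_fun setT (fun r : R => r^-1)%R.
Proof.
rewrite (_ : (fun r => _) = (fun r : R => (pw (-1) r - pw (-1) (- r)))%R).
  apply: measurable_funB; first exact: measurable_pw.
  by apply: (measurableT_comp (measurable_pw _)); exact: measurable_funN.
apply/funext => r; have [r0|r0|<-] := ltgtP 0%R r.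
- by rewrite pwE// (pwN _ (_ : - r <= 0)%R) ?oppr_le0 ?ltW// subr0 powR_inv1// ltW.
- rewrite (pwN _ (ltW r0)) pwE ?oppr_gt0// powR_inv1 ?oppr_ge0 ?ltW//.
  by rewrite invrN sub0r opprK.
- by rewrite invr0 oppr0 subrr.
Qed.

(* Uniqueness of the Haar measure [dr/r] of the multiplicative group. *)
Let inv1 (h : R -> \bar R) : measurable_fun setT h -> (forall r, 0 <= h r) ->
  \int[mu]_r ((pw (-1) r)%:E * h r^-1%R) = \int[mu]_r ((pw (-1) r)%:E * h r).
Proof.
move=> mh h0.
pose b (r : R) : \bar R := (\1_(`[1%R, 2%R]%classic : set R) r)%:E.
have mb : measurable_fun setT b by exact: measurable_EFin_indic.
have b0 r : 0 <= b r by rewrite lee_fin.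
have W0 r : 0 <= (pw (-1) r)%:E :> \bar R by rewrite lee_fin pw_ge0.
have mW := measurable_EFin_pw (-1).
pose J k := \int[mu]_r ((pw (-1) r)%:E * k r).
have Jb : exists2 c : R, (0 < c)%R & J b = c%:E.
  have l12 : mu `[1%R, 2%R]%classic = 1.
    by rewrite lebesgue_measure_itv/= lte_fin ltr1n -EFinD; congr (_%:E); ring.
  have ib : \int[mu]_r b r = 1 by rewrite /b integral_indicT.
  have Jge : (2^-1)%:E <= J b.
    rewrite -[leLHS]mule1 -ib -ge0_integralZl//.
    apply: ge0_le_integral => //.
    - by move=> r _; rewrite mule_ge0.
    - exact: emeasurable_funM.
    - exact: emeasurable_funM.
    move=> r _; rewrite /b indicE; case: (boolP (r \in _)); last by rewrite !mule0.
    rewrite inE/= in_itv/= !mule1 => /andP[r1 r2]; have r0 := lt_le_trans ltr01 r1.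
    by rewrite lee_fin pwE// powR_inv1 ?(ltW r0)// lef_pV2 ?posrE.
  have Jle : J b <= 1.
    rewrite -ib; apply: ge0_le_integral => //.
    - by move=> r _; rewrite mule_ge0.
    - exact: emeasurable_funM.
    move=> r _; rewrite /b indicE; case: (boolP (r \in _)); last by rewrite mule0.
    rewrite inE/= in_itv/= !mule1 => /andP[r1 r2]; have r0 := lt_le_trans ltr01 r1.
    by rewrite lee_fin pwE// powR_inv1 ?(ltW r0)// invf_le1.
  have Jfin : J b \is a fin_num.
    rewrite ge0_fin_numE ?(le_lt_trans Jle) ?ltry//.
    by apply: le_trans Jge; rewrite lee_fin.
  exists (fine (J b)); last by rewrite fineK.
  by rewrite -lte_fin fineK//; apply: lt_le_trans Jge; rewrite lte_fin.
have swap (k : R -> R -> \bar R) : measurable_fun setT (fun u : R * R => k u.1 u.2) ->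
    (forall x y, 0 <= k x y) -> J (fun x => J (fun y => k x y)) = J (fun y => J (fun x => k x y)).
  move=> mk k0; pose l (u : R * R) := (pw (-1) u.1)%:E * (pw (-1) u.2)%:E * k u.1 u.2.
  have ml : measurable_fun setT l.
    apply: emeasurable_funM => //; apply: emeasurable_funM; apply: (measurableT_comp mW) => //.
  have := @fubini_tonelli _ _ _ _ R mu mu l ml.
  have E1 x y : l (x, y) = (pw (-1) x)%:E * ((pw (-1) y)%:E * k x y) by rewrite /l muleA.
  have E2 x y : l (x, y) = (pw (-1) y)%:E * ((pw (-1) x)%:E * k x y).
    by rewrite /l [X in X * _]muleC -muleA.
  have -> : J (fun x => J (fun y => k x y)) = \int[mu]_x \int[mu]_y l (x, y).
    apply: eq_integral => x _; rewrite /J -ge0_integralZl//.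
    - by apply: eq_integral => y _; rewrite E1.
    - by apply: emeasurable_funM => //; exact: (measurableT_comp mk (measurable_pair1 x)).
    - by move=> y _; rewrite mule_ge0.
  have -> : J (fun y => J (fun x => k x y)) = \int[mu]_y \int[mu]_x l (x, y).
    apply: eq_integral => y _; rewrite /J -ge0_integralZl//.
    - by apply: eq_integral => x _; rewrite E2.
    - by apply: emeasurable_funM => //; exact: (measurableT_comp mk (measurable_pair2 y)).
    - by move=> x _; rewrite mule_ge0.
  by apply=> u; rewrite !mule_ge0.
have JZ (c : \bar R) k : 0 <= c -> measurable_fun setT k -> (forall r, 0 <= k r) ->
    c * J k = J (fun r => c * k r).
  move=> c0 mk k0; rewrite /J -ge0_integralZl//.
  - by apply: eq_integral => r _; rewrite muleCA.
  - exact: emeasurable_funM.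
  - by move=> r _; rewrite mule_ge0.
have pos (k1 k2 : R -> \bar R) : (forall r : R, (0 < r)%R -> k1 r = k2 r) -> J k1 = J k2.
  move=> k12; apply: eq_integral => r _; have [r0|r0] := leP r 0%R.
    by rewrite pwN// !mul0e.
  by rewrite k12.
have J0 k : (forall r, 0 <= k r) -> 0 <= J k.
  by move=> k0; apply: integral_ge0 => r _; rewrite mule_ge0.
have main : J h * J b = J b * J (h \o (fun r => r^-1)%R).
  transitivity (J (fun r => J (fun y => h r * b (r * y)%R))).
    rewrite muleC JZ ?J0//; apply: (pos _ _) => r r0.
    have -> : J b = J (fun y => b (r * y)%R) by rewrite /J (scale1 r0 mb b0).
    by rewrite muleC JZ//; apply: (measurableT_comp mb); exact: measurable_funM.
  rewrite swap; last 2 first.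
  - apply: emeasurable_funM; first exact: (measurableT_comp mh).
    by apply: (measurableT_comp mb); exact: measurable_funM.
  - by move=> x y; rewrite mule_ge0.
  transitivity (J (fun y => J (fun r => h (r * y^-1)%R * b r))).
    apply: (pos _ _) => y y0; rewrite -[RHS](scale1 (h := fun r => h (r * y^-1)%R * b r) y0); last 2 first.
    - apply: emeasurable_funM => //; apply: (measurableT_comp mh); exact: measurable_funM.
    - by move=> r; rewrite mule_ge0.
    by apply: (pos _ _) => r r0; rewrite mulrAC divff ?gt_eqF// mul1r mulrC.
  rewrite -swap; last 2 first.
  - apply: emeasurable_funM; last exact: (measurableT_comp mb).
    apply: (measurableT_comp mh); apply: measurable_funM => //.
    by apply: (measurableT_comp measurable_invr).
  - by move=> x y; rewrite mule_ge0.
  have mhi : measurable_fun setT (h \o (fun r : R => r^-1)%R).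
    by apply: (measurableT_comp mh); exact: measurable_invr.
  rewrite [RHS]muleC JZ//; last by apply: J0 => r /=.
  apply: (pos _ _) => r r0; rewrite [RHS]muleC JZ//; last by move=> x /=.
  have mk : measurable_fun setT (fun y : R => h (r * y^-1)%R * b r).
    apply: emeasurable_funM => //; apply: (measurableT_comp mh); apply: measurable_funM => //.
    exact: measurable_invr.
  have k0 (y : R) : 0 <= h (r * y^-1)%R * b r by rewrite mule_ge0.
  rewrite [LHS](_ : _ = J (fun y => h (r * (r * y)^-1)%R * b r)); last first.
    by rewrite /J (scale1 r0 mk k0).
  apply: (pos _ _) => y y0 /=; rewrite muleC invfM mulrA divff ?gt_eqF// mul1r//.
move: main; have [c c0 ->] := Jb; rewrite muleC => /(congr1 (fun x => (c^-1)%:E * x)).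
rewrite !muleA -!EFinM mulVf ?gt_eqF// !mul1e => E; exact: esym E.
Qed.

(** Write [r^s dr] as [r^(s+1) dr/r] and use the invariance of [dr/r] under inversion. *)
Lemma ge0_integral_pw_inv s (h : R -> \bar R) :
  measurable_fun setT h -> (forall r, 0 <= h r) ->
  \int[mu]_r ((pw s r)%:E * h r^-1%R) = \int[mu]_r ((pw (- s - 2) r)%:E * h r).
Proof.
move=> mh h0.
have := @inv1 (fun r => (pw (- s - 1) r)%:E * h r).
have -> : \int[mu]_r ((pw (-1) r)%:E * ((pw (- s - 1) r^-1)%:E * h r^-1%R)) =
          \int[mu]_r ((pw s r)%:E * h r^-1%R).
  by apply: eq_integral => r _; rewrite muleA -EFinM pwV pwD; congr ((pw _ r)%:E * _); ring.
have -> : \int[mu]_r ((pw (-1) r)%:E * ((pw (- s - 1) r)%:E * h r)) =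
          \int[mu]_r ((pw (- s - 2) r)%:E * h r).
  by apply: eq_integral => r _; rewrite muleA -EFinM pwD; congr ((pw _ r)%:E * _); ring.
apply.
- by apply: emeasurable_funM => //; exact: measurable_EFin_pw.
- by move=> r; rewrite mule_ge0// lee_fin pw_ge0.
Qed.

End power_weight.

Section power_inequalities.
Context {R : realType}.
Implicit Types a b x y s q : R.

Lemma powR_convex a b x y s : 0 <= a -> 0 <= b -> a + b = 1 -> 0 <= x -> 0 <= y ->
  1 <= s -> (a * x + b * y) `^ s <= a * x `^ s + b * y `^ s.
Proof.
move=> a0 b0 ab x0 y0 s1.
have a01 : a <= 1 by rewrite -ab lerDl.
have bE : b = 1 - a by rewrite -ab addrAC subrr add0r.
have := @convex_powR R s s1 (Itv01 a0 a01) x y.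
rewrite !inE/= !in_itv/= !andbT => /(_ x0 y0).
by rewrite bE; exact.
Qed.

(** Joint convexity of [w^(q+1) X^(-q)], the perspective of [t^(q+1)]: convexity is applied at
    [w1 / X] and [w2 / Y] with weights proportional to [a X] and [b Y]. *)
Lemma powR_perspective a b (w1 w2 X Y q : R) : 0 < a -> 0 < b -> 0 < w1 -> 0 < w2 ->
  0 < X -> 0 < Y -> 0 < q ->
  (a * w1 + b * w2) `^ (q + 1) * (a * X + b * Y) `^ (- q) <=
  a * w1 `^ (q + 1) * X `^ (- q) + b * w2 `^ (q + 1) * Y `^ (- q).
Proof.
move=> a0 b0 w10 w20 X0 Y0 q0; set S := a * X + b * Y.
have S0 : 0 < S by rewrite addr_gt0// mulr_gt0.
have q1 : 1 <= q + 1 by rewrite lerDr ltW.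
have ab : a * X / S + b * Y / S = 1 by rewrite -mulrDl divff// gt_eqF.
have aX0 : 0 <= a * X / S by rewrite divr_ge0 ?mulr_ge0 ?ltW.
have bY0 : 0 <= b * Y / S by rewrite divr_ge0 ?mulr_ge0 ?ltW.
have := powR_convex aX0 bY0 ab (ltW (divr_gt0 w10 X0)) (ltW (divr_gt0 w20 Y0)) q1.
have -> : a * X / S * (w1 / X) + b * Y / S * (w2 / Y) = (a * w1 + b * w2) / S.
  by field; rewrite !gt_eqF.
have pq c z : 0 < c -> 0 < z -> (c / z) `^ (q + 1) * z = c `^ (q + 1) * z `^ (- q).
  move=> c0 z0; rewrite powRM ?invr_ge0 ?ltW// powRV// -mulrA; congr (_ * _).
  rewrite -powRN -[X in _ * X]powRr1 ?ltW// -powRD ?(gt_eqF z0) ?implybT//.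
  by congr (_ `^ _); ring.
move=> /(ler_wpM2r (ltW S0)); rewrite pq ?addr_gt0 ?mulr_gt0// => /le_trans; apply.
rewrite le_eqVlt; apply/orP; left; apply/eqP.
rewrite -!mulrA -(pq w1 X)// -(pq w2 Y)//.
by field; rewrite gt_eqF.
Qed.

Lemma powR_geo (F1 F2 c la mb : R) :
  (F1 `^ c) `^ la * (F2 `^ c) `^ mb = (F1 `^ la * F2 `^ mb) `^ c.
Proof.
rewrite (@powRM R _ _ _ (powR_ge0 F1 la) (powR_ge0 F2 mb)) (powRAC F1) (powRAC F2).
by [].
Qed.

End power_inequalities.

(** * Ball's convexity theorem in the plane *)

Section ball_radial.
Context {R : realType}.
Local Notation mu := (@lebesgue_measure R).

Record planar_density (f : R -> R -> R) : Prop := PlanarDensity {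
  pd_meas : measurable_fun setT (fun u : R * R => f u.1 u.2);
  pd_ge0 : forall x y, 0 <= f x y;
  pd_bnd : exists M, forall x y, f x y <= M;
  pd_supp : exists2 D, 0 < D & forall x y, 0 < f x y -> `|x| <= D /\ `|y| <= D;
  pd_pos : exists e d, [/\ 0 < e, 0 < d & forall x y, `|x| < e -> `|y| < e -> d <= f x y];
  pd_logconcave : logconcave (fun u : (R^o * R^o)%type => f u.1 u.2);
  pd_even : forall x y, f (- x) (- y) = f x y }.

(** The exponent [1 - p] collects the polar Jacobian [r] and the factor [r^(-p)] that homogeneity
    takes out of the kernel. *)
Definition radial p (f : R -> R -> R) (x y : R) : \bar R :=
  (\int[mu]_r ((pw (1 - p) r)%:E * (f (r * x) (r * y))%:E))%E.

Variables (p : R) (f : R -> R -> R).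
Hypotheses (p0 : 0 < p) (p1 : p < 1) (pf : planar_density f).

Lemma measurable_ray x y : measurable_fun setT (fun r : R => f (r * x) (r * y)).
Proof.
have mp : measurable_fun setT (fun r : R => (r * x, r * y)).
  by apply: measurable_fun_pair; apply: measurable_funM.
exact: (measurableT_comp (pd_meas pf) mp).
Qed.

(** The integrand after [r = 1 / z]. In the variable [z] the harmonic means of radii natural to
    Ball's theorem become linear combinations, to which the superadditivity of level sets
    applies. *)
Let ballf x y z := pw (p - 3) z * f (z^-1 * x) (z^-1 * y).

Lemma radial_ballf x y : radial p f x y = (\int[mu]_z (ballf x y z)%:E)%E.
Proof.
rewrite /radial /ballf.
have := @ge0_integral_pw_inv R (p - 3) (fun r => (f (r * x) (r * y))%:E).
rewrite (_ : - (p - 3) - 2 = 1 - p); last by ring.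
move=> <-.
- by apply: eq_integral => z _; rewrite EFinM.
- by apply/measurable_EFinP; exact: measurable_ray.
- by move=> r; rewrite lee_fin (pd_ge0 pf).
Qed.

Lemma radial_fin x y : (x != 0) || (y != 0) ->
  exists2 A, 0 < A & radial p f x y = A%:E.
Proof.
move=> xy; pose m := Num.max `|x| `|y|.
have m0 : 0 < m.
  by rewrite lt_max !normr_gt0.
have [M fM] := pd_bnd pf; have [D D0 fD] := pd_supp pf.
have [e [d [e0 d0 fe]]] := pd_pos pf.
have k0 r : (0 <= (pw (1 - p) r)%:E * (f (r * x) (r * y))%:E)%E.
  by rewrite mule_ge0// lee_fin ?pw_ge0// (pd_ge0 pf).
have mk : measurable_fun setT (fun r => (pw (1 - p) r)%:E * (f (r * x) (r * y))%:E)%E.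
  apply: emeasurable_funM; first exact: measurable_EFin_pw.
  by apply/measurable_EFinP; exact: measurable_ray.
have M0 : 0 <= M by rewrite (le_trans _ (fM 0 0))// (pd_ge0 pf).
(* Beyond [T] the ray has left the support of [f], and up to [T] the weight is at most [T^(1-p)]. *)
pose T := D / m; have T0 : 0 < T by rewrite divr_gt0.
have ub : (radial p f x y <= (T `^ (1 - p) * M * T)%:E)%E.
  apply: (@le_trans _ _ (\int[mu]_r ((T `^ (1 - p) * M) * \1_(`[0, T]%classic : set R) r)%:E)%E).
    apply: ge0_le_integral => //.
      apply/measurable_EFinP; apply: measurable_funM => //; exact: measurable_indic.
    move=> r _; rewrite -EFinM lee_fin indicE.
    have [r0|r0] := leP r 0; first by rewrite pwN// mul0r !mulr_ge0 ?powR_ge0.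
    case: (boolP (r \in _)); rewrite ?inE ?notin_setE/= in_itv/= (ltW r0)/= => rT.
      rewrite mulr1 ler_pM ?pw_ge0 ?(pd_ge0 pf)// pwE//.
      by apply: ge0_ler_powR => //; rewrite ?nnegrE ?subr_ge0 ltW.
    suff -> : f (r * x) (r * y) = 0 by rewrite !mulr0.
    apply/eqP; rewrite eq_le (pd_ge0 pf) andbT leNgt; apply/negP => /fD.
    rewrite !normrM gtr0_norm// => -[h1 h2]; apply: rT.
    rewrite ler_pdivlMr// /m maxEle; by case: ifP.
  under eq_integral do rewrite EFinM.
  rewrite ge0_integralZl//; last 2 first.
    - exact: measurable_EFin_indic.
    - by rewrite lee_fin mulr_ge0 ?powR_ge0.
  rewrite integral_indicT//= lebesgue_measure_itv/= lte_fin T0 -EFinD subr0.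
  by rewrite -EFinM.
(* Up to [t] both coordinates of the point on the ray are at most [e / 2], where [f] is bounded
   below. *)
pose t := e / (2 * m); have t0 : 0 < t by rewrite divr_gt0// mulr_gt0.
have t20 : 0 < t / 2 by rewrite divr_gt0.
have lb : (0 < radial p f x y)%E.
  have c0 : 0 < (t / 2) `^ (1 - p) * d by rewrite mulr_gt0 ?powR_gt0.
  have tt : t / 2 < t by rewrite ltr_pdivrMr// ltr_pMr// ltr1n.
  apply: (integral_gt0_itv mk k0 tt c0) => r tr rt; have r0 := lt_le_trans t20 tr.
  rewrite -EFinM lee_fin ler_pM ?powR_ge0 ?(ltW d0)//.
    by rewrite pwE// ge0_ler_powR// ?nnegrE ?subr_ge0 ?(ltW p1) ?(ltW r0)// divr_ge0 ?ltW.
  have rm z : `|z| <= m -> `|r * z| < e.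
    move=> zm; rewrite normrM gtr0_norm//; apply: (@le_lt_trans _ _ (t * m)).
      by rewrite ler_pM ?(ltW r0).
    have -> : t * m = e / 2 by rewrite /t; field; rewrite gt_eqF.
    by rewrite ltr_pdivrMr// ltr_pMr// ltr1n.
  by apply: fe; apply: rm; rewrite le_max lexx ?orbT.
have fin : radial p f x y \is a fin_num.
  rewrite ge0_fin_numE; first by rewrite (le_lt_trans ub)// ltry.
  by apply: integral_ge0.
exists (fine (radial p f x y)); last by rewrite fineK.
by rewrite -lte_fin fineK.
Qed.

Let s_gt0 : 0 < 3 - p. Proof. by rewrite subr_gt0 (lt_trans p1)// ltr1n. Qed.

Let powK (t : R) : 0 < t -> (t `^ (- (3 - p)^-1)) `^ (- (3 - p)) = t.
Proof.
move=> t0; rewrite -powRrM (_ : _ * _ = 1) ?powRr1 ?ltW//.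
by field; rewrite gt_eqF.
Qed.

Let powKV (t : R) : 0 < t -> (t `^ (- (3 - p))) `^ (- (3 - p)^-1) = t.
Proof.
move=> t0; rewrite -powRrM (_ : _ * _ = 1) ?powRr1 ?ltW//.
by field; rewrite gt_eqF.
Qed.

Let gt0_powRN_lt (c t u : R) : 0 < c -> 0 < t -> t < u -> u `^ (- c) < t `^ (- c).
Proof.
move=> c0 t0 tu; have u0 := lt_trans t0 tu.
rewrite !powRN ltf_pV2 ?posrE ?powR_gt0//.
by apply: gt0_ltr_powR => //; rewrite nnegrE ltW.
Qed.

(* The function [z f(u/z)^(-1/s)], [s = 3 - p], is the perspective of a convex function of
   [u], hence jointly convex in [(u, z)]. *)
Let ballf_combine (a b x1 y1 x2 y2 z1 z2 t1 t2 : R) : 0 < a -> 0 < b -> a + b = 1 ->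
  0 < t1 -> 0 < t2 ->
  t1 `^ (- (3 - p)) < ballf x1 y1 z1 -> t2 `^ (- (3 - p)) < ballf x2 y2 z2 ->
  (a * t1 + b * t2) `^ (- (3 - p)) <
    ballf (a * x1 + b * x2) (a * y1 + b * y2) (a * z1 + b * z2).
Proof.
move=> a0 b0 ab t10 t20.
have aux x y z t : 0 < t -> t `^ (- (3 - p)) < ballf x y z ->
    [/\ 0 < z, 0 < f (z^-1 * x) (z^-1 * y) &
        z * f (z^-1 * x) (z^-1 * y) `^ (- (3 - p)^-1) < t].
  move=> t0; rewrite /ballf; have [z0|z0] := leP z 0.
    by rewrite pwN// mul0r ltNge powR_ge0.
  rewrite pwE// => H.
  have F0 : 0 < f (z^-1 * x) (z^-1 * y).
    rewrite lt_neqAle (pd_ge0 pf) andbT eq_sym; apply/eqP => E.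
    by move: H; rewrite E mulr0 ltNge powR_ge0.
  split => //.
  have := @gt0_powRN_lt (3 - p)^-1 _ _ _ _ H.
  rewrite invr_gt0 s_gt0 powR_gt0// => /(_ isT isT).
  rewrite powKV// powRM ?powR_ge0 ?ltW//.
  by rewrite (_ : p - 3 = - (3 - p)) ?powKV//; ring.
move=> /(aux _ _ _ _ t10)[z10 F10 h1] /(aux _ _ _ _ t20)[z20 F20 h2].
set x3 := a * x1 + b * x2; set y3 := a * y1 + b * y2; set z := a * z1 + b * z2.
have z0 : 0 < z by rewrite addr_gt0// mulr_gt0.
pose la := a * z1 / z; pose mb := b * z2 / z.
have la0 : 0 < la by rewrite divr_gt0// mulr_gt0.
have mb0 : 0 < mb by rewrite divr_gt0// mulr_gt0.
have lamb : la + mb = 1 by rewrite -mulrDl divff// gt_eqF.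
set F1 := f _ _ in F10 h1; set F2 := f _ _ in F20 h2.
have F3ge : F1 `^ la * F2 `^ mb <= f (z^-1 * x3) (z^-1 * y3).
  have := pd_logconcave pf (z1^-1 * x1, z1^-1 * y1) (z2^-1 * x2, z2^-1 * y2) la0 mb0 lamb.
  rewrite /= /GRing.scale/= -/F1 -/F2.
  rewrite (_ : la * _ + mb * _ = z^-1 * x3); last first.
    by rewrite /la /mb /x3; field; rewrite !gt_eqF.
  rewrite (_ : la * _ + mb * _ = z^-1 * y3)//.
  by rewrite /la /mb /y3; field; rewrite !gt_eqF.
set F3 := f (z^-1 * x3) _ in F3ge *.
have F30 : 0 < F3 by apply: lt_le_trans F3ge; rewrite mulr_gt0 ?powR_gt0.
have si0 : 0 < (3 - p)^-1 by rewrite invr_gt0.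
have key : z * F3 `^ (- (3 - p)^-1) < a * t1 + b * t2.
  apply: (@le_lt_trans _ _ (z * ((F1 `^ (- (3 - p)^-1)) `^ la * (F2 `^ (- (3 - p)^-1)) `^ mb))).
    rewrite ler_pM2l// powR_geo.
    rewrite !powRN lef_pV2 ?posrE ?powR_gt0 ?mulr_gt0 ?powR_gt0//.
      by apply: ge0_ler_powR => //; rewrite ?nnegrE ?mulr_ge0 ?powR_ge0 ?(ltW F30) ?(ltW si0).
      apply: (@le_lt_trans _ _ (z * (la * F1 `^ (- (3 - p)^-1) + mb * F2 `^ (- (3 - p)^-1)))).
    by rewrite ler_pM2l// powR_amgm// powR_ge0.
  rewrite mulrDr.
  rewrite (_ : z * (la * F1 `^ (- (3 - p)^-1)) = a * (z1 * F1 `^ (- (3 - p)^-1))); last first.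
    by rewrite /la; field; rewrite gt_eqF.
  rewrite (_ : z * (mb * F2 `^ (- (3 - p)^-1)) = b * (z2 * F2 `^ (- (3 - p)^-1))); last first.
    by rewrite /mb; field; rewrite gt_eqF.
  by rewrite ltrD// ltr_pM2l.
have := gt0_powRN_lt s_gt0 (mulr_gt0 z0 (powR_gt0 _ F30)) key.
rewrite powRM ?powR_ge0 ?ltW// powK//.
by rewrite /ballf pwE// -/F3 opprB.
Qed.

Let measurable_ballf x y : measurable_fun setT (ballf x y).
Proof.
apply: measurable_funM; first exact: measurable_pw.
exact: (measurableT_comp (measurable_ray x y) measurable_invr).
Qed.

Let ballf_ge0 x y z : 0 <= ballf x y z.
Proof. by rewrite mulr_ge0 ?pw_ge0 ?(pd_ge0 pf). Qed.

(** The factor [z^(p-3)] blows up at 0, but the support of [f] keeps [z] above [m / D]; its decay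
    for large [z] bounds the superlevel sets. They are intervals by [ballf_combine] with both base
    points equal. *)
Let ballf_tent x y : (x != 0) || (y != 0) ->
  exists2 w, 0 < w & tent_like (ballf x y) w.
Proof.
move=> xy; pose m := Num.max `|x| `|y|.
have m0 : 0 < m by rewrite lt_max !normr_gt0.
have [M fM] := pd_bnd pf; have [D D0 fD] := pd_supp pf.
have [e [d [e0 d0 fe]]] := pd_pos pf.
have M0 : 0 <= M by rewrite (le_trans _ (fM 0 0))// (pd_ge0 pf).
have bnd z : ballf x y z <= (m / D) `^ (p - 3) * M.
  rewrite /ballf; have [z0|z0] := leP z 0.
    by rewrite pwN// mul0r mulr_ge0// powR_ge0.
  have [F0|F0] := leP (f (z^-1 * x) (z^-1 * y)) 0.
    by rewrite (_ : f _ _ = 0) ?mulr0 ?mulr_ge0 ?powR_ge0//; apply/eqP; rewrite eq_le F0 (pd_ge0 pf).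
  rewrite ler_pM ?pw_ge0 ?(pd_ge0 pf)// pwE//.
  have mz : m / D <= z.
    have [h1 h2] := fD _ _ F0; rewrite ler_pdivrMr//.
    move: h1 h2; rewrite !normrM gtr0_norm ?invr_gt0// !ler_pdivrMl// => h1 h2.
    by rewrite /m ge_max h1 h2.
  have mD0 : 0 < m / D by rewrite divr_gt0.
  rewrite (_ : p - 3 = - (3 - p)); last by ring.
  rewrite !powRN lef_pV2 ?posrE ?powR_gt0//.
  by apply: ge0_ler_powR => //; rewrite ?nnegrE ?(ltW s_gt0) ?(ltW mD0) ?(ltW z0).
have [z bz] : exists z, 0 < ballf x y z.
  pose z := 2 * m / e; have z0 : 0 < z by rewrite divr_gt0// mulr_gt0.
  exists z; rewrite /ballf pwE// mulr_gt0 ?powR_gt0//; apply: (lt_le_trans d0).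
  have h u : `|u| <= m -> `|z^-1 * u| < e.
    move=> um; rewrite normrM gtr0_norm ?invr_gt0// ltr_pdivrMl// /z divfK ?gt_eqF//.
    by apply: (le_lt_trans um); rewrite ltr_pMl// ltr1n.
  by apply: fe; apply: h; rewrite le_max lexx ?orbT.
have hs : has_sup (range (ballf x y)).
  by split; [exists (ballf x y z), z|exists ((m / D) `^ (p - 3) * M) => _ [u _ <-]].
have fs u : ballf x y u <= sup (range (ballf x y)) by apply: (ub_le_sup hs.2); exists u.
exists (sup (range (ballf x y))); first exact: lt_le_trans (fs z).
split => //.
- by move=> u; rewrite ballf_ge0 fs.
- by move=> u /(sup_gt hs.1)[_ [v _ <-]] uv; exists v.
- move=> t t0; split.
    move=> u v r /= tu tv /andP[ur rv].
    have [->//|uNr] := eqVneq r u; have [->//|vNr] := eqVneq r v.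
    have {}ur : u < r by rewrite lt_neqAle eq_sym uNr.
    have {}rv : r < v by rewrite lt_neqAle vNr.
    have vu : 0 < v - u by lra.
    have ab : (v - r) / (v - u) + (r - u) / (v - u) = 1.
      by rewrite -mulrDl addrA subrK divff// gt_eqF.
    have a0 : 0 < (v - r) / (v - u) by rewrite divr_gt0// subr_gt0.
    have b0 : 0 < (r - u) / (v - u) by rewrite divr_gt0// subr_gt0.
    pose T := t `^ (- (3 - p)^-1); have T0 : 0 < T by exact: powR_gt0.
    have := @ballf_combine _ _ x y x y u v T T a0 b0 ab T0 T0.
    rewrite /T powK// => /(_ tu tv).
    have cE w : (v - r) / (v - u) * w + (r - u) / (v - u) * w = w by rewrite -mulrDl ab mul1r.
    rewrite !cE powK// (_ : _ * u + _ * v = r)//.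
    by field; rewrite gt_eqF.
  exists ((M / t) `^ (3 - p)^-1) => u; rewrite /ballf.
  have [u0|u0] := leP u 0; first by rewrite pwN// mul0r ltNge (ltW t0).
  rewrite pwE// gtr0_norm// => h.
  have {}h : t < u `^ (- (3 - p)) * M.
    apply: (lt_le_trans h); rewrite (_ : - (3 - p) = p - 3); last by ring.
    by rewrite ler_wpM2l ?powR_ge0.
  rewrite [leLHS](_ : _ = (u `^ (3 - p)) `^ (3 - p)^-1); last first.
    by rewrite -powRrM divff ?powRr1 ?(ltW u0)// gt_eqF.
  apply: ge0_ler_powR; rewrite ?nnegrE ?powR_ge0 ?divr_ge0 ?invr_ge0 ?(ltW t0) ?(ltW s_gt0)//.
  rewrite ler_pdivlMr//; move: h; rewrite powRN mulrC ltr_pdivlMr ?powR_gt0// => /ltW.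
  by rewrite mulrC.
Qed.

(** Writing the suprema as [c1^(p-3)] and [c2^(p-3)], the level sets give [a c1^(3-p) A1 + b
    c2^(3-p) A2 <= C^(3-p) A3]. The perspective inequality with [q = 2 - p] bounds the left side
    below by [C^(3-p)] times the desired mean, so the unknown suprema cancel. *)
Theorem ball_radial_convex (a b x1 y1 x2 y2 A1 A2 A3 : R) : 0 < a -> 0 < b -> a + b = 1 ->
  (x1 != 0) || (y1 != 0) -> (x2 != 0) || (y2 != 0) ->
  0 < A1 -> 0 < A2 -> 0 < A3 ->
  radial p f x1 y1 = A1%:E -> radial p f x2 y2 = A2%:E ->
  radial p f (a * x1 + b * x2) (a * y1 + b * y2) = A3%:E ->
  A3 `^ (- (2 - p)^-1) <= a * A1 `^ (- (2 - p)^-1) + b * A2 `^ (- (2 - p)^-1).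
Proof.
move=> a0 b0 ab n1 n2 A10 A20 A30 E1 E2 E3.
have [w1 w10 t1] := ballf_tent n1; have [w2 w20 t2] := ballf_tent n2.
have [c1 c10 w1E] : exists2 o : R, 0 < o & w1 = o `^ (- (3 - p)).
  by exists (w1 `^ (- (3 - p)^-1)); [exact: powR_gt0|rewrite powK].
have [c2 c20 w2E] : exists2 o : R, 0 < o & w2 = o `^ (- (3 - p)).
  by exists (w2 `^ (- (3 - p)^-1)); [exact: powR_gt0|rewrite powK].
pose C := a * c1 + b * c2; have C0 : 0 < C by rewrite addr_gt0// mulr_gt0.
pose w3 := C `^ (- (3 - p)); have w30 : 0 < w3 by exact: powR_gt0.
have q0 : 0 < 2 - p by rewrite subr_gt0 (lt_trans p1)// ltr1n.
have := superlevel_superadd (ltW a0) (ltW b0) w10 w20 w30 t1 t2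
  (measurable_ballf (a * x1 + b * x2) (a * y1 + b * y2)) (ballf_ge0 _ _).
rewrite -!radial_ballf E1 E2 E3 -!EFinM -EFinD lee_fin => main.
have {}main : a / w1 * A1 + b / w2 * A2 <= w3^-1 * A3.
  apply: main => z1 z2 y /andP[y0 y1'] h1 h2.
  pose T := y `^ (- (3 - p)^-1); have T0 : 0 < T by exact: powR_gt0.
  have yE : y = T `^ (- (3 - p)) by rewrite powK.
  have oT (o : R) : 0 < o -> (o * T) `^ (- (3 - p)) = o `^ (- (3 - p)) * y.
    by move=> o0; rewrite powRM ?(ltW o0) ?(ltW T0)// -yE.
  have := @ballf_combine a b x1 y1 x2 y2 z1 z2 (c1 * T) (c2 * T) a0 b0 ab
    (mulr_gt0 c10 T0) (mulr_gt0 c20 T0).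
  rewrite !oT// -w1E -w2E => /(_ h1 h2).
  by rewrite !mulrA -mulrDl oT.
set q := 2 - p in q0 *.
have sq : 3 - p = q + 1 by rewrite /q; ring.
pose X1 := A1 `^ (- q^-1); pose X2 := A2 `^ (- q^-1).
have X10 : 0 < X1 by exact: powR_gt0.
have X20 : 0 < X2 by exact: powR_gt0.
have XA (A : R) : 0 < A -> (A `^ (- q^-1)) `^ (- q) = A.
  move=> A0; rewrite -powRrM (_ : _ * _ = 1) ?powRr1 ?(ltW A0)//.
  by field; rewrite gt_eqF.
have := powR_perspective a0 b0 c10 c20 X10 X20 q0.
rewrite (XA _ A10) (XA _ A20) -/C -sq => persp.
have wV (o : R) : (o `^ (- (3 - p)))^-1 = o `^ (3 - p) by rewrite powRN invrK.
rewrite w1E w2E /w3 !wV in main.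
have {persp main} := le_trans persp main.
rewrite ler_pM2l ?powR_gt0// -/X1 -/X2 => h.
set S := a * X1 + b * X2 in h *.
have S0 : 0 < S by rewrite addr_gt0// mulr_gt0.
have -> : S = (S `^ (- q)) `^ (- q^-1).
  rewrite -powRrM (_ : _ * _ = 1) ?powRr1 ?(ltW S0)//.
  by field; rewrite gt_eqF.
rewrite ![_ `^ (- q^-1)]powRN lef_pV2 ?posrE ?powR_gt0//.
by apply: ge0_ler_powR; rewrite ?nnegrE ?powR_ge0 ?invr_ge0 ?(ltW q0) ?(ltW A30).
Qed.

End ball_radial.

(** * Symmetric decreasing kernels against unimodal densities *)

Section unimodal.
Context {R : realType}.
Local Notation mu := (@lebesgue_measure R).

(** Without the truncations at 0 this is the concavity of the overlap length in the shift [a]; that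
    the interval contains 0 takes care of the truncations. *)
Lemma shifted_overlap (l r a h : R) : l <= 0 -> 0 <= r -> 0 < h ->
  Num.max 0 (Num.min r (h - a) - Num.max l (- h - a)) +
  Num.max 0 (Num.min r (h + a) - Num.max l (- h + a)) <=
  2 * Num.max 0 (Num.min r h - Num.max l (- h)).
Proof.
move=> l0 r0 h0.
set m1 := Num.min r (h - a); set M1 := Num.max l (- h - a).
set m2 := Num.min r (h + a); set M2 := Num.max l (- h + a).
have : m1 <= r /\ m1 <= h - a by split; rewrite ge_min lexx ?orbT.
have : m2 <= r /\ m2 <= h + a by split; rewrite ge_min lexx ?orbT.
have : l <= M1 /\ - h - a <= M1 by split; rewrite le_max lexx ?orbT.
have : l <= M2 /\ - h + a <= M2 by split; rewrite le_max lexx ?orbT.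
move=> [p1 p2] [p3 p4] [p5 p6] [p7 p8].
by case: (leP r h) => rh; case: (leP l (- h)) => lh; rewrite [X in _ <= 2 * X]max_r; try lra;
  case: (leP 0 (m1 - M1)) => u0; case: (leP 0 (m2 - M2)) => v0; lra.
Qed.

Lemma overlap_le (J : set R) (a h : R) : measurable J -> ivl J -> J 0 ->
  (mu (J `&` [set x | `|x + a| < h]%R) + mu (J `&` [set x | `|x - a| < h]%R) <=
   2%:E * mu (J `&` [set x | `|x| < h]%R))%E.
Proof.
move=> mJ iJ J0.
have [h0|h0] := leP h 0.
  have E (c : R) : [set x : R | `|x + c| < h] = set0.
    by apply/seteqP; split => x //= /(le_lt_trans (normr_ge0 _)); rewrite ltNge h0.
  by rewrite !E setI0 measure0 adde0 mule_ge0.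
(* All three windows lie in [[- N, N]], so [J] can be cut to a bounded interval, which has a
   supremum and an infimum. *)
pose N := h + `|a|; pose JN := J `&` `[- N, N]%classic.
have N0 : 0 <= N by rewrite /N addr_ge0 ?(ltW h0).
have mS (c : R) : measurable (JN `&` [set x | `|x + c| < h]).
  have -> : [set x | `|x + c| < h] = `]- h - c, h - c[%classic.
    by apply/seteqP; split => x /=; rewrite in_itv/= ltr_norml => /andP[? ?]; apply/andP; split; lra.
  by apply: measurableI => //; exact: measurableI.
have JNE (c : R) : `|c| <= `|a| -> J `&` [set x | `|x + c| < h] = JN `&` [set x | `|x + c| < h].
  move=> ca; apply/seteqP; split => x [Jx /= xc]; last by split => //; case: Jx.
  split => //; split => //=; move: xc; rewrite in_itv/= ltr_norml => /andP[xc1 xc2].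
  have := lerNnormlW ca; have := le_trans (ler_norm c) ca.
  by rewrite /N => c1 c2; apply/andP; split; lra.
have JN0 : JN 0 by split => //=; rewrite in_itv/= oppr_le0 N0.
have hs : has_sup JN by split; [exists 0|exists N => x [_] /=; rewrite in_itv/= => /andP[]].
have hi : has_inf JN by split; [exists 0|exists (- N) => x [_] /=; rewrite in_itv/= => /andP[]].
have len (c : R) : mu (JN `&` [set x | `|x + c| < h]) =
    (Num.max 0 (Num.min (sup JN) (h - c) - Num.max (inf JN) (- h - c)))%:E.
  apply: lebesgue_measure_between => // [x|x [Jx /=]]; rewrite /= ?in_itv/= ?ltr_norml.
    rewrite gt_max lt_min => /andP[/andP[xi x1] /andP[xs x2]].
    have [y [Jy yN] xy] := sup_gt hs.1 xs; have [z [Jz zN] zx] := inf_lt hi.1 xi.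
    split; last by rewrite /= ?ltr_norml; apply/andP; split; lra.
    split; first by apply: (iJ z y) => //; rewrite (ltW zx) (ltW xy).
    move: yN zN; rewrite /= !in_itv/= => /andP[_ yN] /andP[zN _].
    by rewrite (le_trans zN (ltW zx)) (le_trans (ltW xy) yN).
  move=> /andP[x1 x2]; rewrite ge_max le_min (ub_le_sup hs.2 Jx) (ge_inf hi.2 Jx).
  by lra.
have -> : J `&` [set x | `|x| < h] = JN `&` [set x | `|x + 0| < h].
  by rewrite -JNE ?normr0//; congr (_ `&` _); apply: eq_set => x; rewrite addr0.
rewrite (JNE a)// (JNE (- a)) ?normrN// !len -EFinD -EFinM lee_fin !subr0 !opprK.
by apply: shifted_overlap => //; [exact: (ge_inf hi.2)|exact: (ub_le_sup hs.2)].
Qed.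

(** Slicing [g] into intervals around 0 and [k] into centred windows reduces the inequality to
    overlaps of the two, level by level. *)
Lemma unimodal_kernel (a : R) (g k : R -> R) :
  measurable_fun setT g -> measurable_fun setT k ->
  (forall x, 0 <= g x) -> (forall x, 0 <= k x) ->
  (forall x y, 0 <= x -> x <= y -> g y <= g x) ->
  (forall x y, x <= y -> y <= 0 -> g x <= g y) ->
  (forall z, 0 < z -> exists h, forall u, (z < k u) = (`|u| < h)) ->
  (\int[mu]_x ((g x)%:E * (k (x + a)%R)%:E) + \int[mu]_x ((g x)%:E * (k (x - a)%R)%:E) <=
   2%:E * \int[mu]_x ((g x)%:E * (k x)%:E))%E.
Proof.
move=> mg mk g0 k0 gd gi kh.
have mkc (c : R) : measurable_fun setT (fun x : R => k (x + c)).
  by apply: (measurableT_comp mk); exact: measurable_funD.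
have mEk (c : R) : measurable_fun setT (fun x : R => (k (x + c))%:E) by exact/measurable_EFinP.
have kE0 (c x : R) : (0 <= (k (x + c))%:E)%E by rewrite lee_fin.
have k_k0 : k = fun x : R => k (x + 0) by apply/funext => x; rewrite addr0.
have lev (c : R) := layer_cake_mul mu measurableT mg g0 (mEk c) (kE0 c).
have mlev (c : R) := measurable_integral_superlevel mu measurableT mg (mEk c) (kE0 c).
rewrite [in leRHS]k_k0 !lev.
have Ipos (c y : R) : (0 <= \int[mu]_(x in setT `&` [set x | (y < g x)%R]) (k (x + c)%R)%:E)%E.
  exact: integral_ge0.
rewrite -ge0_integralD//; [|exact: mlev|exact: mlev].
rewrite -ge0_integralZl//; last exact: mlev.
apply: ge0_le_integral => //.
- by move=> y _; rewrite adde_ge0.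
- by apply: emeasurable_funD; exact: mlev.
- by apply: measurable_funeM; exact: mlev.
move=> y; rewrite /= in_itv/= andbT => y0; rewrite setTI.
set J := [set x | y < g x].
have mJ : measurable J by exact: measurable_superlevel.
have J0 x : J x -> J 0.
  move=> yx; apply: (lt_le_trans yx); have [x0|x0] := leP 0 x; first exact: gd.
  by apply: gi => //; exact: ltW.
have iJ : ivl J.
  move=> u v x Ju Jv /andP[ux xv]; have [x0|x0] := leP 0 x.
    exact: lt_le_trans Jv (gd _ _ x0 xv).
  exact: lt_le_trans Ju (gi _ _ ux (ltW x0)).
have lev2 (c : R) := layer_cake mu mJ (mkc c) (fun x => k0 (x + c)).
have mlev2 (c : R) := measurable_measure_superlevel mu mJ (mkc c).
rewrite !lev2 -ge0_integralD//; [|exact: mlev2|exact: mlev2].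
rewrite -ge0_integralZl//; last exact: mlev2.
apply: ge0_le_integral => //.
- by move=> z _; rewrite adde_ge0.
- by apply: emeasurable_funD; exact: mlev2.
- by apply: measurable_funeM; exact: mlev2.
move=> z; rewrite /= in_itv/= andbT => z0.
have [h Hh] := kh z z0.
have E (c : R) : [set x | z < k (x + c)] = [set x | `|x + c| < h].
  by apply/seteqP; split => x /=; rewrite Hh.
rewrite !E; have [JE|/set0P[v /J0 Jz]] := eqVneq J set0.
  by rewrite JE !set0I !measure0 adde0 mule0.
have := @overlap_le J a h mJ iJ Jz.
by rewrite (_ : [set x | `|x| < h] = [set x | `|x + 0| < h])//; apply/seteqP; split => x /=; rewrite addr0.
Qed.

End unimodal.

(** * The homogeneous kernel as an average of Poisson kernels *)

Section kernel.
Context {R : realType}.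
Local Notation mu := (@lebesgue_measure R).

(** For [e > 0], the Laplace transform of [cos (r u)] at [e]. The absolute value keeps it
    nonnegative for every real [e]. *)
Definition kern (e u : R) : R := `|e| / (e ^+ 2 + u ^+ 2).

Lemma kern_ge0 e u : 0 <= kern e u.
Proof. by rewrite divr_ge0// addr_ge0// sqr_ge0. Qed.

Lemma kernN e u : kern e (- u) = kern e u.
Proof. by rewrite /kern sqrrN. Qed.

Lemma kernZ c e u : 0 < c -> kern (c * e) (c * u) = c^-1 * kern e u.
Proof.
move=> c0; rewrite /kern normrM gtr0_norm// !exprMn -mulrDr invfM.
rewrite expr2 invfM !mulrA; congr (_ * _); rewrite mulrC !mulrA mulVf ?gt_eqF// mul1r.
by rewrite mulrC.
Qed.

Lemma measurable_kern : measurable_fun setT (fun u : R * R => kern u.1 u.2).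
Proof.
apply: measurable_funM; first by apply: measurableT_comp => //; exact: measurable_fst.
apply: (measurableT_comp (@measurable_invr R)).
by apply: measurable_funD; apply: measurable_funX; [exact: measurable_fst|exact: measurable_snd].
Qed.

Lemma kern_superlevel e z : 0 < e -> 0 < z ->
  exists h, forall u, (z < kern e u) = (`|u| < h).
Proof.
(* If [e / z - e ^+ 2] is not positive, [Num.sqrt] returns 0 and the superlevel set is empty, as it
   should be. *)
move=> e0 z0; exists (Num.sqrt (e / z - e ^+ 2)) => u.
have d0 : 0 < e ^+ 2 + u ^+ 2 by rewrite ltr_wpDr ?sqr_ge0// exprn_gt0.
rewrite /kern gtr0_norm// ltr_pdivlMr// mulrC -ltr_pdivlMr//.
have [h|h] := ltP 0 (e / z - e ^+ 2).
  by rewrite -sqrtr_sqr ltr_sqrt// ltrBrDl.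
rewrite ler0_sqrtr// [RHS]ltNge normr_ge0/=; apply/negP; rewrite -ltrBrDl => h2.
by have := lt_le_trans h2 h; rewrite ltNge sqr_ge0.
Qed.

Local Open Scope ereal_scope.

(** For [0 < p < 1] a constant multiple of [|u|^(-p)], infinite at [u = 0]. The constant is never
    computed; evenness, homogeneity and unimodality carry the argument. *)
Definition pkern p (u : R) : \bar R := \int[mu]_e ((pw (- p) e)%:E * (kern e u)%:E).

Lemma pkern_ge0 p u : 0 <= pkern p u.
Proof. by apply: integral_ge0 => e _; rewrite mule_ge0// lee_fin ?pw_ge0 ?kern_ge0. Qed.

Lemma pkernN p u : pkern p (- u)%R = pkern p u.
Proof. by apply: eq_integral => e _; rewrite kernN. Qed.

Let mpk p : measurable_fun setT (fun v : R * R => (pw (- p) v.2)%:E * (kern v.2 v.1)%:E).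
Proof.
apply: emeasurable_funM; apply/measurable_EFinP.
  by apply: (measurableT_comp (measurable_pw _)); exact: measurable_snd.
have msw : measurable_fun setT (fun v : R * R => (v.2, v.1)).
  by apply: measurable_fun_pair; [exact: measurable_snd|exact: measurable_fst].
exact: (measurableT_comp measurable_kern msw).
Qed.

Let pk0 p (v : R * R) : 0 <= (pw (- p) v.2)%:E * (kern v.2 v.1)%:E.
Proof. by rewrite mule_ge0// lee_fin ?pw_ge0 ?kern_ge0. Qed.

Lemma measurable_pkern p : measurable_fun setT (pkern p).
Proof. exact: (@measurable_fun_fubini_tonelli_F _ _ _ _ R mu _ (mpk p) (pk0 p)). Qed.

Lemma pkernZ p c u : (c != 0)%R -> pkern p (c * u)%R = (`|c| `^ (- p))%:E * pkern p u.
Proof.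
move=> cn0; wlog c0 : c cn0 / (0 < c)%R => [hw|].
  have [/hw|c0|] := ltgtP 0%R c; [exact| |by move=> /esym/eqP; rewrite (negbTE cn0)].
  by rewrite -pkernN -mulNr -normrN; apply: hw; rewrite ?oppr_eq0// oppr_gt0.
rewrite gtr0_norm// /pkern.
have mk : measurable_fun setT (fun e : R => (kern e (c * u))%:E).
  by apply/measurable_EFinP; exact: (measurableT_comp measurable_kern (measurable_pair2 (c * u)%R)).
have mk' : measurable_fun setT (fun e : R => (kern e u)%:E).
  by apply/measurable_EFinP; exact: (measurableT_comp measurable_kern (measurable_pair2 u)).
rewrite -(ge0_integral_pw_scale (- p) c0 mk) => [|e]; last by rewrite lee_fin kern_ge0.
have -> : \int[mu]_r ((pw (- p) r)%:E * (kern (c * r) (c * u))%:E) = (c^-1)%:E * \int[mu]_r ((pw (- p) r)%:E * (kern r u)%:E).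
  rewrite -ge0_integralZl.
  - by apply: eq_integral => r _; rewrite kernZ// EFinM muleCA.
  - by [].
  - by apply: emeasurable_funM => //; exact: measurable_EFin_pw.
  - by move=> r _; rewrite mule_ge0// lee_fin ?pw_ge0 ?kern_ge0.
  - by rewrite lee_fin invr_ge0 ltW.
rewrite muleA -EFinM; congr (_%:E * _).
rewrite powRD; last by rewrite (gt_eqF c0) implybT.
by rewrite (powRr1 (ltW c0)) mulfK// gt_eqF.
Qed.

(** Each [kern e] with [e > 0] satisfies the inequality, and Tonelli lets it pass to their weighted
    average. This keeps the level sets of the infinite-valued [pkern] out of the argument. *)
Lemma unimodal_pkern p (a : R) (g : R -> R) : measurable_fun setT g ->
  (forall x, 0 <= g x)%R ->
  (forall x y, 0 <= x -> x <= y -> g y <= g x)%R ->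
  (forall x y, x <= y -> y <= 0 -> g x <= g y)%R ->
  \int[mu]_x ((g x)%:E * pkern p (x + a)) + \int[mu]_x ((g x)%:E * pkern p (x - a)) <=
  2%:E * \int[mu]_x ((g x)%:E * pkern p x).
Proof.
move=> mg g0 gd gi.
have mEg : measurable_fun setT (fun x : R => (g x)%:E) by exact/measurable_EFinP.
have mS (c : R) : measurable_fun setT (fun v : R * R => ((g v.1)%:E * (kern v.2 (v.1 + c))%:E)).
  apply: emeasurable_funM; apply/measurable_EFinP.
    by apply: (measurableT_comp mg); exact: measurable_fst.
  have msw : measurable_fun setT (fun v : R * R => (v.2, (v.1 + c)%R)).
    apply: measurable_fun_pair; first exact: measurable_snd.
    by apply: measurable_funD => //; exact: measurable_fst.
  exact: (measurableT_comp measurable_kern msw).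
have S0 (c : R) (v : R * R) : 0 <= (g v.1)%:E * (kern v.2 (v.1 + c))%:E.
  by rewrite mule_ge0// lee_fin ?kern_ge0.
pose I (c e : R) := \int[mu]_x ((g x)%:E * (kern e (x + c))%:E).
have mI (c : R) : measurable_fun setT (I c).
  exact: (@measurable_fun_fubini_tonelli_G _ _ _ _ R mu _ (mS c) (S0 c)).
have I0 (c e : R) : 0 <= I c e.
  by apply: integral_ge0 => x _; rewrite mule_ge0// lee_fin ?kern_ge0.
have mW := @measurable_EFin_pw R (- p).
have swap (c : R) : \int[mu]_x ((g x)%:E * pkern p (x + c)) =
    \int[mu]_e ((pw (- p) e)%:E * I c e).
  pose l (v : R * R) := (pw (- p) v.2)%:E * ((g v.1)%:E * (kern v.2 (v.1 + c))%:E).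
  have ml : measurable_fun setT l.
    by apply: emeasurable_funM => //; exact: (measurableT_comp mW).
  have l0 v : 0 <= l v by rewrite mule_ge0// lee_fin pw_ge0.
  transitivity (\int[mu]_x \int[mu]_e l (x, e)).
    apply: eq_integral => x _; rewrite /pkern -ge0_integralZl.
    - by apply: eq_integral => e _; rewrite /l muleCA.
    - by [].
    - apply: emeasurable_funM => //; apply/measurable_EFinP.
      exact: (measurableT_comp measurable_kern (measurable_pair2 (x + c)%R)).
    - by move=> e _; rewrite mule_ge0// lee_fin ?pw_ge0 ?kern_ge0.
    - by rewrite lee_fin.
  rewrite (@fubini_tonelli _ _ _ _ R mu mu l ml l0); apply: eq_integral => e _; rewrite /I -ge0_integralZl.
  - by [].
  - by [].
  - exact: (measurableT_comp (mS c) (measurable_pair2 e)).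
  - by move=> x _; rewrite mule_ge0// lee_fin ?kern_ge0.
  - by rewrite lee_fin pw_ge0.
have -> : \int[mu]_x ((g x)%:E * pkern p x) = \int[mu]_x ((g x)%:E * pkern p (x + 0)).
  by apply: eq_integral => x _; rewrite addr0.
have mWI (c : R) : measurable_fun setT (fun e => (pw (- p) e)%:E * I c e).
  exact: emeasurable_funM.
have WI0 (c e : R) : 0 <= (pw (- p) e)%:E * I c e by rewrite mule_ge0// lee_fin pw_ge0.
rewrite !swap -(ge0_integralD mu measurableT (fun e _ => WI0 a e) (mWI a) (fun e _ => WI0 (- a)%R e) (mWI (- a)%R)).
rewrite -(ge0_integralZl mu measurableT (mWI 0%R) (fun e _ => WI0 0%R e)); last by rewrite lee_fin.
apply: ge0_le_integral => //.
- by move=> e _; rewrite adde_ge0.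
- by apply: emeasurable_funD; exact: mWI.
- by apply: measurable_funeM; exact: mWI.
move=> e _; have [e0|e0] := leP e 0%R.
  by rewrite pwN// !mul0e mule0 adde0.
rewrite -ge0_muleDr// muleCA; apply: lee_wpmul2l; first by rewrite lee_fin pw_ge0.
have mke : measurable_fun setT (kern e).
  exact: (measurableT_comp measurable_kern (measurable_pair1 e)).
have := @unimodal_kernel R a g (kern e) mg mke g0 (kern_ge0 e) gd gi (fun z => kern_superlevel e0).
rewrite /I; under [in X in _ -> _ <= _ * X]eq_integral do rewrite addr0.
by apply.
Qed.

End kernel.

Section convex_line.
Context {R : realType}.

Definition convexR (w : R -> R) := forall a b x y, 0 < a -> 0 < b -> a + b = 1 ->
  w (a * x + b * y) <= a * w x + b * w y.

Lemma convexR_chord (w : R -> R) x y z : convexR w -> x < y -> y < z ->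
  (z - x) * w y <= (z - y) * w x + (y - x) * w z.
Proof.
move=> cw xy yz.
have zx : 0 < z - x by lra.
have ab : (z - y) / (z - x) + (y - x) / (z - x) = 1.
  by rewrite -mulrDl addrA subrK divff// gt_eqF.
have a0 : 0 < (z - y) / (z - x) by rewrite divr_gt0// subr_gt0.
have b0 : 0 < (y - x) / (z - x) by rewrite divr_gt0// subr_gt0.
have := cw _ _ x z a0 b0 ab.
rewrite (_ : _ * x + _ * z = y); last by field; rewrite gt_eqF.
move=> /(ler_wpM2l (ltW zx)) /le_trans; apply.
by rewrite le_eqVlt; apply/orP; left; apply/eqP; field; rewrite gt_eqF.
Qed.

(** The supremum of the difference quotients on the left of 0, which those on the right bound from
    above. *)
Lemma convexR_subgradient (w : R -> R) : convexR w ->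
  exists k, forall x, w 0 + k * x <= w x.
Proof.
move=> cw.
pose S := [set k : R | exists2 x, x < 0 & k = (w x - w 0) / x].
have slope x y : x < 0 -> 0 < y -> (w x - w 0) / x <= (w y - w 0) / y.
  move=> x0 y0; have := convexR_chord cw x0 y0; rewrite !subr0 sub0r => h.
  have xy : 0 < - x * y by rewrite mulr_gt0// oppr_gt0.
  set A := (w x - w 0) / x; set B := (w y - w 0) / y.
  have AE : w x = w 0 + A * x by rewrite /A divfK ?lt_eqF// addrC subrK.
  have BE : w y = w 0 + B * y by rewrite /B divfK ?gt_eqF// addrC subrK.
  rewrite -(@ler_pM2l _ (- x * y))//; rewrite AE BE in h; lra.
have hs : has_sup S.
  split; first by exists ((w (-1) - w 0) / -1); exists (-1) => //; rewrite oppr_lt0.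
  by exists ((w 1 - w 0) / 1) => _ [z z0 ->]; exact: slope.
exists (sup S) => x; have [x0|x0|x0] := ltgtP x 0; last by rewrite x0 mulr0 addr0.
- have : (w x - w 0) / x <= sup S by apply: (ub_le_sup hs.2); exists x.
  by rewrite ler_ndivrMr//; lra.
- have : sup S <= (w x - w 0) / x.
    by apply: ge_sup => [|_ [y y0 ->]]; [exact: hs.1|exact: slope].
  by rewrite ler_pdivlMr//; lra.
Qed.

Lemma convexR_local_min (w : R -> R) d : convexR w -> 0 < d ->
  (forall x, `|x| < d -> w 0 <= w x) ->
  (forall x y, 0 <= x -> x <= y -> w x <= w y) /\
  (forall x y, x <= y -> y <= 0 -> w y <= w x).
Proof.
move=> cw d0 hd.
have min y : w 0 <= w y.
  have [yd|dy] := ltP `|y| d; first exact: hd.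
  have y0 : 0 < `|y| by exact: lt_le_trans dy.
  (* The weight that shrinks [y] to absolute value [d / 2], inside the neighbourhood where the
     minimum is known. *)
  pose b := d / (2 * `|y|); have b0 : 0 < b by rewrite divr_gt0// mulr_gt0.
  have b1 : b < 1.
    by rewrite /b ltr_pdivrMr ?mulr_gt0// mul1r (le_lt_trans dy)// ltr_pMl// ltr1n.
  have a0 : 0 < 1 - b by rewrite subr_gt0.
  have := cw (1 - b) b 0 y a0 b0 (subrK _ _); rewrite mulr0 add0r => h.
  have : w 0 <= w (b * y).
    apply: hd; rewrite normrM gtr0_norm// /b.
    rewrite (_ : d / (2 * `|y|) * `|y| = d / 2); last by field; rewrite gt_eqF.
    by rewrite ltr_pdivrMr// ltr_pMr// ltr1n.
  move=> /le_trans /(_ h) h2; rewrite -(@ler_pM2l _ b)//; lra.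
split => x y.
  rewrite le_eqVlt => /predU1P[<-//|x0]; rewrite le_eqVlt => /predU1P[->//|xy].
  have := convexR_chord cw x0 xy; rewrite !subr0 => h.
  have h1 : (y - x) * w 0 <= (y - x) * w y by rewrite ler_wpM2l// subr_ge0 ltW.
  rewrite -(@ler_pM2l _ y); last exact: lt_trans xy.
  have h2 : x * w 0 <= x * w y by rewrite ler_wpM2l// ltW.
  lra.
rewrite le_eqVlt => /predU1P[->//|xy]; rewrite le_eqVlt => /predU1P[->//|y0].
have := convexR_chord cw xy y0; rewrite !sub0r => h.
have h1 : (y - x) * w 0 <= (y - x) * w x by rewrite ler_wpM2l// subr_ge0 ltW.
rewrite -(@ler_pM2l _ (- x)); last by rewrite oppr_gt0; exact: lt_trans y0.
lra.
Qed.

End convex_line.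

(** * The planar energy in polar form and its local inequality *)

Section planar_inequality.
Context {R : realType}.
Local Notation mu := (@lebesgue_measure R).
Local Open Scope ereal_scope.

Lemma ge0_integral_halves (h : R -> \bar R) : measurable_fun setT h -> (forall t, 0 <= h t) ->
  \int[mu]_t h t = \int[mu]_t ((pw 0 t)%:E * h t) + \int[mu]_t ((pw 0 t)%:E * h (- t)%R).
Proof.
move=> mh h0.
have mhN : measurable_fun setT (fun t : R => h (- t)%R).
  by apply: (measurableT_comp mh); exact: measurable_funN.
have E (k : R -> \bar R) : \int[mu]_t ((pw 0 t)%:E * k t) = \int[mu]_(t in `]0%R, +oo[) k t.
  by rewrite -integral_pw; apply: eq_integral => t _; rewrite powRr0 mul1e.
rewrite !E.
rewrite (_ : setT = `]-oo, 0%R]%classic `|` `]0%R, +oo[%classic); last first.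
  by apply/seteqP; split => // t _ /=; rewrite !in_itv/= andbT; case: leP; [left|right].
rewrite ge0_integral_setU//=; first last.
- apply/disj_setPS => t /= []; rewrite !in_itv/= andbT => t0 t1.
  by move: (le_lt_trans t0 t1); rewrite ltxx.
- exact: measurable_funTS.
rewrite addeC; congr (_ + _).
rewrite [RHS]integral_itv_obnd_cbnd; last exact: measurable_funTS.
rewrite ge0_integration_by_substitution0//.
by apply: eq_integral => t _; rewrite opprK.
Qed.

Variables (p : R) (f : R -> R -> R).
Hypotheses (p0 : (0 < p)%R) (p1 : (p < 1)%R) (pf : planar_density f).

Definition planar_energy (a b : R) :=
  \int[mu]_s \int[mu]_t ((f s t)%:E * pkern p (a * s + b * t)%R).

Let f0 x y : 0 <= (f x y)%:E. Proof. by rewrite lee_fin (pd_ge0 pf). Qed.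

Let mf d (T : measurableType d) (u v : T -> R) : measurable_fun setT u -> measurable_fun setT v ->
  measurable_fun setT (fun x => (f (u x) (v x))%:E).
Proof.
move=> mu' mv; apply/measurable_EFinP.
exact: (measurableT_comp (pd_meas pf) (measurable_fun_pair mu' mv)).
Qed.

Let mK d (T : measurableType d) (u : T -> R) : measurable_fun setT u ->
  measurable_fun setT (fun x => pkern p (u x)).
Proof. by move=> mu'; exact: (measurableT_comp (measurable_pkern p) mu'). Qed.

Let mfst : measurable_fun setT (fst : R * R -> R). Proof. exact: measurable_fst. Qed.
Let msnd : measurable_fun setT (snd : R * R -> R). Proof. exact: measurable_snd. Qed.

(** The shear replacing [t] by [t - k s] turns the linear form into [s + a t]. Evenness folds
    [t < 0] onto [t > 0], whence the factor 2, and [s = t x] brings the integral over [t] into the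
    shape of [radial]. *)
Lemma planar_energy_radial k a :
  planar_energy (1 + a * k) a =
  2%:E * \int[mu]_x (radial p f x (1 - k * x) * pkern p (x + a)%R).
Proof.
pose h (s t : R) := (f s (t - k * s))%:E * pkern p (s + a * t)%R.
have h0 s t : 0 <= h s t by rewrite mule_ge0// pkern_ge0.
have mh : measurable_fun setT (fun u : R * R => h u.1 u.2).
  apply: emeasurable_funM.
    apply: mf => //; apply: measurable_funB => //; exact: measurable_funM.
  by apply: mK; apply: measurable_funD => //; exact: measurable_funM.
transitivity (\int[mu]_s \int[mu]_t h s t).
  apply: eq_integral => s _.
  rewrite -[LHS](ge0_integral_shift (- (k * s))%R).
  - apply: eq_integral => t _; rewrite /h; congr (_ * pkern p _); ring.
  - by apply: emeasurable_funM; [exact: mf|apply: mK; apply: measurable_funD => //; exact: measurable_funM].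
  - by move=> t; rewrite mule_ge0// pkern_ge0.
rewrite (@fubini_tonelli _ _ _ _ R mu mu (fun u => h u.1 u.2) mh) => [/=|u]; last exact: h0.
pose H t := \int[mu]_s h s t.
have mH : measurable_fun setT H.
  apply: (@measurable_fun_fubini_tonelli_G _ _ _ _ R mu (fun u => h u.1 u.2) mh).
  by move=> u; exact: h0.
have H0 t : 0 <= H t by exact: integral_ge0.
have mhs t : measurable_fun setT (h ^~ t).
  exact: (measurableT_comp mh (measurable_pair2 t)).
have HN t : H (- t)%R = H t.
  have N1neq0 : (-1 != 0 :> R)%R by rewrite oppr_eq0 oner_neq0.
  rewrite /H -(@ge0_integral_affine _ (-1) 0 (h ^~ (- t)%R) N1neq0 (mhs _) (fun s => h0 s _)).
  rewrite normrN1 mul1e; apply: eq_integral => s _; rewrite /h addr0 mulN1r.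
  rewrite (_ : - t - k * - s = - (t - k * s))%R; last by ring.
  rewrite (pd_even pf) (_ : - s + a * - t = - (s + a * t))%R; last by ring.
  by rewrite pkernN.
rewrite -[LHS]/(\int[mu]_t H t) (ge0_integral_halves mH H0).
under [X in _ + X]eq_integral do rewrite HN.
have dbl (x : \bar R) : x + x = 2%:E * x.
  by rewrite -[in LHS](mul1e x) -ge0_muleDl// -EFinD.
rewrite dbl; congr (_ * _).
pose l (u : R * R) := (pw (1 - p) u.1)%:E *
  ((f (u.1 * u.2) (u.1 * (1 - k * u.2)))%:E * pkern p (u.2 + a)%R).
have ml : measurable_fun setT l.
  apply: emeasurable_funM; first exact: (measurableT_comp (measurable_EFin_pw _) mfst).
  apply: emeasurable_funM; last by apply: mK; exact: measurable_funD.
  apply: mf; first exact: measurable_funM.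
  by apply: measurable_funM => //; apply: measurable_funB => //; exact: measurable_funM.
have l0 u : 0 <= l u by rewrite mule_ge0 ?lee_fin ?pw_ge0// mule_ge0// pkern_ge0.
transitivity (\int[mu]_t \int[mu]_x l (t, x)).
  apply: eq_integral => t _; have [t0|t0] := leP t 0%R.
    rewrite pwN// mul0e; apply/esym/integral0_eq => x _.
    by rewrite /l pwN// mul0e.
  rewrite /H -(ge0_integral_scale t0 (mhs t) (fun s => h0 s t)).
  rewrite pwE// powRr0 mul1e -ge0_integralZl.
  - apply: eq_integral => x _; rewrite /l /h /= pwE//.
    rewrite (_ : t * x + a * t = t * (x + a))%R; last by ring.
    rewrite pkernZ ?gt_eqF// gtr0_norm// (_ : t - k * (t * x) = t * (1 - k * x))%R; last by ring.
    rewrite powRD; last by rewrite (gt_eqF t0) implybT.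
    by rewrite (powRr1 (ltW t0)) EFinM -[RHS]muleA; congr (_ * _); rewrite muleCA.
  - by [].
  - by apply: (measurableT_comp (mhs t)); exact: measurable_funM.
  - by [].
  - by rewrite lee_fin ltW.
rewrite (@fubini_tonelli _ _ _ _ R mu mu l ml l0); apply: eq_integral => x _.
rewrite /radial -ge0_integralZr.
- by apply: eq_integral => t _; rewrite /l muleA.
- by [].
- apply: emeasurable_funM; first exact: measurable_EFin_pw.
  by apply: mf; exact: measurable_funM.
- by move=> t _; rewrite mule_ge0// lee_fin pw_ge0.
- exact: pkern_ge0.
Qed.

End planar_inequality.

Section planar_local.
Context {R : realType}.
Local Notation mu := (@lebesgue_measure R).

Variables (p : R) (f : R -> R -> R).
Hypotheses (p0 : 0 < p) (p1 : p < 1) (pf : planar_density f).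

Let q0 : 0 < 2 - p. Proof. by rewrite subr_gt0 (lt_trans p1)// ltr1n. Qed.

Let A x y := fine (radial p f x y).

Let AE x y : (x != 0) || (y != 0) -> radial p f x y = (A x y)%:E /\ 0 < A x y.
Proof. by move=> xy; have [a a0 aE] := radial_fin p1 pf xy; rewrite /A aE. Qed.

Let radialZ c x y : 0 < c ->
  ((c `^ (2 - p))%:E * radial p f (c * x) (c * y) = radial p f x y)%E.
Proof.
move=> c0; have mh : measurable_fun setT (fun r : R => (f (r * x) (r * y))%:E).
  by apply/measurable_EFinP; exact: (measurable_ray pf).
have h0 r : (0 <= (f (r * x) (r * y))%:E)%E by rewrite lee_fin (pd_ge0 pf).
rewrite /radial -[RHS](ge0_integral_pw_scale (1 - p) c0 mh h0).
rewrite (_ : 1 - p + 1 = 2 - p); last by ring.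
by congr (_ * _)%E; apply: eq_integral => r _; rewrite !mulrA ![_ * c]mulrC.
Qed.

(** The gauge of Ball's body of [f]: homogeneous of degree one, and convex by
    [ball_radial_convex]. *)
Let W x y := A x y `^ (- (2 - p)^-1).

Let WZ c x y : 0 < c -> (x != 0) || (y != 0) -> W (c * x) (c * y) = c * W x y.
Proof.
move=> c0 xy.
have cxy : (c * x != 0) || (c * y != 0) by rewrite !mulf_eq0 !negb_or (gt_eqF c0).
have [E1 h1] := AE xy; have [E2 h2] := AE cxy.
have := radialZ x y c0; rewrite E1 E2 -EFinM => -[E].
rewrite /W -E powRM ?powR_ge0 ?(ltW h2)// mulrA -powRrM.
rewrite (_ : (2 - p) * - (2 - p)^-1 = -1); last by field; rewrite gt_eqF.
by rewrite powR_inv1 ?(ltW c0)// divff ?mul1r// gt_eqF.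
Qed.

Let W_convex a b x1 y1 x2 y2 : 0 < a -> 0 < b -> a + b = 1 ->
  (x1 != 0) || (y1 != 0) -> (x2 != 0) || (y2 != 0) ->
  (a * x1 + b * x2 != 0) || (a * y1 + b * y2 != 0) ->
  W (a * x1 + b * x2) (a * y1 + b * y2) <= a * W x1 y1 + b * W x2 y2.
Proof.
move=> a0 b0 ab n1 n2 n3.
have [E1 h1] := AE n1; have [E2 h2] := AE n2; have [E3 h3] := AE n3.
exact: (ball_radial_convex p1 pf a0 b0 ab n1 n2 h1 h2 h3 E1 E2 E3).
Qed.

(* Homogeneity makes [W] along the tilted line [(x, 1 - k x)] lie above its value at [x = 0], when
   [k W(0,1)] is a subgradient of [W(., 1)] at [0]. *)
Lemma radial_unimodal : exists k,
  (forall x y, 0 <= x -> x <= y -> A y (1 - k * y) <= A x (1 - k * x)) /\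
  (forall x y, x <= y -> y <= 0 -> A x (1 - k * x) <= A y (1 - k * y)).
Proof.
have n1 (x : R) : (x != 0) || ((1 : R) != 0) by rewrite oner_neq0 orbT.
have c1 : convexR (fun x => W x 1).
  move=> a b x y a0 b0 ab.
  have := W_convex a0 b0 ab (n1 x) (n1 y); rewrite !mulr1 ab; exact.
have [k0 hk0] := convexR_subgradient c1.
have W0 : 0 < W 0 1 by rewrite powR_gt0//; have [] := AE (n1 0).
have [k kE] : exists k, k0 = k * W 0 1.
  by exists (k0 / W 0 1); rewrite divfK// gt_eqF.
exists k.
have nk x : (x != 0) || (1 - k * x != 0).
  by have [->|//] := eqVneq x 0; rewrite mulr0 subr0 oner_neq0.
have c2 : convexR (fun x => W x (1 - k * x)).
  move=> a b x y a0 b0 ab.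
  have := W_convex a0 b0 ab (nk x) (nk y).
  rewrite (_ : a * (1 - k * x) + b * (1 - k * y) = 1 - k * (a * x + b * y)).
    by apply; exact: nk.
  by rewrite -[in RHS]ab; ring.
(* Within [d] of 0 the factor [1 - k x] is positive and homogeneity brings [W] back to the line of
   height 1; farther away convexity alone extends the minimum. *)
pose d := (`|k| + 1)^-1; have d0 : 0 < d by rewrite invr_gt0 ltr_wpDl.
have loc x : `|x| < d -> W 0 (1 - k * 0) <= W x (1 - k * x).
  move=> xd; rewrite mulr0 subr0.
  have kx : k * x < 1.
    apply: (le_lt_trans (ler_norm _)); rewrite normrM.
    have : `|x| * (`|k| + 1) < 1 by rewrite -ltr_pdivlMr ?ltr_wpDl// mul1r.
    by have := normr_ge0 x; lra.
  have c0 : 0 < 1 - k * x by rewrite subr_gt0.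
  set c := 1 - k * x in c0 *.
  have -> : W x c = c * W (x / c) 1.
    have e1 : c * (x / c) = x by rewrite mulrC divfK// gt_eqF.
    by rewrite -(WZ c0 (n1 (x / c))) e1 mulr1.
  have := hk0 (x / c); rewrite -(@ler_pM2l _ c c0).
  apply: le_trans; rewrite le_eqVlt; apply/orP; left; apply/eqP.
  rewrite kE (_ : c * _ = W 0 1 * (c + k * x)); last by field; rewrite gt_eqF.
  by rewrite /c subrK mulr1.
have [up dn] := convexR_local_min c2 d0 loc.
have inv x y : W x (1 - k * x) <= W y (1 - k * y) -> A y (1 - k * y) <= A x (1 - k * x).
  rewrite /W; have [_ h1] := AE (nk x); have [_ h2] := AE (nk y).
  rewrite !powRN lef_pV2 ?posrE ?powR_gt0// => h; rewrite leNgt; apply/negP => lt.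
  have qi : 0 < (2 - p)^-1 by rewrite invr_gt0.
  have := gt0_ltr_powR qi (ltW h1 : _ \in Num.nneg) (ltW h2 : _ \in Num.nneg) lt.
  by rewrite ltNge h.
by split => x y xy yx; apply: inv; [exact: up|exact: dn].
Qed.

Theorem planar_energy_local : exists k, forall a,
  (planar_energy p f (1 + a * k) a + planar_energy p f (1 - a * k) (- a) <=
   2%:E * planar_energy p f 1 0)%E.
Proof.
have [k [up dn]] := radial_unimodal; exists k => a.
have nk x : (x != 0) || (1 - k * x != 0).
  by have [->|//] := eqVneq x 0; rewrite mulr0 subr0 oner_neq0.
pose g x := A x (1 - k * x).
have gE x : radial p f x (1 - k * x) = (g x)%:E by have [] := AE (nk x).
have g0 x : 0 <= g x by have [_ /ltW] := AE (nk x).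
have mg : measurable_fun setT g.
  apply/measurable_EFinP; rewrite (_ : _ \o _ = fun x => radial p f x (1 - k * x)); last first.
    by apply/funext => x /=; rewrite gE.
  pose l (u : R * R) := ((pw (1 - p) u.2)%:E * (f (u.2 * u.1) (u.2 * (1 - k * u.1)))%:E)%E.
  have ml : measurable_fun setT l.
    have mfst : measurable_fun setT (fst : R * R -> R) by exact: measurable_fst.
    have msnd : measurable_fun setT (snd : R * R -> R) by exact: measurable_snd.
    apply: emeasurable_funM; first exact: (measurableT_comp (measurable_EFin_pw _) msnd).
    apply/measurable_EFinP.
    have mp : measurable_fun setT (fun u : R * R => (u.2 * u.1, u.2 * (1 - k * u.1))).
      apply: measurable_fun_pair; first exact: measurable_funM.
      by apply: measurable_funM => //; apply: measurable_funB => //; exact: measurable_funM.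
    exact: (measurableT_comp (pd_meas pf) mp).
  apply: (@measurable_fun_fubini_tonelli_F _ _ _ _ R mu l ml) => u.
  by rewrite mule_ge0// lee_fin ?pw_ge0// (pd_ge0 pf).
have main := unimodal_pkern p a mg g0 up dn.
have E b : (planar_energy p f (1 + b * k) b =
    2%:E * \int[mu]_x ((g x)%:E * pkern p (x + b)%R))%E.
  by rewrite (planar_energy_radial p pf); under eq_integral do rewrite gE.
have E0 : (planar_energy p f 1 0 = 2%:E * \int[mu]_x ((g x)%:E * pkern p x))%E.
  have := E 0; rewrite mul0r addr0 => ->.
  by under eq_integral do rewrite addr0.
rewrite E0 E -mulNr E -ge0_muleDr; last 2 first.
- by apply: integral_ge0 => x _; rewrite mule_ge0// ?lee_fin ?pkern_ge0.
- by apply: integral_ge0 => x _; rewrite mule_ge0// ?lee_fin ?pkern_ge0.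
by apply: lee_wpmul2l => //; rewrite lee_fin.
Qed.

End planar_local.

(** * Averages of the power spectrum *)

Section improper_integrals.
Context {R : realType}.
Local Notation mu := (@lebesgue_measure R).

Lemma cvg_powRN (c : R) : 0 < c -> r `^ (- c) @[r --> +oo] --> (0 : R).
Proof.
move=> c0; apply/cvgrPdist_lt => e e0.
near=> r.
have r0 : 0 < r by near: r; exact: nbhs_pinfty_gt.
have er : e `^ (- c^-1) < r by near: r; apply: nbhs_pinfty_gt; exact: num_real.
rewrite sub0r normrN ger0_norm ?powR_ge0// powRN.
rewrite invf_plt ?posrE ?powR_gt0//.
have := gt0_ltr_powR c0 (powR_ge0 _ _ : _ \in Num.nneg) (ltW r0 : _ \in Num.nneg) er.
rewrite -powRrM mulNr mulVf ?gt_eqF// powR_inv1// ltW//.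
Unshelve. all: by end_near. Qed.

Let derivable_continuous (F : R -> R) (r d : R) : is_derive r 1 F d -> {for r, continuous F}.
Proof.
by move=> h; apply/differentiable_continuous/derivable1_diffP; exact: ex_derive.
Qed.

Let FTCy (f F : R -> R) (a l : R) : (forall r, a <= r -> 0 <= f r) ->
  (forall r, a <= r -> is_derive r 1 F (f r)) ->
  (forall r, a <= r -> {for r, continuous f}) ->
  F r @[r --> +oo] --> l ->
  (\int[mu]_(r in `[a, +oo[) (f r)%:E = (l - F a)%:E)%E.
Proof.
move=> f0 dF cf Fl; rewrite (@ge0_continuous_FTC2y R f F a l)//.
- apply/continuous_within_itvcyP; split.
    by move=> r; rewrite in_itv/= andbT => /ltW /cf.
  exact/cvg_at_right_filter/cf.
- by move=> r /ltW /dF h; exact: ex_derive.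
- by apply/cvg_at_right_filter; apply: derivable_continuous; exact: dF.
- move=> r; rewrite in_itv/= andbT => /ltW /dF h.
  by rewrite derive1E; exact: derive_val.
Qed.

Lemma integral_powR_tail (s : R) : 1 < s ->
  (\int[mu]_(r in `[1%R, +oo[) (r `^ (- s))%:E = ((s - 1)^-1)%:E)%E.
Proof.
move=> s1; have c0 : 0 < s - 1 by rewrite subr_gt0.
pose F (r : R) := - (s - 1)^-1 * r `^ (- (s - 1)).
have dpow (r c : R) : 1 <= r -> is_derive r 1 (fun r : R => r `^ c) (c * r `^ (c - 1)).
  by move=> r1; apply: is_derive1_powR; exact: lt_le_trans r1.
rewrite (_ : (s - 1)^-1 = 0 - F 1); last by rewrite /F powR1 mulr1 sub0r opprK.
apply: FTCy.
- by move=> r _; exact: powR_ge0.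
- move=> r r1; have h := dpow r (- (s - 1)) r1; rewrite /F; apply: is_derive_eq.
  rewrite (_ : - (s - 1) - 1 = - s); last by ring.
  by rewrite /GRing.scale/=; field; rewrite gt_eqF.
- by move=> r r1; apply: derivable_continuous; exact: dpow.
- rewrite -[X in _ --> X](mulr0 (- (s - 1)^-1)); apply: cvgM; first exact: cvg_cst.
  exact: cvg_powRN.
Qed.

(** The summand 1 makes the integrand nonnegative, as the fundamental theorem at infinity and later
    Tonelli require; it accounts for the term [e^-1]. *)
Lemma integral_expcos (e u : R) : 0 < e ->
  (\int[mu]_(r in `[0%R, +oo[) ((1 + cos (r * u)) * expR (- (e * r)))%:E =
   (e^-1 + kern e u)%:E)%E.
Proof.
move=> e0; pose d := e ^+ 2 + u ^+ 2.
have d0 : 0 < d by rewrite ltr_wpDr ?sqr_ge0// exprn_gt0.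
pose G (r : R) := d^-1 * (u * sin (r * u) - e * cos (r * u)) - e^-1.
pose F (r : R) := expR (- (e * r)) * G r.
have dF (r : R) : is_derive r 1 F ((1 + cos (r * u)) * expR (- (e * r))).
  rewrite /F /G; apply: is_derive_eq; rewrite /GRing.scale/=.
  by rewrite /d; field; rewrite !gt_eqF.
have df (r : R) : is_derive r 1 (fun r : R => (1 + cos (r * u)) * expR (- (e * r)))
    ((1 + cos (r * u)) * (- e * expR (- (e * r))) + expR (- (e * r)) * (- sin (r * u) * u)).
  by apply: is_derive_eq; rewrite /GRing.scale/=; ring.
rewrite (_ : e^-1 + kern e u = 0 - F 0); last first.
  rewrite /F /G mulr0 oppr0 expR0 mul0r sin0 cos0 sub0r mul1r /kern gtr0_norm// -/d.
  by field; rewrite !gt_eqF.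
apply: FTCy.
- move=> r _; apply: mulr_ge0; last exact: expR_ge0.
  by have := cos_geN1 (r * u); lra.
- by move=> r _; exact: derivable_continuous (df r).
- pose M := d^-1 * (`|u| + e) + e^-1.
  have M0 : 0 < M by rewrite ltr_wpDl ?invr_gt0// mulr_ge0 ?addr_ge0 ?invr_ge0 ?(ltW d0) ?(ltW e0).
  have GM r : `|G r| <= M.
    apply: (le_trans (ler_normB _ _)); rewrite (gtr0_norm (_ : 0 < e^-1)) ?invr_gt0// lerD2r.
    rewrite normrM gtr0_norm ?invr_gt0// ler_pM2l ?invr_gt0//.
    apply: (le_trans (ler_normB _ _)); rewrite !normrM (gtr0_norm e0).
    apply: lerD; rewrite -[leRHS]mulr1; apply: ler_wpM2l => //; rewrite ?(ltW e0)//.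
      by rewrite ler_norml sin_geN1 sin_le1.
    by rewrite ler_norml cos_geN1 cos_le1.
  apply/cvgrPdist_lt => z z0.
  have : expR (- (e * r)) @[r --> +oo] --> (0 : R).
    apply: (@cvg_comp _ _ _ (fun r => e * r) (fun z => expR (- z)) _ (pinfty_nbhs R)).
      exact: gt0_cvgMry.
    exact: cvgr_expR.
  move=> /cvgrPdist_lt /(_ (z / M)); rewrite divr_gt0// => /(_ isT).
  apply: filterS => r; rewrite !sub0r !normrN /F normrM ltr_pdivlMr//.
  by apply: le_lt_trans; rewrite ler_wpM2l.
Qed.

(** The bound [M] controls the integral near 0, where [s > -1], and the decay controls it at
    infinity, where [s - t < -1]. *)
Lemma pw_integral_fin (s t M C : R) (h : R -> R) : -1 < s -> s - t < -1 ->
  measurable_fun setT h -> (forall r, 0 <= h r) -> (forall r, 0 < r -> h r <= M) ->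
  (forall r, 0 < r -> h r <= C * r `^ (- t)) ->
  (\int[mu]_r ((pw s r)%:E * (h r)%:E) < +oo)%E.
Proof.
move=> s1 st mh h0 hM hC.
pose J : set R := `[1%R, +oo[%classic.
have M0 : 0 <= M by exact: le_trans (hM 1 _).
have C0 : 0 <= C by have := hC 1 ltr01; rewrite powR1 mulr1; apply: le_trans.
have mJ : measurable J by exact: measurable_itv.
have mi : measurable_fun setT (fun r : R => (\1_J r)%:E : \bar R) by exact: measurable_EFin_indic.
have i0 (r : R) : (0 <= (\1_J r)%:E :> \bar R)%E by rewrite lee_fin.
have tail c : c < -1 -> (\int[mu]_r ((pw c r)%:E * (\1_J r)%:E) = ((- c - 1)^-1)%:E)%E.
  move=> c1; have := @integral_powR_tail (- c); rewrite opprK ltrNr => /(_ c1) <-.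
  rewrite [RHS]integral_mkcond; apply: eq_integral => r _; rewrite patchE indicE -/J.
  case: ifPn; last by rewrite mule0.
  rewrite inE /J/= in_itv/= andbT mule1 => r1; rewrite pwE//; exact: lt_le_trans r1.
have mpw c : measurable_fun setT (fun r => (pw c r)%:E * (\1_J r)%:E : \bar R)%E.
  by apply: emeasurable_funM => //; exact: measurable_EFin_pw.
(* Inversion maps []0, 1]] to [[1, +oo[], so the single tail formula serves both ends. *)
have head : (\int[mu]_r ((pw s r)%:E * (\1_J r^-1)%:E) = ((s + 1)^-1)%:E)%E.
  rewrite (ge0_integral_pw_inv s mi i0) tail; first by congr ((_^-1)%:E); ring.
  lra.
have mhead : measurable_fun setT (fun r => (pw s r)%:E * (\1_J r^-1)%:E : \bar R)%E.
  apply: emeasurable_funM; first exact: measurable_EFin_pw.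
  exact: (measurableT_comp mi (@measurable_invr R)).
have pos1 r : (0 <= M%:E * ((pw s r)%:E * (\1_J r^-1)%:E))%E.
  by rewrite mule_ge0 ?lee_fin// mulr_ge0 ?pw_ge0.
have pos2 r : (0 <= C%:E * ((pw (s - t) r)%:E * (\1_J r)%:E))%E.
  by rewrite mule_ge0 ?lee_fin// mulr_ge0 ?pw_ge0.
apply: (@le_lt_trans _ _ (\int[mu]_r (M%:E * ((pw s r)%:E * (\1_J r^-1)%:E) +
    C%:E * ((pw (s - t) r)%:E * (\1_J r)%:E)))%E).
  apply: ge0_le_integral => //.
  - by move=> r _; rewrite mule_ge0 ?lee_fin ?pw_ge0.
  - by apply: emeasurable_funM; [exact: measurable_EFin_pw|exact/measurable_EFinP].
  - by apply: emeasurable_funD; apply: measurable_funeM; [exact: mhead|exact: mpw].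
  move=> r _; have [r0|r0] := leP r 0.
    by rewrite !pwN// !mul0e !mule0 adde0.
  have [r1|r1] := leP r 1.
    rewrite -[leLHS]adde0; apply: leeD => //.
    rewrite indicE mem_set; last by rewrite /J/= in_itv/= andbT -invr1 lef_pV2 ?posrE.
    by rewrite mule1 muleC lee_wpmul2r ?lee_fin ?pw_ge0// hM.
  rewrite -[leLHS]add0e; apply: leeD => //.
  rewrite [X in (_ <= _ * (_ * X))%E](_ : _ = 1%E); last first.
    by rewrite indicE mem_set// /J/= in_itv/= andbT ltW.
  rewrite mule1 -!EFinM lee_fin -pwD mulrCA ler_wpM2l ?pw_ge0//.
  by rewrite (pwE _ r0) hC.
have p1 r : (0 <= (pw s r)%:E * (\1_J r^-1)%:E)%E by rewrite mule_ge0 ?lee_fin ?pw_ge0.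
have p2 r : (0 <= (pw (s - t) r)%:E * (\1_J r)%:E)%E by rewrite mule_ge0 ?lee_fin ?pw_ge0.
rewrite (ge0_integralDT mu (measurable_funeM M%:E mhead) (measurable_funeM C%:E (mpw (s - t))))//.
rewrite (ge0_integralZT mu mhead)// (ge0_integralZT mu (mpw (s - t)))//.
by rewrite head tail// -!EFinM -EFinD ltry.
Qed.

(** The number [c] is [Gamma(1 - p)], which is finite only for [p < 1]. *)
Lemma gamma_fin (p : R) : 0 < p -> p < 1 ->
  exists2 c : R, 0 < c & (\int[mu]_e ((pw (- p) e)%:E * (expR (- e))%:E) = c%:E)%E.
Proof.
move=> p0 p1.
have me : measurable_fun setT (fun e : R => expR (- e)).
  by apply: (measurableT_comp (@measurable_expR R)); exact: measurable_funN.
have fin : (\int[mu]_e ((pw (- p) e)%:E * (expR (- e))%:E) < +oo)%E.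
  apply: (@pw_integral_fin (- p) 2 1 2) => //; [lra|lra| |].
  - by move=> r r0; rewrite -[leRHS]expR0 ler_expR oppr_le0 ltW.
  move=> r r0; rewrite expRN powRN powR_mulrn ?(ltW r0)//.
  rewrite -[X in X / _]invrK -invfM lef_pV2 ?posrE ?expR_gt0 ?mulr_gt0 ?exprn_gt0//.
  have := @expR_ge1Dxn R r 1 (ltW r0); rewrite (_ : 2`! = 2)%N// => h.
  apply: le_trans h; lra.
have pos (e : R) : (0 <= (pw (- p) e)%:E * (expR (- e))%:E)%E.
  by rewrite mule_ge0 ?lee_fin ?pw_ge0 ?expR_ge0.
pose c := (\int[mu]_e ((pw (- p) e)%:E * (expR (- e))%:E))%E.
have cfin : c \is a fin_num by rewrite ge0_fin_numE// integral_ge0.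
exists (fine c); last by rewrite fineK.
rewrite -lte_fin fineK//.
have lb : 0 < 2 `^ (- p) * expR (- 2) by rewrite mulr_gt0 ?powR_gt0 ?expR_gt0.
have mf : measurable_fun setT (fun e : R => (pw (- p) e)%:E * (expR (- e))%:E)%E.
  by apply: emeasurable_funM; [exact: measurable_EFin_pw|exact/measurable_EFinP].
apply: (integral_gt0_itv (a := 1) (b := 2) mf pos _ lb) => [|e e1 e2]; first by rewrite ltr1n.
have e0 : 0 < e by exact: lt_le_trans e1.
rewrite -EFinM lee_fin pwE// ler_pM ?powR_ge0 ?expR_ge0//.
  rewrite !powRN lef_pV2 ?posrE ?powR_gt0//.
  by apply: ge0_ler_powR => //; rewrite ?nnegrE ?(ltW p0) ?(ltW e0).
by rewrite ler_expR lerN2.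
Qed.

End improper_integrals.

Section measurable_trigo.
Context d (T : measurableType d) (R : realType).
Implicit Type f : T -> R.

Lemma measurable_funcos f : measurable_fun setT f -> measurable_fun setT (fun x => cos (f x)).
Proof. exact: (measurableT_comp (continuous_measurable_fun (@continuous_cos R))). Qed.

Lemma measurable_funsin f : measurable_fun setT f -> measurable_fun setT (fun x => sin (f x)).
Proof. exact: (measurableT_comp (continuous_measurable_fun (@continuous_sin R))). Qed.

End measurable_trigo.

(** * Squared characteristic functions as double integrals *)

Section characteristic_power.
Context d (T : measurableType d) (R : realType).
Variables (m : {sigma_finite_measure set T -> \bar R}) (K : set T).
Hypotheses (mK : measurable K) (finK : (m K < +oo)%E).
Local Notation mu := (@lebesgue_measure R).

(** The squared modulus of the integral of [exp (i a)] over [K]. *)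
Definition charpow (a : T -> R) : R :=
  (\int[m]_(x in K) cos (a x)) ^+ 2 + (\int[m]_(x in K) sin (a x)) ^+ 2.

(** The integral of [g] over all differences [a x - a y] with [x], [y] in [K]. Expanding the squared
    modulus, [charpow] is formally the case [g = cos]; only nonnegative [g] enter, so that Tonelli
    is available. *)
Definition pairint (a : T -> R) (g : R -> \bar R) : \bar R :=
  (\int[m]_x \int[m]_y ((\1_K x * \1_K y)%:E * g (a x - a y)%R))%E.

Lemma charpow_ge0 a : 0 <= charpow a.
Proof. by rewrite addr_ge0 ?sqr_ge0. Qed.

Lemma bounded_on_integrable (h : T -> R) (M : R) : measurable_fun setT h ->
  (forall x, `|h x| <= M) -> m.-integrable K (EFin \o h).
Proof.
move=> mh hM; apply: measurable_bounded_integrable => //.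
  exact: measurable_funS mh.
exists M; split; first exact: num_real.
by move=> N MN x _; exact: le_trans (ltW MN).
Qed.

Lemma integral_indic_Rintegral (h : T -> R) : m.-integrable K (EFin \o h) ->
  (\int[m]_x (\1_K x * h x)%:E = (\int[m]_(x in K) h x)%R%:E)%E.
Proof.
move=> ih; rewrite /Rintegral fineK; last exact: integrable_fin_num.
rewrite [RHS]integral_mkcond; apply: eq_integral => x _; rewrite patchE indicE.
by case: ifPn => xK; rewrite ?mul1r ?mul0r.
Qed.

Let V : R := fine (m K).

Let cosM (a : T -> R) x : `|cos (a x)| <= 1.
Proof. by rewrite ler_norml cos_geN1 cos_le1. Qed.

Let sinM (a : T -> R) x : `|sin (a x)| <= 1.
Proof. by rewrite ler_norml sin_geN1 sin_le1. Qed.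

Lemma cos_integrable a : measurable_fun setT a -> m.-integrable K (EFin \o (fun x => cos (a x))).
Proof. by move=> ma; apply: (bounded_on_integrable (measurable_funcos ma) (cosM a)). Qed.

Lemma sin_integrable a : measurable_fun setT a -> m.-integrable K (EFin \o (fun x => sin (a x))).
Proof. by move=> ma; apply: (bounded_on_integrable (measurable_funsin ma) (sinM a)). Qed.

Let i1 (r : R) : m.-integrable K (EFin \o (fun=> r)).
Proof. exact: (@bounded_on_integrable _ `|r| (@measurable_cst _ _ _ _ setT r)). Qed.

Let iZ (r : R) h : m.-integrable K (EFin \o h) ->
  m.-integrable K (EFin \o (fun x => r * h x)).
Proof. exact: integrableZl. Qed.

Let iD h k : m.-integrable K (EFin \o h) -> m.-integrable K (EFin \o k) ->
  m.-integrable K (EFin \o (fun x => h x + k x)).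
Proof. exact: integrableD. Qed.

Lemma pairint_cos a : measurable_fun setT a ->
  pairint a (fun u => (1 + cos u)%:E) = (V ^+ 2 + charpow a)%:E.
Proof.
move=> ma; pose C := \int[m]_(x in K) cos (a x); pose S := \int[m]_(x in K) sin (a x).
have comb (r s t : R) :
    \int[m]_(x in K) (r + (s * cos (a x) + t * sin (a x))) = r * V + (s * C + t * S).
  rewrite (RintegralD mK (i1 r) (iD (iZ s (cos_integrable ma)) (iZ t (sin_integrable ma)))).
  rewrite (RintegralD mK (iZ s (cos_integrable ma)) (iZ t (sin_integrable ma))).
  by rewrite (RintegralZl s mK (cos_integrable ma)) (RintegralZl t mK (sin_integrable ma)) (Rintegral_cst m mK).
have icomb r s t : m.-integrable K (EFin \o (fun x => r + (s * cos (a x) + t * sin (a x)))).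
  exact: (iD (i1 r) (iD (iZ s (cos_integrable ma)) (iZ t (sin_integrable ma)))).
have inner x : (\int[m]_y ((\1_K x * \1_K y)%:E * (1 + cos (a x - a y))%:E) =
    (\1_K x * (V + (C * cos (a x) + S * sin (a x))))%:E)%E.
  pose i : R := \1_K x.
  transitivity (\int[m]_y ((\1_K y * (i + (i * cos (a x) * cos (a y) + i * sin (a x) * sin (a y))))%:E))%E.
    apply: eq_integral => y _; rewrite cosB -EFinM -/i; congr (_%:E); ring.
  rewrite (integral_indic_Rintegral (icomb _ _ _)) comb; congr (_%:E).
  by rewrite -/i; ring.
rewrite /pairint; under eq_integral do rewrite inner.
rewrite (integral_indic_Rintegral (icomb _ _ _)) comb; congr (_%:E).
Qed.

Lemma charpowN (a : T -> R) : measurable_fun setT a -> charpow (fun x => - a x) = charpow a.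
Proof.
move=> ma; congr (_ ^+ 2 + _); first by apply: eq_Rintegral => x _; rewrite cosN.
rewrite -[RHS]sqrrN -mulN1r -(RintegralZl _ mK (sin_integrable ma)); congr (_ ^+ 2).
by apply: eq_Rintegral => x _; rewrite sinN mulN1r.
Qed.

Lemma pairint_cst a (c : R) : pairint a (fun=> c%:E) = (c * V ^+ 2)%:E.
Proof.
have inner x : (\int[m]_y ((\1_K x * \1_K y)%:E * c%:E) = (\1_K x * (c * V))%:E)%E.
  pose i : R := \1_K x.
  transitivity (\int[m]_y (\1_K y * (i * c))%:E)%E.
    by apply: eq_integral => y _; rewrite -EFinM; congr (_%:E); rewrite -/i; ring.
  by rewrite (integral_indic_Rintegral (i1 _)) (Rintegral_cst m mK) mulrA.
rewrite /pairint; under eq_integral do rewrite inner.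
by rewrite (integral_indic_Rintegral (i1 _)) (Rintegral_cst m mK) -mulrA.
Qed.

Lemma pairint_scale a g r :
  pairint (fun x => r * a x) g = pairint a (fun u => g (r * u)).
Proof.
by apply: eq_integral => x _; apply: eq_integral => y _; rewrite mulrBr.
Qed.

Section exchange.
Variable a : T -> R.
Hypothesis ma : measurable_fun setT a.

(** The generic parameter space [U] lets one measurability proof serve both the exchange of
    integrals and, with [U = unit], the algebra of [pairint]. *)
Let mpair d' (U : measurableType d') (G : U * R -> \bar R) : measurable_fun setT G ->
  measurable_fun setT (fun v : (U * T) * T => (\1_K v.1.2 * \1_K v.2)%:E * G (v.1.1, (a v.1.2 - a v.2)%R))%E.
Proof.
move=> mG; have mi : measurable_fun setT (\1_K : T -> R) by exact: measurable_indic.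
have m12 : measurable_fun setT (fun v : (U * T) * T => v.1.2).
  by apply: (measurableT_comp (@measurable_snd _ _ U T)); exact: measurable_fst.
have m11 : measurable_fun setT (fun v : (U * T) * T => v.1.1).
  by apply: (measurableT_comp (@measurable_fst _ _ U T)); exact: measurable_fst.
apply: emeasurable_funM.
  apply/measurable_EFinP; apply: measurable_funM; first exact: (measurableT_comp mi m12).
  exact: (measurableT_comp mi (@measurable_snd _ _ (U * T)%type T)).
apply: (measurableT_comp mG); apply: measurable_fun_pair => //.
apply: measurable_funB; first exact: (measurableT_comp ma m12).
exact: (measurableT_comp ma (@measurable_snd _ _ (U * T)%type T)).
Qed.

Let pair0 d' (U : measurableType d') (G : U * R -> \bar R) (G0 : forall v, (0 <= G v)%E)
  (v : (U * T) * T) : (0 <= (\1_K v.1.2 * \1_K v.2)%:E * G (v.1.1, (a v.1.2 - a v.2)%R))%E.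
Proof. by rewrite mule_ge0// lee_fin. Qed.

Let minner d' (U : measurableType d') (G : U * R -> \bar R) : measurable_fun setT G ->
  (forall v, 0 <= G v)%E ->
  measurable_fun setT (fun v : U * T => \int[m]_y ((\1_K v.2 * \1_K y)%:E * G (v.1, (a v.2 - a y)%R)))%E.
Proof.
by move=> mG G0; exact: (@measurable_fun_fubini_tonelli_F _ _ _ _ R m _ (mpair mG) (pair0 G0)).
Qed.

Let inner0 d' (U : measurableType d') (G : U * R -> \bar R) (G0 : forall v, (0 <= G v)%E)
  (v : U * T) : (0 <= \int[m]_y ((\1_K v.2 * \1_K y)%:E * G (v.1, (a v.2 - a y)%R)))%E.
Proof. by apply: integral_ge0 => y _; rewrite mule_ge0// lee_fin. Qed.

Lemma measurable_pairint d' (U : measurableType d') (G : U * R -> \bar R) :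
  measurable_fun setT G -> (forall v, 0 <= G v)%E ->
  measurable_fun setT (fun r => pairint a (fun u => G (r, u))).
Proof.
move=> mG G0.
exact: (@measurable_fun_fubini_tonelli_F _ _ _ _ R m _ (minner mG G0) (inner0 G0)).
Qed.

Lemma pairint_exchange d' (U : measurableType d')
    (nu : {sigma_finite_measure set U -> \bar R}) (G : U * R -> \bar R) :
  measurable_fun setT G -> (forall v, 0 <= G v)%E ->
  (\int[nu]_r pairint a (fun u => G (r, u)) = pairint a (fun u => \int[nu]_r G (r, u)))%E.
Proof.
move=> mG G0.
rewrite (@fubini_tonelli _ _ _ _ R nu m _ (minner mG G0) (inner0 G0)) /=.
apply: eq_integral => x _ /=.
have mx : measurable_fun setT (fun v : U * T => ((v.1, x), v.2)).
  apply: measurable_fun_pair; last exact: measurable_snd.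
  by apply: measurable_fun_pair => //; exact: measurable_fst.
rewrite (@fubini_tonelli _ _ _ _ R nu m _ (measurableT_comp (mpair mG) mx)
  (fun v => pair0 G0 ((v.1, x), v.2))) /=.
apply: eq_integral => y _.
have mGy : measurable_fun setT (fun r => G (r, (a x - a y)%R)).
  exact: (measurableT_comp mG (measurable_pair2 (a x - a y)%R)).
by rewrite (ge0_integralZT nu mGy).
Qed.

Lemma pairintD (g h : R -> \bar R) : measurable_fun setT g -> measurable_fun setT h ->
  (forall u, 0 <= g u)%E -> (forall u, 0 <= h u)%E ->
  (pairint a (fun u => g u + h u) = pairint a g + pairint a h)%E.
Proof.
move=> mg mh g0 h0.
have mG (k : R -> \bar R) : measurable_fun setT k ->
    measurable_fun setT (fun v : unit * R => k v.2).
  by move=> mk; apply: (measurableT_comp mk); exact: measurable_snd.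
have mu2 : measurable_fun setT (fun x : T => (tt, x)) by exact: measurable_pair1.
rewrite /pairint -ge0_integralDT.
- apply: eq_integral => x _; rewrite -ge0_integralDT.
  + by apply: eq_integral => y _; rewrite ge0_muleDr.
  + exact: (measurableT_comp (mpair (mG g mg)) (measurable_pair1 (tt, x))).
  + exact: (measurableT_comp (mpair (mG h mh)) (measurable_pair1 (tt, x))).
  + by move=> y; rewrite mule_ge0 ?lee_fin.
  + by move=> y; rewrite mule_ge0 ?lee_fin.
- exact: (measurableT_comp (minner (mG g mg) (fun v => g0 v.2)) mu2).
- exact: (measurableT_comp (minner (mG h mh) (fun v => h0 v.2)) mu2).
- by move=> x; apply: integral_ge0 => y _; rewrite mule_ge0 ?lee_fin.
- by move=> x; apply: integral_ge0 => y _; rewrite mule_ge0 ?lee_fin.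
Qed.

Lemma pairintZ (c : R) (g : R -> \bar R) : 0 <= c -> measurable_fun setT g ->
  (forall u, 0 <= g u)%E -> pairint a (fun u => c%:E * g u)%E = (c%:E * pairint a g)%E.
Proof.
move=> c0 mg g0.
have mG : measurable_fun setT (fun v : unit * R => g v.2).
  by apply: (measurableT_comp mg); exact: measurable_snd.
have mu2 : measurable_fun setT (fun x : T => (tt, x)) by exact: measurable_pair1.
rewrite /pairint -ge0_integralZT//.
- apply: eq_integral => x _; rewrite -ge0_integralZT//.
  + by apply: eq_integral => y _; rewrite muleCA.
  + exact: (measurableT_comp (mpair mG) (measurable_pair1 (tt, x))).
  + by move=> y; rewrite mule_ge0 ?lee_fin.
- exact: (measurableT_comp (minner mG (fun v => g0 v.2)) mu2).
- by move=> x; apply: integral_ge0 => y _; rewrite mule_ge0 ?lee_fin.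
Qed.

End exchange.

(** Adding [V ^+ 2] turns [charpow] into a parameter integral of a nonnegative function, whose
    measurability is part of Tonelli's theorem. *)
Lemma measurable_charpow a : measurable_fun setT a ->
  measurable_fun setT (fun r : R => charpow (fun x => r * a x)).
Proof.
move=> ma.
rewrite (_ : (fun r : R => _) =
    (fun r => fine (pairint a (fun u => (1 + cos (r * u))%:E)) - V ^+ 2)); last first.
  apply/funext => r; rewrite -(pairint_scale a (fun u => (1 + cos u)%:E)).
  by rewrite pairint_cos ?addrK 1?addrC ?addKr//; exact: measurable_funM.
apply: measurable_funB => //; apply: (measurableT_comp (fine_measurable measurableT)).
apply: (measurable_pairint ma (G := fun v : R * R => (1 + cos (v.1 * v.2))%:E)).
  apply/measurable_EFinP; apply: measurable_funD => //.
  apply: measurable_funcos.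
  by apply: measurable_funM; [exact: measurable_fst|exact: measurable_snd].
by move=> v; rewrite lee_fin; have := cos_geN1 (v.1 * v.2); lra.
Qed.

End characteristic_power.

Section exponential_average.
Context {R : realType}.
Local Notation mu := (@lebesgue_measure R).

Lemma measurable_expRN (e : R) : measurable_fun setT (fun r : R => expR (- (e * r))).
Proof.
apply: (measurableT_comp (@measurable_expR R)).
by apply: measurable_funN; apply: measurable_funM.
Qed.

Lemma integral_pw_expcos (e u : R) : 0 < e ->
  (\int[mu]_r ((pw 0 r * expR (- (e * r)))%:E * (1 + cos (r * u))%:E) =
   (e^-1)%:E + (kern e u)%:E)%E.
Proof.
move=> e0; rewrite -EFinD -(integral_expcos u e0).
have mf : measurable_fun setT (fun r : R => (1 + cos (r * u)) * expR (- (e * r))).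
  apply: measurable_funM; last exact: measurable_expRN.
  apply: measurable_funD => //.
  apply: measurable_funcos.
  exact: measurable_funM.
rewrite -integral_itv_obnd_cbnd; last first.
  by apply/measurable_EFinP; exact: (measurable_funS measurableT _ mf).
transitivity (\int[mu]_r ((pw 0 r)%:E * ((1 + cos (r * u)) * expR (- (e * r)))%:E))%E.
  by apply: eq_integral => r _; rewrite -!EFinM -mulrA; congr (_ * _)%:E; exact: mulrC.
by rewrite -integral_pw; apply: eq_integral => r _; rewrite powRr0 mul1e.
Qed.

Lemma integral_pw_exp (e : R) : 0 < e ->
  (\int[mu]_r (pw 0 r * expR (- (e * r)))%:E = (e^-1)%:E)%E.
Proof.
move=> e0; have me : measurable_fun setT (fun r : R => (pw 0 r * expR (- (e * r)))%:E).
  apply/measurable_EFinP; apply: measurable_funM; first exact: measurable_pw.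
  exact: measurable_expRN.
have H := integral_pw_expcos 0 e0.
transitivity (\int[mu]_r ((1 / 2)%:E * ((pw 0 r * expR (- (e * r)))%:E * (1 + cos (r * 0))%:E)))%E.
  apply: eq_integral => r _; rewrite mulr0 cos0 -!EFinM; congr (_%:E).
  by field.
rewrite ge0_integralZT//.
- rewrite H -EFinD -EFinM /kern (gtr0_norm e0); congr (_%:E).
  by field; rewrite gt_eqF.
- apply: emeasurable_funM => //.
  by rewrite (_ : (fun _ => _) = fun=> (1 + 1)%:E)//; apply/funext => r; rewrite mulr0 cos0.
- move=> r; rewrite mulr0 cos0 -EFinM lee_fin mulr_ge0 ?addr_ge0//.
  by rewrite mulr_ge0 ?pw_ge0 ?expR_ge0.
Qed.

Section average_identity.
Context d (T : measurableType d).
Variables (m : {sigma_finite_measure set T -> \bar R}) (K : set T) (a : T -> R).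
Hypotheses (mK : measurable K) (finK : (m K < +oo)%E) (ma : measurable_fun setT a).

Let Q (r : R) := charpow m K (fun x => r * a x).

Let mQ : measurable_fun setT Q.
Proof. exact: measurable_charpow. Qed.

Let mexp (e : R) : measurable_fun setT (fun r : R => (pw 0 r * expR (- (e * r)))%:E).
Proof.
apply/measurable_EFinP; apply: measurable_funM; first exact: measurable_pw.
exact: measurable_expRN.
Qed.

Let exp0 (e r : R) : (0 <= (pw 0 r * expR (- (e * r)))%:E)%E.
Proof. by rewrite lee_fin mulr_ge0 ?pw_ge0 ?expR_ge0. Qed.

(* Adding the finite quantity [V^2 / e] to both sides makes the integrands nonnegative, so that
   Tonelli's theorem applies. *)
Lemma charpow_exp_average (e : R) : 0 < e ->
  (\int[mu]_r ((pw 0 r * expR (- (e * r)))%:E * (Q r)%:E) =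
   pairint m K a (fun u => (kern e u)%:E))%E.
Proof.
move=> e0; pose V := fine (m K).
have mk : measurable_fun setT (fun u : R => (kern e u)%:E).
  by apply/measurable_EFinP; exact: (measurableT_comp (@measurable_kern R) (measurable_pair1 e)).
have Vfin : (V ^+ 2 * e^-1)%:E \is a fin_num by [].
rewrite -[LHS](addeK _ Vfin) -[RHS](addeK _ Vfin); congr (_ - _)%E.
rewrite addeC [RHS]addeC.
transitivity (\int[mu]_r ((pw 0 r * expR (- (e * r)))%:E * (V ^+ 2 + Q r)%:E))%E.
  transitivity (\int[mu]_r ((V ^+ 2)%:E * (pw 0 r * expR (- (e * r)))%:E +
      (pw 0 r * expR (- (e * r)))%:E * (Q r)%:E))%E; last first.
    by apply: eq_integral => r _; rewrite -!EFinM -EFinD; congr (_%:E); ring.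
  rewrite ge0_integralDT.
  - by rewrite (ge0_integralZT mu (mexp e)) ?sqr_ge0// integral_pw_exp.
  - exact: (measurable_funeM _ (mexp e)).
  - by apply: (emeasurable_funM (mexp e)); exact/measurable_EFinP.
  - by move=> r; rewrite mule_ge0 ?exp0// lee_fin sqr_ge0.
  - by move=> r; rewrite mule_ge0 ?exp0// lee_fin charpow_ge0.
transitivity (\int[mu]_r pairint m K a (fun u => (pw 0 r * expR (- (e * r)))%:E * (1 + cos (r * u))%:E))%E.
  apply: eq_integral => r _; rewrite pairintZ//.
  - rewrite -(pairint_scale m K a (fun u => (1 + cos u)%:E)) pairint_cos//.
    exact: measurable_funM.
  - by have := exp0 e r; rewrite lee_fin.
  - apply/measurable_EFinP; apply: measurable_funD => //.
    apply: measurable_funcos.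
    exact: measurable_funM.
pose G (v : R * R) : \bar R :=
  ((pw 0 v.1 * expR (- (e * v.1)))%:E * (1 + cos (v.1 * v.2))%:E)%E.
have mG : measurable_fun setT G.
  apply: emeasurable_funM; first by apply: (measurableT_comp (mexp e)); exact: measurable_fst.
  apply/measurable_EFinP; apply: measurable_funD => //.
  apply: measurable_funcos.
  by apply: measurable_funM; [exact: measurable_fst|exact: measurable_snd].
have G0 v : (0 <= G v)%E.
  by rewrite mule_ge0// lee_fin; have := cos_geN1 (v.1 * v.2); lra.
rewrite (pairint_exchange m mK ma mu mG G0).
rewrite (_ : (fun u => _) = (fun u => (e^-1)%:E + (kern e u)%:E)%E); last first.
  by apply/funext => u; exact: integral_pw_expcos.
rewrite pairintD//; first by rewrite pairint_cst// mulrC.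
- by move=> u; rewrite lee_fin invr_ge0 ltW.
- by move=> u; rewrite lee_fin kern_ge0.
Qed.

(** For [r > 0], scaling the Gamma integral by [r] shows that [c r^(p-1)] is the integral of
    [e^(-p) exp (- e r)] over [e > 0]; Tonelli then reduces the claim to [charpow_exp_average] for
    each [e]. *)
Lemma charpow_power_average (p c : R) : 0 < p -> p < 1 ->
  (\int[mu]_e ((pw (- p) e)%:E * (expR (- e))%:E) = c%:E)%E ->
  (c%:E * \int[mu]_r ((pw (p - 1) r)%:E * (Q r)%:E) = pairint m K a (pkern p))%E.
Proof.
move=> p0 p1 gc.
have c0 : 0 <= c.
  rewrite -lee_fin -gc; apply: integral_ge0 => e _.
  by rewrite mule_ge0 ?lee_fin ?pw_ge0 ?expR_ge0.
have pp (e : R) : (0 <= (pw (- p) e)%:E :> \bar R)%E by rewrite lee_fin pw_ge0.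
have mk : measurable_fun setT (fun v : R * R => (pw (- p) v.1)%:E * (kern v.1 v.2)%:E)%E.
  apply: emeasurable_funM.
    by apply: (measurableT_comp (measurable_EFin_pw (- p))); exact: measurable_fst.
  by apply/measurable_EFinP; exact: measurable_kern.
have k0 (v : R * R) : (0 <= (pw (- p) v.1)%:E * (kern v.1 v.2)%:E)%E.
  by rewrite mule_ge0// lee_fin kern_ge0.
rewrite /pkern -(pairint_exchange m mK ma mu mk k0).
have mQE : measurable_fun setT (fun r => (Q r)%:E) by exact/measurable_EFinP.
have Q0 r : (0 <= (Q r)%:E)%E by rewrite lee_fin charpow_ge0.
pose H (v : R * R) : \bar R :=
  ((pw (- p) v.1)%:E * ((pw 0 v.2 * expR (- (v.1 * v.2)))%:E * (Q v.2)%:E))%E.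
have mH : measurable_fun setT H.
  apply: emeasurable_funM.
    by apply: (measurableT_comp (measurable_EFin_pw (- p))); exact: measurable_fst.
  apply: emeasurable_funM; last by apply: (measurableT_comp mQE); exact: measurable_snd.
  apply/measurable_EFinP; apply: measurable_funM.
    by apply: (measurableT_comp (measurable_pw 0)); exact: measurable_snd.
  apply: (measurableT_comp (@measurable_expR R)); apply: measurable_funN.
  by apply: measurable_funM; [exact: measurable_fst|exact: measurable_snd].
have H0 v : (0 <= H v)%E by rewrite !mule_ge0.
transitivity (\int[mu]_e \int[mu]_r H (e, r))%E; last first.
  apply: eq_integral => e _.
  rewrite -[RHS]/(pairint m K a (fun u => (pw (- p) e)%:E * (kern e u)%:E)%E).
  have [e0|e0] := leP e 0.
    rewrite /H/= pwN// [RHS](_ : _ = pairint m K a (fun=> 0%:E)); last first.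
      by congr pairint; apply/funext => u; rewrite mul0e.
    by rewrite pairint_cst// mul0r; apply: integral0_eq => r _; rewrite mul0e.
  rewrite pairintZ ?pw_ge0//; last 2 first.
  - by apply/measurable_EFinP; exact: (measurableT_comp (@measurable_kern R) (measurable_pair1 e)).
  - by move=> u; rewrite lee_fin kern_ge0.
  have me : measurable_fun setT (fun r : R => (pw 0 r * expR (- (e * r)))%:E * (Q r)%:E)%E.
    exact: emeasurable_funM.
  rewrite -(charpow_exp_average e0) -(ge0_integralZT mu me) ?pw_ge0// => r.
  by rewrite mule_ge0.
rewrite (@fubini_tonelli _ _ _ _ R mu mu H mH H0) -ge0_integralZT//.
- apply: eq_integral => r _; have [r0|r0] := leP r 0.
    rewrite pwN// mul0e mule0; apply/esym; apply: integral0_eq => e _.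
    by rewrite /H/= (pwN 0 r0) mul0r mul0e mule0.
  have mE : measurable_fun setT (fun e : R => (expR (- e))%:E).
    apply/measurable_EFinP; apply: (measurableT_comp (@measurable_expR R)).
    exact: measurable_funN.
  have E0 (e : R) : (0 <= (expR (- e))%:E :> \bar R)%E by rewrite lee_fin expR_ge0.
  rewrite -gc -(ge0_integral_pw_scale (- p) r0 mE E0).
  have mEr : measurable_fun setT (fun e : R => (expR (- (r * e)))%:E).
    by apply/measurable_EFinP; exact: measurable_expRN.
  transitivity ((Q r)%:E * \int[mu]_e ((pw (- p) e)%:E * (expR (- (r * e)))%:E))%E.
    rewrite (pwE _ r0) muleA muleC; congr (_ * _)%E; rewrite muleAC -EFinM.
    rewrite -powRD; last by rewrite (gt_eqF r0) implybT.
    by rewrite (_ : _ + _ = 0) ?powRr0 ?mul1e//; ring.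
  rewrite -ge0_integralZT ?charpow_ge0//.
  + apply: eq_integral => e _; rewrite /H/= (pwE 0 r0) powRr0 mul1r.
    by rewrite muleCA; congr (_ * _)%E; rewrite muleC (mulrC r).
  + by apply: emeasurable_funM => //; exact: measurable_EFin_pw.
  + by move=> e; rewrite mule_ge0// lee_fin expR_ge0.
- by apply: emeasurable_funM => //; exact: measurable_EFin_pw.
- by move=> r; rewrite mule_ge0// lee_fin pw_ge0.
Qed.

End average_identity.
End exponential_average.

(** * The covariogram and its planar marginals *)

Section covariogram.
Context {R : realType}.
Local Notation mu := (@lebesgue_measure R).

Lemma bounded_density_supp n (f : 'rV[R]_n -> R) :
  0 < rint f -> exists v, f v != 0.
Proof.
apply: contraPP => /forallNP f0 /=; rewrite /rint integral0_eq ?ltxx// => v _.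
by have /negP := f0 v; rewrite negbK => /eqP ->.
Qed.

Lemma le_rint_cube n (f : 'rV[R]_n -> R) (c : 'rV[R]_n) (e d : R) :
  bounded_density f -> 0 < e -> 0 <= d -> (forall v, cube e (v - c) -> d <= f v) ->
  d * (2 * e) ^+ n <= rint f.
Proof.
move=> bf e0 d0 df; have [mf f0 _ _] := bf.
rewrite -lee_fin -rintE// EFinM -(cube_shift_measure c e0).
have mc : measurable [set v : 'rV[R]_n | cube e (v - c)].
  rewrite -[X in measurable X]setTI.
  apply: (measurable_rVD (@measurable_id _ _ setT) (@measurable_cst _ _ _ _ _ (- c))) => //.
  exact: measurable_cube.
rewrite -integral_rV_indic// -ge0_integralZT//; last exact: measurable_EFin_indic.
apply: ge0_le_integral => //.
- by move=> v _; rewrite mule_ge0 ?lee_fin.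
- by apply: measurable_funeM; exact: measurable_EFin_indic.
- exact/measurable_EFinP.
move=> v _; rewrite -EFinM lee_fin indicE; case: (boolP (v \in _)) => [|_]; last by rewrite mulr0.
by rewrite inE mulr1 => /df.
Qed.

Variables (n : nat) (K : set 'rV[R]_n).
Hypothesis sK : solid K.
Local Notation lam := (lebesgue_rV R n).

Let mK : measurable K. Proof. by have [] := sK. Qed.

Definition overlap (z y : 'rV[R]_n) : R := \1_K y * \1_K (y + z).

Definition covg (z : 'rV[R]_n) : R := rint (overlap z).

Lemma overlap_ge0 z y : 0 <= overlap z y.
Proof. by rewrite mulr_ge0. Qed.

Lemma overlap_neq0 z y : overlap z y != 0 -> K y /\ K (y + z).
Proof.
rewrite /overlap !indicE; case: (boolP (y \in K)); last by rewrite mul0r eqxx.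
rewrite inE => Ky; case: (boolP (_ \in K)); last by rewrite mulr0 eqxx.
by rewrite inE.
Qed.

Lemma overlap1 z y : K y -> K (y + z) -> overlap z y = 1.
Proof. by move=> Ky Kz; rewrite /overlap !indicE !mem_set// mulr1. Qed.

Lemma overlap_le1 z y : overlap z y <= 1.
Proof.
rewrite /overlap !indicE.
by case: (_ \in K); case: (_ \in K); rewrite ?mulr1 ?mulr0 ?mul0r.
Qed.

Lemma measurable_overlap :
  measurable_fun setT (fun v : 'rV[R]_n * 'rV[R]_n => overlap v.1 v.2).
Proof.
have mi : measurable_fun setT (\1_K : 'rV[R]_n -> R) by exact: measurable_indic.
apply: measurable_funM; first by apply: (measurableT_comp mi); exact: measurable_snd.
apply: (measurableT_comp mi).
by apply: measurable_rVD; [exact: measurable_snd|exact: measurable_fst].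
Qed.

Lemma bounded_density_overlap z : bounded_density (overlap z).
Proof.
have [_ _ [D D0 KD] _] := sK; split.
- exact: (measurableT_comp measurable_overlap (measurable_pair1 z)).
- exact: overlap_ge0.
- by exists 1 => y; exact: overlap_le1.
- by exists D => // y /lt0r_neq0/overlap_neq0[/KD].
Qed.

Lemma covgE z : (\int[lam]_y (overlap z y)%:E = (covg z)%:E)%E.
Proof. exact: (rintE (bounded_density_overlap z)). Qed.

Lemma covg_ge0 z : 0 <= covg z.
Proof. by apply: rint_ge0; exact: overlap_ge0. Qed.

Lemma covgN z : covg (- z) = covg z.
Proof.
apply: EFin_inj; rewrite -!covgE.
have mo : measurable_fun setT (fun y => (overlap (- z) y)%:E).
  apply/measurable_EFinP.
  exact: (measurableT_comp measurable_overlap (measurable_pair1 (- z))).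
rewrite -(ge0_integral_rV_shift z mo) => [|v]; last by rewrite lee_fin overlap_ge0.
by apply: eq_integral => y _; rewrite /overlap addrK mulrC.
Qed.

Lemma bounded_density_covg : bounded_density covg.
Proof.
have [_ _ [D D0 KD] _] := sK; split.
- apply: (measurableT_comp (fine_measurable measurableT)).
  apply: (@measurable_fun_fubini_tonelli_F _ _ _ _ R lam (fun v => (overlap v.1 v.2)%:E)).
    by apply/measurable_EFinP; exact: measurable_overlap.
  by move=> v; rewrite lee_fin overlap_ge0.
- exact: covg_ge0.
- exists (1 * (2 * D) ^+ n) => z; rewrite -lee_fin -covgE.
  apply: integral_bounded_density => //.
  + by have [] := bounded_density_overlap z.
  + by move=> v; rewrite overlap_ge0 overlap_le1.
  + by move=> v /lt0r_neq0/overlap_neq0[/KD].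
- exists (2 * D) => [|z]; first exact: mulr_gt0.
  move=> /bounded_density_supp[y /overlap_neq0[/KD yD /KD zD]] i.
  rewrite (_ : z ord0 i = (y + z) ord0 i - y ord0 i); last by rewrite mxE addrC addKr.
  by rewrite (le_lt_trans (ler_normB _ _))// mulr_natl mulr2n ltrD// ?zD ?yD.
Qed.

Lemma covg_pos : exists e d : R, [/\ 0 < e, 0 < d & forall z, cube e z -> d <= covg z].
Proof.
have [_ _ _ [c [e [e0 Ke]]]] := sK.
(* With both [z] and [v - c] in the half-size cube, [v] and [v + z] stay within the cube of size [e]
   around [c]. *)
exists (e / 2), (1 * (2 * (e / 2)) ^+ n); split; first by rewrite divr_gt0.
  by rewrite mul1r exprn_gt0// mulr_gt0// divr_gt0.
move=> z zc; apply: (le_rint_cube (c := c) (bounded_density_overlap z)) => //.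
  by rewrite divr_gt0.
move=> v vc; rewrite overlap1//.
  rewrite -(subrK c v) addrC; apply: Ke => i; apply: lt_trans (vc i) _; lra.
rewrite -(subrK c v) addrAC addrC; apply: Ke => i.
rewrite mxE (le_lt_trans (ler_normD _ _))// [ltRHS](_ : _ = e / 2 + e / 2); last by field.
by rewrite ltrD// ?zc ?vc.
Qed.

(** The pairs [(z, y)] with [y] and [y + z] in [K] form a convex set, so its indicator [overlap] is
    log-concave; Prekopa integrates out [y]. *)
Lemma logconcave_covg (a b : R) z1 z2 : 0 < a -> 0 < b -> a + b = 1 ->
  covg z1 `^ a * covg z2 `^ b <= covg (a *: z1 + b *: z2).
Proof.
have [_ cK _ _] := sK.
apply: (prekopa bounded_density_overlap) => {}a {}b x1 x2 y1 y2 a0 b0 ab.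
have [->|/overlap_neq0[h1 h2]] := eqVneq (overlap x1 y1) 0.
  by rewrite powR0 ?gt_eqF// mul0r overlap_ge0.
have [->|/overlap_neq0[h3 h4]] := eqVneq (overlap x2 y2) 0.
  by rewrite powR0 ?gt_eqF// mulr0 overlap_ge0.
have K1 : K (a *: y1 + b *: y2) by apply: cK => //; exact: ltW.
have K2 : K (a *: (y1 + x1) + b *: (y2 + x2)) by apply: cK => //; exact: ltW.
rewrite !overlap1//; first by rewrite !powR1 mulr1.
by move: K2; rewrite !scalerDr addrACA.
Qed.

(** Substitute [x = y + z]: by additivity [a x - a y] becomes [a z], and the remaining integral over
    [y] is the covariogram. *)
Lemma pairint_covg (a : 'rV[R]_n -> R) (g : R -> \bar R) :
  measurable_fun setT a -> measurable_fun setT g -> (forall u, 0 <= g u)%E ->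
  (forall x y, a (x + y) = a x + a y) ->
  (pairint lam K a g = \int[lam]_z ((covg z)%:E * g (a z)))%E.
Proof.
move=> ma mg g0 aD.
have mi : measurable_fun setT (\1_K : 'rV[R]_n -> R) by exact: measurable_indic.
pose F (v : 'rV[R]_n * 'rV[R]_n) : \bar R :=
  ((\1_K v.1 * \1_K v.2)%:E * g (a v.1 - a v.2)%R)%E.
have mF : measurable_fun setT F.
  apply: emeasurable_funM.
    apply/measurable_EFinP; apply: measurable_funM; apply: (measurableT_comp mi).
      exact: measurable_fst.
    exact: measurable_snd.
  apply: (measurableT_comp mg); apply: measurable_funB; apply: (measurableT_comp ma).
    exact: measurable_fst.
  exact: measurable_snd.
have F0 v : (0 <= F v)%E by rewrite mule_ge0// lee_fin mulr_ge0.
rewrite /pairint (@fubini_tonelli _ _ _ _ R lam lam F mF F0).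
pose G (v : 'rV[R]_n * 'rV[R]_n) : \bar R := ((overlap v.2 v.1)%:E * g (a v.2))%E.
have mo : measurable_fun setT (fun v : 'rV[R]_n * 'rV[R]_n => (overlap v.2 v.1)%:E).
  have msw : measurable_fun setT (fun v : 'rV[R]_n * 'rV[R]_n => (v.2, v.1)).
    by apply: measurable_fun_pair; [exact: measurable_snd|exact: measurable_fst].
  by apply/measurable_EFinP; exact: (measurableT_comp measurable_overlap msw).
have mG : measurable_fun setT G.
  apply: (emeasurable_funM mo); apply: (measurableT_comp mg); apply: (measurableT_comp ma).
  exact: measurable_snd.
have G0 v : (0 <= G v)%E by rewrite mule_ge0// lee_fin overlap_ge0.
transitivity (\int[lam]_y \int[lam]_z G (y, z))%E.
  apply: eq_integral => y _.
  rewrite -(ge0_integral_rV_shift y (measurableT_comp mF (measurable_pair2 y))) => [|v]; last exact: F0.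
  apply: eq_integral => z _; rewrite /F /G /overlap/= aD addrK mulrC.
  by rewrite (addrC z).
rewrite (@fubini_tonelli _ _ _ _ R lam lam G mG G0).
apply: eq_integral => z _; rewrite /G/=.
have moz : measurable_fun setT (fun y => (overlap z y)%:E).
  by apply/measurable_EFinP; have [] := bounded_density_overlap z.
rewrite -covgE -[RHS](ge0_integralZr lam measurableT moz) => [//|y _|].
  by rewrite lee_fin overlap_ge0.
exact: g0.
Qed.

End covariogram.

Section planar_marginal.
Context {R : realType}.

Lemma consrN n (x : R) (v : 'rV[R]_n) : consr (- x, - v) = - consr (x, v).
Proof. by rewrite -[RHS]scaleN1r consrZ mulN1r scaleN1r. Qed.

Local Notation mu := (@lebesgue_measure R).
Variables (m : nat) (K : set 'rV[R]_m.+2).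
Hypothesis sK : solid K.
Local Notation lam := (lebesgue_rV R m).

Let C (s t : R) (w : 'rV[R]_m) : R := covg K (consr (s, consr (t, w))).

Definition marginal (s t : R) : R := rint (C s t).

Let bC s t : bounded_density (C s t).
Proof.
have := bounded_density_slice s (bounded_density_covg sK).
exact: bounded_density_slice.
Qed.

Let marginalE s t : (\int[lam]_w (C s t w)%:E = (marginal s t)%:E)%E.
Proof. exact: (rintE (bC s t)). Qed.

Let mC : measurable_fun setT (fun v : (R * R) * 'rV[R]_m => C v.1.1 v.1.2 v.2).
Proof.
have [mc _ _ _] := bounded_density_covg sK; apply: (measurableT_comp mc).
have m1 : measurable_fun setT (fun v : (R * R) * 'rV[R]_m => v.1.1).
  by apply: (measurableT_comp (@measurable_fst _ _ R R)); exact: measurable_fst.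
have m2 : measurable_fun setT (fun v : (R * R) * 'rV[R]_m => v.1.2).
  by apply: (measurableT_comp (@measurable_snd _ _ R R)); exact: measurable_fst.
apply: (measurableT_comp (@measurable_consr R m.+1)); apply: measurable_fun_pair => //.
by apply: (measurableT_comp (@measurable_consr R m)); apply: measurable_fun_pair.
Qed.

Lemma planar_density_marginal : planar_density marginal.
Proof.
have [mc c0 [M cM] [D D0 cD]] := bounded_density_covg sK.
have cube2 e s t (w : 'rV[R]_m) :
    cube e (consr (s, consr (t, w))) <-> [/\ `|s| < e, `|t| < e & cube e w].
  split=> [H|[se te we] i].
    split; first by have := H ord0; rewrite consr_ord0.
      by have := H (lift ord0 ord0); rewrite consr_lift consr_ord0.
    by move=> i; have := H (lift ord0 (lift ord0 i)); rewrite !consr_lift.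
  have [j ->|->] := unliftP ord0 i; last by rewrite consr_ord0.
  rewrite consr_lift; have [k ->|->] := unliftP ord0 j; last by rewrite consr_ord0.
  by rewrite consr_lift.
split.
- apply: (measurableT_comp (fine_measurable measurableT)).
  apply: (@measurable_fun_fubini_tonelli_F _ _ _ _ R lam (fun v : (R * R) * 'rV[R]_m => (C v.1.1 v.1.2 v.2)%:E)).
    by apply/measurable_EFinP; exact: mC.
  by move=> v; rewrite lee_fin c0.
- by move=> s t; apply: rint_ge0 => w; exact: c0.
- exists (M * (2 * D) ^+ m) => s t; rewrite -lee_fin -(marginalE s t).
  apply: integral_bounded_density => //.
  + by have [] := bC s t.
  + by move=> w; rewrite c0 cM.
  + by move=> w /cD/cube2[].
- exists D => // s t /bounded_density_supp[w Cw].
  have /cD/cube2[sD tD _] : 0 < covg K (consr (s, consr (t, w))) by rewrite lt0r Cw c0.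
  by split; exact: ltW.
- have [e [d [e0 d0 He]]] := covg_pos sK.
  exists e, (d * (2 * e) ^+ m); split => //; first by rewrite mulr_gt0// exprn_gt0// mulr_gt0.
  move=> s t se te; apply: (le_rint_cube (c := 0) (bC s t)) => //; first exact: ltW.
  by move=> w; rewrite subr0 => we; apply: He; apply/cube2.
- apply: (@prekopa R m (R^o * R^o)%type (fun u => C u.1 u.2)) => [u|a b u1 u2 v1 v2 a0 b0 ab].
    exact: bC.
  by rewrite /C; have := logconcave_covg sK (consr (u1.1, consr (u1.2, v1)))
    (consr (u2.1, consr (u2.2, v2))) a0 b0 ab; rewrite !consrZ !consrD.
- move=> s t; apply: EFin_inj; rewrite -[LHS]marginalE -[RHS]marginalE.
  have mCs : measurable_fun setT (fun w => (C (- s) (- t) w)%:E).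
    by apply/measurable_EFinP; have [] := bC (- s) (- t).
  rewrite -[LHS](ge0_integral_rVN mCs) => [|w]; last by rewrite lee_fin c0.
  apply: eq_integral => w _; congr (_%:E).
  by rewrite /C !consrN covgN.
Qed.

Lemma pairint_marginal (p a b : R) :
  pairint (lebesgue_rV R m.+2) K
    (fun x => a * x ord0 ord0 + b * x ord0 (lift ord0 ord0)) (pkern p) =
  planar_energy p marginal a b.
Proof.
have [mc c0 _ _] := bounded_density_covg sK.
have ma : measurable_fun setT (fun x : 'rV[R]_m.+2 => a * x ord0 ord0 + b * x ord0 (lift ord0 ord0)).
  by apply: measurable_funD; apply: measurable_funM => //; exact: measurable_coord.
have mp := @measurable_pkern R p.
rewrite (pairint_covg sK ma mp (pkern_ge0 p)); last first.
  by move=> x y; rewrite !mxE; ring.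
have mF : measurable_fun setT (fun z : 'rV[R]_m.+2 =>
    (covg K z)%:E * pkern p (a * z ord0 ord0 + b * z ord0 (lift ord0 ord0))%R)%E.
  apply: emeasurable_funM; first exact/measurable_EFinP.
  exact: (measurableT_comp mp ma).
have F0 (z : 'rV[R]_m.+2) :
    (0 <= (covg K z)%:E * pkern p (a * z ord0 ord0 + b * z ord0 (lift ord0 ord0))%R)%E.
  by rewrite mule_ge0 ?pkern_ge0// lee_fin c0.
rewrite (ge0_integral_rVS mF F0); apply: eq_integral => s _.
rewrite (ge0_integral_rVS (measurableT_comp mF (@measurable_consr_r R m.+1 s)) (fun w => F0 _)).
apply: eq_integral => t _ /=.
rewrite -(marginalE s t) -[RHS](ge0_integralZr lam measurableT).
- by apply: eq_integral => w _; rewrite consr_lift !consr_ord0.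
- by apply/measurable_EFinP; have [] := bC s t.
- by move=> w _; rewrite lee_fin c0.
- exact: pkern_ge0.
Qed.

End planar_marginal.

(** * Decay and regularity of the power means *)

Section dot_product.
Context {R : realType} {n : nat}.
Implicit Types x y z : 'rV[R]_n.

Lemma dotrC x y : dotr x y = dotr y x.
Proof. by apply: eq_bigr => i _; rewrite mulrC. Qed.

Lemma dotrDr x y z : dotr x (y + z) = dotr x y + dotr x z.
Proof. by rewrite -big_split/=; apply: eq_bigr => i _; rewrite mxE mulrDr. Qed.

Lemma dotrDl x y z : dotr (x + y) z = dotr x z + dotr y z.
Proof. by rewrite dotrC dotrDr !(dotrC z). Qed.

Lemma dotrZr c x y : dotr x (c *: y) = c * dotr x y.
Proof. by rewrite mulr_sumr; apply: eq_bigr => i _; rewrite mxE mulrCA. Qed.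

Lemma dotrZl c x y : dotr (c *: x) y = c * dotr x y.
Proof. by rewrite dotrC dotrZr dotrC. Qed.

Lemma dotr0 x : dotr x 0 = 0.
Proof. by apply: big1 => i _; rewrite mxE mulr0. Qed.

Lemma dotr_ge0 x : 0 <= dotr x x.
Proof. by apply: sumr_ge0 => i _; rewrite -expr2 sqr_ge0. Qed.

Lemma sqr_le_dotr x i : x ord0 i ^+ 2 <= dotr x x.
Proof.
rewrite /dotr (bigD1 i)//= -expr2 lerDl.
by apply: sumr_ge0 => j _; rewrite -expr2 sqr_ge0.
Qed.

Lemma dotr_gt0 x : (0 < dotr x x) = (x != 0).
Proof.
rewrite lt0r dotr_ge0 andbT; congr (~~ _); apply/eqP/eqP => [x0|->]; last exact: dotr0.
apply/rowP => i; rewrite mxE; apply/eqP; rewrite -sqrf_eq0 eq_le sqr_ge0 andbT.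
by rewrite -x0 sqr_le_dotr.
Qed.

Lemma measurable_dotr y : measurable_fun setT (dotr y).
Proof.
apply: measurable_sum => i; apply: measurable_funM => //; exact: measurable_coord.
Qed.

End dot_product.

(** * Quadratic decay of the power spectrum *)

Section decay.
Context {R : realType}.
Variables (n : nat) (K : set 'rV[R]_n).
Hypothesis sK : solid K.
Local Notation lam := (lebesgue_rV R n).
Local Notation V := (fine (lam K)).

Let mK : measurable K. Proof. by have [] := sK. Qed.

Lemma solid_finite : (lam K < +oo)%E.
Proof. by have /andP[] := solid_measure sK. Qed.
Let finK := solid_finite.

Lemma solid_volume_gt0 : 0 < V.
Proof. by rewrite fine_gt0// solid_measure. Qed.

Lemma covg0 : covg K 0 = V.
Proof.
congr fine; rewrite -integral_rV_indic//; apply: eq_integral => y _.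
by rewrite /overlap addr0 indicE; case: (_ \in _); rewrite ?mulr1 ?mulr0.
Qed.

Let im (h : 'rV[R]_n -> R) (mh : measurable_fun setT h) (phi : R) :
  lam.-integrable K (EFin \o (fun x => cos (h x + phi))).
Proof.
by apply: (cos_integrable mK finK); exact: measurable_funD.
Qed.

Section phase.
Variable h : 'rV[R]_n -> R.
Hypothesis mh : measurable_fun setT h.

Let m1c (phi : R) : measurable_fun setT (fun x => (\1_K x * (1 + cos (h x + phi)))%:E).
Proof.
apply/measurable_EFinP; apply: measurable_funM; first exact: measurable_indic.
apply: measurable_funD => //.
apply: measurable_funcos.
exact: measurable_funD.
Qed.

Let p1c (phi : R) x : (0 <= (\1_K x * (1 + cos (h x + phi)))%:E :> \bar R)%E.
Proof. by rewrite lee_fin mulr_ge0//; have := cos_geN1 (h x + phi); lra. Qed.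

Lemma integral_1cos phi : (\int[lam]_x (\1_K x * (1 + cos (h x + phi)))%:E =
  (V + \int[lam]_(x in K) cos (h x + phi))%R%:E)%E.
Proof.
have i1 : lam.-integrable K (EFin \o (fun=> 1)).
  apply: (bounded_on_integrable mK finK (M := 1)) => [|x]; first exact: measurable_cst.
  by rewrite normr1.
rewrite (integral_indic_Rintegral mK); last exact: (integrableD mK i1 (im mh phi)).
by rewrite (RintegralD mK i1 (im mh phi)) (Rintegral_cst lam mK) mul1r.
Qed.

Lemma phase_ge phi : - V <= \int[lam]_(x in K) cos (h x + phi).
Proof.
rewrite -subr_ge0 opprK addrC -lee_fin -integral_1cos.
by apply: integral_ge0 => x _; exact: p1c.
Qed.

(* Translating [K] by [z] changes the sign of the oscillating factor. *)
Lemma phase_le phi z : h z = pi -> (forall x y, h (x + y) = h x + h y) ->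
  \int[lam]_(x in K) cos (h x + phi) <= V - covg K z.
Proof.
move=> hz hD; set C := Rintegral _ _ _.
have mi : measurable_fun setT (fun x => (\1_K x)%:E : \bar R) by exact: measurable_EFin_indic.
have mz : measurable_fun setT (fun x : 'rV[R]_n => x + z) by exact: measurable_rVD.
have E1 := integral_1cos phi; rewrite -/C in E1.
have E2 : (\int[lam]_x (\1_K (x + z)%R * (1 - cos (h x + phi)))%:E = (V + C)%:E)%E.
  rewrite -E1 -[RHS](ge0_integral_rV_shift z (m1c phi) (p1c phi)).
  apply: eq_integral => x _; congr (_ * (1 + _))%:E.
  by rewrite hD hz addrAC cosDpi.
have E3 : (\int[lam]_x (\1_K x)%:E = V%:E)%E.
  by rewrite integral_rV_indic// fineK// ge0_fin_numE.
have E4 : (\int[lam]_x (\1_K (x + z)%R)%:E = V%:E)%E.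
  by rewrite -E3 -[RHS](ge0_integral_rV_shift z mi) => [//|x]; rewrite lee_fin.
have E5 := covgE sK z.
have mo : measurable_fun setT (fun y => (overlap K z y)%:E).
  by apply/measurable_EFinP; have [] := bounded_density_overlap sK z.
have m2 : measurable_fun setT (fun x : 'rV[R]_n => (\1_K (x + z)%R * (1 - cos (h x + phi)))%:E).
  apply/measurable_EFinP; apply: measurable_funM.
    by apply: (measurableT_comp _ mz); exact: measurable_indic.
  apply: measurable_funB => //.
  apply: measurable_funcos.
  exact: measurable_funD.
have p2 x : (0 <= (\1_K (x + z)%R * (1 - cos (h x + phi)))%:E :> \bar R)%E.
  by rewrite lee_fin mulr_ge0//; have := cos_le1 (h x + phi); lra.
have o0 x : (0 <= (overlap K z x)%:E)%E by rewrite lee_fin overlap_ge0.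
have q0 x : (0 <= 2%:E * (overlap K z x)%:E)%E by rewrite mule_ge0.
have mz1 : measurable_fun setT (fun x : 'rV[R]_n => (\1_K (x + z)%R)%:E : \bar R).
  exact: (measurableT_comp mi mz).
suff : ((V + C) + ((V + C) + 2 * covg K z) <= 2 * (V + V))%R by lra.
rewrite -lee_fin EFinD (EFinD (V + C)) (EFinM 2 (covg K z)) (EFinM 2 (V + V)) (EFinD V V).
rewrite -{1}E1 -E2 -E5 -{1}E3 -E4.
rewrite -(ge0_integralZT lam mo) ?overlap_ge0//.
rewrite -(ge0_integralDT lam m2 (measurable_funeM 2%:E mo) p2 q0).
have m3 := emeasurable_funD m2 (measurable_funeM 2%:E mo).
have p3 x := adde_ge0 (p2 x) (q0 x).
rewrite -(ge0_integralDT lam (m1c phi) m3 (p1c phi) p3).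
have i0 x : (0 <= (\1_K x)%:E :> \bar R)%E by rewrite lee_fin.
rewrite -(ge0_integralDT lam mi mz1 i0 (fun x => i0 _)).
rewrite -(ge0_integralZT lam (emeasurable_funD mi mz1)) ?ler0n//; last first.
  by move=> x; exact: adde_ge0.
apply: ge0_le_integral => //.
- by move=> x _; exact: adde_ge0 (p1c phi x) (p3 x).
- exact: (emeasurable_funD (m1c phi) m3).
- exact: (measurable_funeM 2%:E (emeasurable_funD mi mz1)).
move=> x _; rewrite -EFinM -!EFinD -EFinM lee_fin /overlap !indicE.
have c1 := cos_geN1 (h x + phi); have c2 := cos_le1 (h x + phi).
by case: (x \in K); case: (_ \in K); rewrite /=; lra.
Qed.

(** The phases [phi] and [phi + pi] give opposite values, so the upper bound is two-sided; [phi = 0]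
    and [phi = - pi / 2] recover the cosine and the sine integral. *)
Lemma charpow_le_phase e : (forall phi, \int[lam]_(x in K) cos (h x + phi) <= e) ->
  charpow lam K h <= 2 * e ^+ 2.
Proof.
move=> He.
have N phi : \int[lam]_(x in K) cos (h x + (phi + pi)) = - \int[lam]_(x in K) cos (h x + phi).
  rewrite -mulN1r -(RintegralZl _ mK (im mh phi)); apply: eq_Rintegral => x _.
  by rewrite addrA cosDpi mulN1r.
have sq phi : (\int[lam]_(x in K) cos (h x + phi)) ^+ 2 <= e ^+ 2.
  have h1 := He phi; have := He (phi + pi); rewrite N => h2.
  by rewrite -subr_ge0 subr_sqr mulr_ge0//; lra.
rewrite /charpow mulr_natl mulr2n; apply: lerD.
  rewrite (_ : \int[lam]_(x in K) _ = \int[lam]_(x in K) cos (h x + 0)); first exact: sq.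
  by apply: eq_Rintegral => x _; rewrite addr0.
rewrite (_ : \int[lam]_(x in K) _ = \int[lam]_(x in K) cos (h x + - (pi / 2))); first exact: sq.
by apply: eq_Rintegral => x _; rewrite cosBpihalf.
Qed.

Lemma charpow_le_volume : charpow lam K h <= 2 * V ^+ 2.
Proof.
apply: charpow_le_phase => phi; have := phase_ge (phi + pi).
rewrite (_ : \int[lam]_(x in K) _ = - \int[lam]_(x in K) cos (h x + phi)) ?lerN2//.
rewrite -mulN1r -(RintegralZl _ mK (im mh phi)); apply: eq_Rintegral => x _.
by rewrite addrA cosDpi mulN1r.
Qed.

End phase.

(* By log-concavity [covg K (t z)] is at least [V^(1-t) d^t]. *)
Lemma covg_lipschitz : exists e L : R, [/\ 0 < e, 0 <= L &
  forall t z, 0 < t -> t < 1 -> cube (t * e) z -> V - covg K z <= t * L].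
Proof.
have [e [d [e0 d0 He]]] := covg_pos sK; have V0 := solid_volume_gt0.
have dV : d <= V by rewrite -covg0; apply: He => i; rewrite mxE normr0.
have dV0 : 0 < d / V by rewrite divr_gt0.
exists e, (V * - ln (d / V)); split=> //.
  rewrite mulr_ge0 ?(ltW V0)// oppr_ge0 ln_le0// ler_pdivrMr// mul1r; exact: dV.
move=> t z t0 t1 ze.
have zd : d <= covg K (t^-1 *: z).
  apply: He => i; rewrite mxE normrM gtr0_norm ?invr_gt0// ltr_pdivrMl//; exact: ze.
have t1' : 0 < 1 - t by rewrite subr_gt0.
have ts : t + (1 - t) = 1 by ring.
have := logconcave_covg sK (t^-1 *: z) 0 t0 t1' ts.
rewrite scaler0 addr0 scalerA mulfV ?gt_eqF// scale1r covg0 => /(le_trans _) H.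
have : V * (1 + t * ln (d / V)) <= covg K z.
  apply: (@le_trans _ _ (d `^ t * V `^ (1 - t))); last first.
    by apply: H; rewrite ler_wpM2r ?powR_ge0// ge0_ler_powR ?nnegrE ?(ltW t0) ?(ltW d0)// (le_trans (ltW d0) zd).
  have -> : d `^ t * V `^ (1 - t) = V * (d / V) `^ t.
    have Vn : V != 0 by rewrite gt_eqF.
    rewrite -[X in X `^ t * _](divfK Vn) (powRM _ (ltW dV0) (ltW V0)) -mulrA.
    by rewrite -powRD ?Vn ?implybT// (addrC t) subrK (powRr1 (ltW V0)) mulrC.
  by rewrite ler_pM2l// /powR gt_eqF// expR_ge1Dx.
lra.
Qed.

(** A translation [z] along [y] with [dotr y z = pi] has length [pi / |y|]. It nearly preserves [K],
    up to volume of order [1 / |y|] by [covg_lipschitz], while reversing the oscillation, so the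
    Fourier integral is itself of order [1 / |y|]. *)
Lemma charpow_decay : exists2 C : R, 0 <= C & forall y,
  dotr y y * charpow lam K (dotr y) <= C.
Proof.
have [e [L [e0 L0 HL]]] := covg_lipschitz.
(* The constant covers two cases: for [t < 1] it comes from [2 (t e s)^2 L^2] with [t e s = 4], and
   for [t >= 1] from [(e s)^2 <= 16] and the trivial bound [2 V^2]. *)
exists (32 * (L ^+ 2 + V ^+ 2) / e ^+ 2).
  by rewrite divr_ge0 ?sqr_ge0// mulr_ge0// addr_ge0 ?sqr_ge0.
move=> y; have [->|y0] := eqVneq y 0.
  by rewrite dotr0 mul0r divr_ge0 ?sqr_ge0// mulr_ge0// addr_ge0 ?sqr_ge0.
have q0 : 0 < dotr y y by rewrite dotr_gt0.
set q := dotr y y in q0 *; pose s := Num.sqrt q.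
have s0 : 0 < s by rewrite sqrtr_gt0.
have sq : s ^+ 2 = q by rewrite sqr_sqrtr// ltW.
(* Since [pi < 4], the cube of size [t e = 4 / s] contains the translation [z], whose coordinates
   are at most [pi / s]. *)
pose t := 4 / (e * s); have t0 : 0 < t by rewrite divr_gt0// mulr_gt0.
have e2 : 0 < e ^+ 2 by rewrite exprn_gt0.
have mh := measurable_dotr y.
have te : t * e * s = 4 by rewrite /t; field; rewrite !gt_eqF.
rewrite ler_pdivlMr//.
have [t1|t1] := ltP t 1; last first.
  have es : (e * s) ^+ 2 <= 16.
    have : e * s <= 4 by move: t1; rewrite /t ler_pdivlMr ?mulr_gt0// mul1r.
    have : 0 < e * s by rewrite mulr_gt0.
    by move=> h1 h2; rewrite (_ : 16 = 4 ^+ 2); [apply: lerXn2r; rewrite ?nnegrE ?(ltW h1)|ring].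
  have P := charpow_le_volume mh; have P0 := charpow_ge0 lam K (dotr y).
  apply: (@le_trans _ _ (16 * (2 * V ^+ 2))).
    rewrite (_ : _ * _ * _ = (e * s) ^+ 2 * charpow lam K (dotr y)); last by rewrite -sq; ring.
    by apply: ler_pM => //; exact: sqr_ge0.
  by rewrite mulrA -natrM ler_wpM2l// lerDr sqr_ge0.
pose z := (pi / q) *: y.
have hz : dotr y z = pi by rewrite dotrZr -/q divfK// gt_eqF.
have zc : cube (t * e) z.
  move=> i; rewrite mxE normrM (gtr0_norm (_ : 0 < pi / q)); last by rewrite divr_gt0// pi_gt0.
  have ys : `|y ord0 i| <= s.
    by rewrite -sqrtr_sqr /s ler_sqrt// ?sqr_le_dotr// ltW.
  apply: (@le_lt_trans _ _ (pi / q * s)).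
    by rewrite ler_wpM2l// divr_ge0 ?pi_ge0// ltW.
  rewrite -(ltr_pM2r s0) te (_ : pi / q * s * s = pi); last first.
    by rewrite -sq; field; rewrite gt_eqF.
  have := @pihalf_lt2 R; lra.
have P : charpow lam K (dotr y) <= 2 * (t * L) ^+ 2.
  apply: (charpow_le_phase mh) => phi.
  exact: le_trans (phase_le mh phi hz (dotrDr y)) (HL t z t0 t1 zc).
apply: (@le_trans _ _ (q * (2 * (t * L) ^+ 2) * e ^+ 2)).
  by rewrite ler_pM2r// ler_pM2l.
rewrite (_ : q * _ * _ = 2 * (t * e * s) ^+ 2 * L ^+ 2); last by rewrite -sq; ring.
rewrite te (_ : 2 * 4 ^+ 2 = 32); last by ring.
by rewrite ler_wpM2l// lerDl sqr_ge0.
Qed.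

End decay.

(** * Coordinates adapted to two independent vectors *)

Section linear_change.
Context {R : realType}.

Lemma pairint_mulmx n (K : set 'rV[R]_n) (M : 'M[R]_n) : measurable K -> M \in unitmx ->
  exists2 c : R, 0 < c & forall (a : 'rV[R]_n -> R) (g : R -> \bar R),
    measurable_fun setT a -> measurable_fun setT g -> (forall u, 0 <= g u)%E ->
    (pairint (lebesgue_rV R n) [set v | K (v *m M)] (fun v => a (v *m M)) g =
     (c ^+ 2)%:E * pairint (lebesgue_rV R n) K a g)%E.
Proof.
move=> mK uM; have [c c0 Hc] := ge0_integral_rV_mulmx uM; exists c => // a g ma mg g0.
have iE v : \1_[set v : 'rV[R]_n | K (v *m M)] v = \1_K (v *m M) :> R.
  by rewrite !indicE; congr (_%:R); apply/idP/idP; rewrite !inE.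
have mi : measurable_fun setT (\1_K : 'rV[R]_n -> R) by exact: measurable_indic.
pose F (v : 'rV[R]_n * 'rV[R]_n) : \bar R :=
  ((\1_K v.1 * \1_K v.2)%:E * g (a v.1 - a v.2)%R)%E.
have mF : measurable_fun setT F.
  apply: emeasurable_funM.
    apply/measurable_EFinP; apply: measurable_funM; apply: (measurableT_comp mi).
      exact: measurable_fst.
    exact: measurable_snd.
  apply: (measurableT_comp mg); apply: measurable_funB; apply: (measurableT_comp ma).
    exact: measurable_fst.
  exact: measurable_snd.
have F0 v : (0 <= F v)%E by rewrite mule_ge0// lee_fin mulr_ge0.
pose G x := (\int[lebesgue_rV R n]_y F (x, y))%E.
have mG : measurable_fun setT G by exact: (@measurable_fun_fubini_tonelli_F _ _ _ _ R _ F mF F0).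
have G0 x : (0 <= G x)%E by exact: integral_ge0.
have mGM : measurable_fun setT (fun x : 'rV[R]_n => G (x *m M)).
  apply: (measurableT_comp mG); exact: (measurable_rV_linear M (@measurable_id _ _ setT)).
transitivity (\int[lebesgue_rV R n]_x (c%:E * G (x *m M)%R))%E.
  apply: eq_integral => x _.
  rewrite -[RHS](Hc (fun y => F (x *m M, y)) (measurableT_comp mF (measurable_pair1 (x *m M))) (fun y => F0 _)).
  by apply: eq_integral => y _; rewrite !iE.
rewrite (ge0_integralZT (lebesgue_rV R n) mGM (fun x => G0 _) (ltW c0)).
by rewrite (Hc G mG G0) muleA -EFinM -expr2.
Qed.

(** Apply [pairint_mulmx] to [1 + cos] and to the constant 1 and subtract; [cos] alone is not
    nonnegative. *)
Lemma charpow_mulmx n (K : set 'rV[R]_n) (M : 'M[R]_n) : solid K -> M \in unitmx ->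
  exists2 c : R, 0 < c & forall a : 'rV[R]_n -> R, measurable_fun setT a ->
    charpow (lebesgue_rV R n) K a =
    c * charpow (lebesgue_rV R n) [set v | K (v *m M)] (fun v => a (v *m M)).
Proof.
move=> sK uM; have sK' := solid_mulmx uM sK.
have [mK _ _ _] := sK; have [mK' _ _ _] := sK'.
have [c c0 Hc] := pairint_mulmx mK uM.
exists (c ^+ 2)^-1 => [|a ma]; first by rewrite invr_gt0 exprn_gt0.
have maM : measurable_fun setT (fun v : 'rV[R]_n => a (v *m M)).
  apply: (measurableT_comp ma); exact: (measurable_rV_linear M (@measurable_id _ _ setT)).
have m1 : measurable_fun setT (fun u : R => (1 + cos u)%:E).
  apply/measurable_EFinP; apply: measurable_funD => //.
  exact: measurable_funcos.
have g1 (u : R) : (0 <= (1 + cos u)%:E :> \bar R)%E.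
  by rewrite lee_fin; have := cos_geN1 u; lra.
have := Hc a _ ma m1 g1.
rewrite (pairint_cos mK' (solid_finite sK') maM) (pairint_cos mK (solid_finite sK) ma).
rewrite -EFinM => -[E1].
have mc : measurable_fun setT (fun u : R => (1 : R)%:E : \bar R) by [].
have c1 (u : R) : (0 <= (1 : R)%:E :> \bar R)%E by rewrite lee_fin.
have := Hc a _ ma mc c1.
rewrite (pairint_cst mK' (solid_finite sK')) (pairint_cst mK (solid_finite sK)) -EFinM !mul1r => -[E2].
apply: (mulfI (lt0r_neq0 (exprn_gt0 2 c0))); rewrite mulrA mulfV ?mul1r; last first.
  by rewrite gt_eqF// exprn_gt0.
by apply: (addrI (c ^+ 2 * fine (lebesgue_rV R n K) ^+ 2)); rewrite -mulrDr -E1 E2.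
Qed.

(** The matrix [B] with columns [xi] and [eta] has rank 2, so elimination writes it as [L (U; 0)]
    with [L] and [U] invertible. Undoing both gives [M] with [M B = (1; 0)], which makes the two
    linear forms the first two coordinates. *)
Lemma independent_coordinates m (xi eta : 'rV[R]_m.+2) :
  (forall a b, a *: xi + b *: eta = 0 -> a = 0 /\ b = 0) ->
  exists2 M : 'M[R]_m.+2, M \in unitmx & forall v : 'rV[R]_m.+2,
    dotr xi (v *m M) = v ord0 ord0 /\ dotr eta (v *m M) = v ord0 (lift ord0 ord0).
Proof.
move=> ind; pose A : 'M[R]_(1 + 1, m.+2) := col_mx xi eta.
have rA : \rank A = 2%N.
  apply/eqP; apply: inj_row_free => v.
  rewrite -[v]hsubmxK mul_row_col => H.
  have E (u : 'rV[R]_1) (w : 'rV[R]_m.+2) : u *m w = u 0 0 *: w.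
    by rewrite [u]mx11_scalar mul_scalar_mx mxE eqxx mulr1n.
  move: H; rewrite !E => /ind[h1 h2].
  by rewrite [lsubmx v]mx11_scalar h1 [rsubmx v]mx11_scalar h2 !raddf0 row_mx0.
pose B := A^T; have rB : \rank B = 2%N by rewrite mxrank_tr.
pose U : 'M[R]_2 := row_ebase B; pose L : 'M[R]_(2 + m) := col_ebase B.
have uU : U \in unitmx by exact: row_ebase_unit.
have uL : L \in unitmx by exact: col_ebase_unit.
have PU : (pid_mx 2 : 'M[R]_(2 + m, 2)) *m U = col_mx U 0.
  by rewrite pid_mx_col mul_col_mx mul1mx mul0mx.
have BE : B = L *m col_mx U 0 by rewrite -PU -[LHS]mulmx_ebase rB -mulmxA.
pose N : 'M[R]_(2 + m) := block_mx (invmx U) 0 0 1%:M.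
have uN : N \in unitmx by rewrite unitmxE det_ublock det1 mulr1 -unitmxE unitmx_inv.
have NU : N *m col_mx U 0 = col_mx 1%:M 0.
  by rewrite mul_block_col mul0mx mulmx0 !addr0 mulVmx// mul0mx.
have lsub (u : 'rV[R]_(2 + m)) : u *m col_mx 1%:M 0 = lsubmx u.
  by rewrite -{1}[u]hsubmxK mul_row_col mulmx1 mulmx0 addr0.
exists (N *m invmx L); first by rewrite unitmx_mul uN unitmx_inv.
move=> v; pose w := v *m (N *m invmx L) *m B.
have wE : w = @lsubmx _ _ 2 m v.
  rewrite /w BE -!mulmxA mulKmx// NU; exact: lsub.
have wi (i : 'I_2) : w ord0 i = dotr (row i A) (v *m (N *m invmx L)).
  rewrite /w mxE; apply: eq_bigr => j _; rewrite !mxE; exact: mulrC.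
split.
- rewrite (_ : xi = row (@lshift 1 1 ord0) A) -?wi ?wE ?mxE.
    by congr (v _ _); exact/val_inj.
  by apply/rowP => j; rewrite mxE col_mxEu.
- rewrite (_ : eta = row (@rshift 1 1 ord0) A) -?wi ?wE ?mxE.
    by congr (v _ _); exact/val_inj.
  by apply/rowP => j; rewrite mxE col_mxEd.
Qed.

End linear_change.

(** * The power means: planar restriction, finiteness and continuity *)

Section power_mean.
Context {R : realType}.
Local Notation mu := (@lebesgue_measure R).

(** The function [G] of the overview, before its finiteness is known. *)
Definition pmean n (K : set 'rV[R]_n) (p : R) (y : 'rV[R]_n) : \bar R :=
  (\int[mu]_r ((pw (p - 1) r)%:E *
    (charpow (lebesgue_rV R n) K (fun x => (r * dotr y x)%R))%:E))%E.

Definition independent n (xi eta : 'rV[R]_n) :=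
  forall a b : R, a *: xi + b *: eta = 0 -> a = 0 /\ b = 0.

Lemma pmean_ge0 n (K : set 'rV[R]_n) p y : (0 <= pmean K p y)%E.
Proof. by apply: integral_ge0 => r _; rewrite mule_ge0 ?lee_fin ?pw_ge0 ?charpow_ge0. Qed.

Lemma measurable_charpow_ray n (K : set 'rV[R]_n) (y : 'rV[R]_n) : solid K ->
  measurable_fun setT (fun r : R => charpow (lebesgue_rV R n) K (fun x => r * dotr y x)).
Proof.
move=> sK; have [mK _ _ _] := sK.
apply: (measurable_charpow mK (solid_finite sK)); exact: measurable_dotr.
Qed.

Lemma pmean_planar m (K : set 'rV[R]_m.+2) p (xi eta : 'rV[R]_m.+2) :
  solid K -> 0 < p -> p < 1 -> independent xi eta ->
  exists f (c : R), [/\ planar_density f, 0 < c &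
    forall a b, (c%:E * pmean K p (a *: xi + b *: eta) = planar_energy p f a b)%E].
Proof.
move=> sK p0 p1 /independent_coordinates[M uM HM].
have sK' := solid_mulmx uM sK; have [mK' _ _ _] := sK'.
have [c c0 Hc] := charpow_mulmx sK uM; have [g g0 Hg] := gamma_fin p0 p1.
(* Here [g] is the Gamma constant of the exponential average and [c] the factor that the change of
   coordinates [M] puts on [charpow]. *)
exists (marginal [set v | K (v *m M)]), (g * c^-1); split.
- exact: planar_density_marginal.
- by rewrite mulr_gt0// invr_gt0.
move=> a b; rewrite -(pairint_marginal sK').
have ml : measurable_fun setT (fun x : 'rV[R]_m.+2 => a * x ord0 ord0 + b * x ord0 (lift ord0 ord0)).
  by apply: measurable_funD; apply: measurable_funM => //; exact: measurable_coord.
rewrite -(charpow_power_average mK' (solid_finite sK') ml p0 p1 Hg) EFinM -muleA; congr (_ * _)%E.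
have mQ : measurable_fun setT (fun r : R => (charpow (lebesgue_rV R m.+2) [set v | K (v *m M)]
    (fun x => r * (a * x ord0 ord0 + b * x ord0 (lift ord0 ord0))))%:E : \bar R).
  by apply/measurable_EFinP; exact: (measurable_charpow mK' (solid_finite sK') ml).
transitivity ((c^-1)%:E * (c%:E * \int[mu]_r ((pw (p - 1) r)%:E *
    (charpow (lebesgue_rV R m.+2) [set v | K (v *m M)]
      (fun x => (r * (a * x ord0 ord0 + b * x ord0 (lift ord0 ord0)))%R))%:E)))%E; last first.
  by rewrite muleA -EFinM mulVf ?gt_eqF// mul1e.
congr (_ * _)%E; rewrite -ge0_integralZT ?(ltW c0)//.
- apply: eq_integral => r _; rewrite [RHS]muleCA Hc ?EFinM; last first.
    by apply: measurable_funM => //; exact: measurable_dotr.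
  congr (_ * (_ * (charpow _ _ _)%:E))%E; apply/funext => v.
  by have [h1 h2] := HM v; rewrite dotrDl !dotrZl h1 h2.
- by apply: emeasurable_funM => //; exact: measurable_EFin_pw.
- by move=> r; rewrite mule_ge0 ?lee_fin ?pw_ge0 ?charpow_ge0.
Qed.

Lemma independent_dim n (xi eta : 'rV[R]_n) : independent xi eta -> (1 < n)%N.
Proof.
case: n xi eta => [|[|//]] xi eta ind.
  by have [] := ind 1 0; [apply/rowP => -[]|move/eqP; rewrite oner_eq0].
have [|_ /eqP] := ind (eta ord0 ord0) (- xi ord0 ord0).
  by apply/rowP => i; rewrite !mxE !(ord1 i) mulNr mulrC; exact: subrr.
rewrite oppr_eq0 => /eqP x0; have [|h _] := ind 1 0.
  by rewrite scale0r addr0 scale1r; apply/rowP => i; rewrite mxE (ord1 i).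
by move/eqP: h; rewrite oner_eq0.
Qed.

Lemma pmean_local n (K : set 'rV[R]_n) p (xi eta : 'rV[R]_n) :
  solid K -> 0 < p -> p < 1 -> independent xi eta ->
  exists k : R, forall a,
    (pmean K p ((1 + a * k) *: xi + a *: eta) + pmean K p ((1 - a * k) *: xi - a *: eta)
     <= 2%:E * pmean K p xi)%E.
Proof.
move=> sK p0 p1 ind; have := independent_dim ind.
case: n K xi eta sK ind => [//|[//|m]] K xi eta sK ind _.
have [f [c [pf c0 Hf]]] := pmean_planar sK p0 p1 ind.
have [k Hk] := planar_energy_local p1 pf; exists k => a.
have := Hk a; rewrite -!Hf scale1r scale0r addr0 scaleNr muleCA -ge0_muleDr ?pmean_ge0//.
by rewrite lee_pmul2l// lte_fin.
Qed.

End power_mean.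

Section power_mean_regularity.
Context {R : realType}.
Local Notation mu := (@lebesgue_measure R).
Variables (n : nat) (K : set 'rV[R]_n).
Hypothesis sK : solid K.
Local Notation lam := (lebesgue_rV R n).
Local Notation V := (fine (lam K)).

Let mK : measurable K. Proof. by have [] := sK. Qed.
Let finK := solid_finite sK.

Let h (y : 'rV[R]_n) (r : R) : R := charpow lam K (fun x => r * dotr y x).

Let mh y : measurable_fun setT (h y).
Proof. exact: measurable_charpow_ray. Qed.

Let h0 y r : 0 <= h y r. Proof. exact: charpow_ge0. Qed.

Let mEh y : measurable_fun setT (fun r => (h y r)%:E : \bar R).
Proof. exact/measurable_EFinP. Qed.

(** The constants do not depend on [y], so that the bounds can dominate the integrand uniformly
    along a line of vectors. *)
Lemma charpow_ray_bounds : exists M C : R, [/\ 0 <= M, 0 <= C &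
  forall y r, h y r <= M /\ (0 < r -> dotr y y * h y r <= C * r `^ (- 2))].
Proof.
have [C C0 HC] := charpow_decay sK; exists (2 * V ^+ 2), C; split=> //.
  by rewrite mulr_ge0// sqr_ge0.
move=> y r; split.
  by apply: (charpow_le_volume sK); apply: measurable_funM => //; exact: measurable_dotr.
move=> r0; have r2 : 0 < r ^+ 2 by rewrite exprn_gt0.
have hE : h y r = charpow lam K (dotr (r *: y)).
  by congr charpow; apply/funext => x; rewrite dotrZl.
have := HC (r *: y); rewrite -hE dotrZl dotrZr => H.
rewrite powRN (powR_mulrn 2 (ltW r0)) ler_pdivlMr//; apply: le_trans H.
by rewrite le_eqVlt; apply/orP; left; apply/eqP; ring.
Qed.

Lemma charpow_ray_fin y (s : R) : y != 0 -> -1 < s -> s < 1 ->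
  (\int[mu]_r ((pw s r)%:E * (h y r)%:E) < +oo)%E.
Proof.
move=> y0 s0 s1; have q0 : 0 < dotr y y by rewrite dotr_gt0.
have [M [C [M0 C0 H]]] := charpow_ray_bounds.
apply: (@pw_integral_fin _ s 2 M (C / dotr y y)) => // [|r _|r r0].
- lra.
- by have [] := H y r.
- rewrite mulrAC ler_pdivlMr// mulrC.
  by have [_ /(_ r0)] := H y r.
Qed.

Lemma pmean_fin p y : 0 < p -> p <= 1 -> y != 0 ->
  exists2 A : R, 0 < A & pmean K p y = A%:E.
Proof.
move=> p0 p1 y0.
have fin : (pmean K p y < +oo)%E by apply: (charpow_ray_fin y0); lra.
have V0 := solid_volume_gt0 sK.
have fn : pmean K p y \is a fin_num by rewrite ge0_fin_numE// pmean_ge0.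
exists (fine (pmean K p y)); last by rewrite fineK.
rewrite fine_gt0// fin andbT.
have [_ _ [D D0 KD] _] := sK.
pose B := 1 + \sum_i `|y ord0 i| * D.
have B0 : 0 < B by rewrite ltr_pwDl// sumr_ge0// => i _; rewrite mulr_ge0 ?(ltW D0).
have yB x : K x -> `|dotr y x| <= B.
  move=> /KD Kx; apply: (le_trans (ler_norm_sum _ _ _)).
  rewrite /B -[leLHS]add0r lerD// ler_sum// => i _; rewrite normrM ler_wpM2l//.
  exact/ltW/Kx.
(* For [r <= rho] the phases [r * dotr y x] lie in [[-1/2, 1/2]] for all [x] in [K]; every cosine is
   then at least [kappa] and no cancellation occurs. *)
pose rho := (2 * B)^-1; have rho0 : 0 < rho by rewrite invr_gt0 mulr_gt0.
pose kappa := cos (1 / 2 : R).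
have pi2 := @pi_ge2 R.
have k0 : 0 < kappa by apply: cos_gt0_pihalf; apply/andP; split; lra.
have coslb u : `|u| <= 1 / 2 -> kappa <= cos u.
  move=> u2; have -> : cos u = cos `|u| by case: (ger0P u) => //; rewrite cosN.
  have hu : `|u| \in `[0, pi] by rewrite in_itv/= normr_ge0/=; lra.
  have hk : (1 / 2 : R) \in `[0, pi] by rewrite in_itv/=; apply/andP; split; lra.
  by rewrite leNgt (ltr_cos hk hu) -leNgt.
have hlb r : 0 < r -> r <= rho -> (kappa * V) ^+ 2 <= h y r.
  move=> r0 rr; rewrite /h /charpow; apply: (@le_trans _ _ ((\int[lam]_(x in K) cos (r * dotr y x)) ^+ 2)); last first.
    by rewrite lerDl sqr_ge0.
  have mry : measurable_fun setT (fun x : 'rV[R]_n => r * dotr y x).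
    by apply: measurable_funM => //; exact: measurable_dotr.
  have ic := cos_integrable mK finK mry.
  have i1 : lam.-integrable K (EFin \o (fun=> kappa)).
    apply: (bounded_on_integrable mK finK (M := `|kappa|)) => [|x]; first exact: measurable_cst.
    exact: lexx.
  have : kappa * V <= \int[lam]_(x in K) cos (r * dotr y x).
    rewrite -(Rintegral_cst lam mK); apply: le_Rintegral => // x Kx.
    apply: coslb; rewrite normrM gtr0_norm//.
    apply: (@le_trans _ _ (rho * B)); first by apply: ler_pM => //; [exact: ltW|exact: yB].
    by rewrite /rho invfM mulfVK ?gt_eqF// div1r.
  have kV : 0 <= kappa * V by rewrite mulr_ge0 ?(ltW k0) ?(ltW V0).
  by move=> H; apply: lerXn2r => //; rewrite nnegrE (le_trans kV).
pose c := rho `^ (p - 1) * (kappa * V) ^+ 2.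
have c0 : 0 < c by rewrite mulr_gt0 ?powR_gt0// exprn_gt0// mulr_gt0.
have mf : measurable_fun setT (fun r => (pw (p - 1) r)%:E * (h y r)%:E)%E.
  by apply: emeasurable_funM; [exact: measurable_EFin_pw|exact: mEh].
have f0 r : (0 <= (pw (p - 1) r)%:E * (h y r)%:E)%E by rewrite mule_ge0 ?lee_fin ?pw_ge0.
have rr : rho / 2 < rho by rewrite ltr_pdivrMr// ltr_pMr// ltr1n.
apply: (integral_gt0_itv mf f0 rr c0) => r r1 r2; rewrite -EFinM lee_fin.
have r0 : 0 < r by apply: lt_le_trans r1; rewrite divr_gt0.
rewrite (pwE _ r0) /c ler_pM ?powR_ge0 ?sqr_ge0//; last exact: hlb.
rewrite -(opprB 1 p) !powRN lef_pV2 ?posrE ?powR_gt0//.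
by apply: ge0_ler_powR => //; rewrite ?nnegrE ?subr_ge0 ?(ltW r0) ?(ltW rho0).
Qed.

Lemma pmeanZ p c y : 0 < c -> ((c `^ p)%:E * pmean K p (c *: y) = pmean K p y)%E.
Proof.
move=> c0.
have h0E r : (0 <= (h y r)%:E :> \bar R)%E by rewrite lee_fin.
rewrite -[RHS](ge0_integral_pw_scale (p - 1) c0 (mEh y) h0E) subrK.
have hc r : h y (c * r) = charpow lam K (fun x => r * dotr (c *: y) x).
  by congr charpow; apply/funext => x; rewrite dotrZl mulrA (mulrC r c).
have -> : pmean K p (c *: y) = (\int[mu]_r ((pw (p - 1) r)%:E * (h y (c * r))%:E))%E.
  by apply: eq_integral => r _; rewrite hc.
by [].
Qed.

Lemma pmeanN p y : pmean K p (- y) = pmean K p y.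
Proof.
apply: eq_integral => r _; congr (_ * _%:E)%E.
have mr : measurable_fun setT (fun x : 'rV[R]_n => r * dotr y x).
  by apply: measurable_funM => //; exact: measurable_dotr.
rewrite -(charpowN mK finK mr); congr charpow; apply/funext => x.
by rewrite -scaleN1r dotrZl mulN1r mulrN.
Qed.

Lemma charpow_continuous (a b : 'rV[R]_n -> R) : measurable_fun setT a -> measurable_fun setT b ->
  continuous (fun c : R => charpow lam K (fun x => a x + c * b x)).
Proof.
move=> ma mb c.
have cI : c \in (`]c - 1, c + 1[%classic : set R).
  by rewrite inE /= in_itv/=; apply/andP; split; lra.
have i1 : lam.-integrable K (EFin \o (fun=> 1)).
  apply: (bounded_on_integrable mK finK (M := 1)) => [|x]; first exact: measurable_cst.
  by rewrite normr1.
have mab e : measurable_fun setT (fun x => a x + e * b x).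
  by apply: measurable_funD => //; exact: measurable_funM.
have key (g : R -> R) : continuous g -> (forall u, `|g u| <= 1) ->
    {for c, continuous (fun e : R => \int[lam]_(x in K) g (a x + e * b x))}.
  move=> cg g1.
  apply: (@continuity_under_integral R _ _ lam (fun (e : R) x => g (a x + e * b x)) K mK (c - 1) (c + 1) _ _ _ i1 _ c cI).
  - move=> e _; apply: (bounded_on_integrable mK finK (M := 1)) => [|x]; last exact: g1.
    exact: (measurableT_comp (continuous_measurable_fun cg) (mab e)).
  - apply: aeW => x _ e _; apply: (@continuous_comp _ _ _ (fun e : R => a x + e * b x) g); last exact: cg.
    by apply: cvgD; [exact: cvg_cst|apply: cvgM; [exact: cvg_id|exact: cvg_cst]].
  - by move=> e _; apply: aeW => x _; exact: g1.
have kc : {for c, continuous (fun e : R => \int[lam]_(x in K) cos (a x + e * b x))}.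
  by apply: key; [exact: continuous_cos|move=> u; rewrite ler_norml cos_geN1 cos_le1].
have ks : {for c, continuous (fun e : R => \int[lam]_(x in K) sin (a x + e * b x))}.
  by apply: key; [exact: continuous_sin|move=> u; rewrite ler_norml sin_geN1 sin_le1].
exact: (cvgD (cvgM kc kc) (cvgM ks ks)).
Qed.

Let mph (p : R) y : measurable_fun setT (fun r => pw (p - 1) r * h y r).
Proof. by apply: measurable_funM; [exact: measurable_pw|exact: mh]. Qed.

Lemma ge0_integrable (g : R -> R) : measurable_fun setT g -> (forall r, 0 <= g r) ->
  (\int[mu]_r (g r)%:E < +oo)%E -> mu.-integrable setT (EFin \o g).
Proof.
move=> mg g0 gf; apply/integrableP; split; first exact/measurable_EFinP.
rewrite [X in (X < _)%E](_ : _ = \int[mu]_r (g r)%:E)%E//.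
by apply: eq_integral => r _ /=; rewrite ger0_norm.
Qed.

Lemma fine_pmeanE p y : fine (pmean K p y) = \int[mu]_r (pw (p - 1) r * h y r).
Proof. by congr fine; apply: eq_integral => r _; rewrite EFinM. Qed.

Lemma pmean_continuous_line p (S T : 'rV[R]_n) (q : R) : 0 < p -> p <= 1 -> 0 < q ->
  (forall c, q <= dotr (S + c *: T) (S + c *: T)) ->
  continuous (fun c : R => fine (pmean K p (S + c *: T))).
Proof.
move=> p0 p1 q0 Hq c.
rewrite (_ : (fun c : R => _) = (fun c : R => \int[mu]_r (pw (p - 1) r * h (S + c *: T) r))); last first.
  by apply/funext => e; exact: fine_pmeanE.
have cI : c \in (`]c - 1, c + 1[%classic : set R).
  by rewrite inE /= in_itv/=; apply/andP; split; lra.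
have [M [C [M0 C0 H]]] := charpow_ray_bounds.
(* A majorant common to all points of the line, since [q] bounds their squared length from below. *)
pose w (r : R) := Num.min M (C / q * r `^ (- 2)).
have mw : measurable_fun setT w.
  apply: measurable_minr => //; apply: measurable_funM => //; exact: measurable_powR.
have w0 r : 0 <= w r by rewrite le_min M0/= mulr_ge0 ?powR_ge0// divr_ge0// ltW.
have wint : mu.-integrable setT (EFin \o (fun r => pw (p - 1) r * w r)).
  apply: ge0_integrable; first by apply: measurable_funM => //; exact: measurable_pw.
    by move=> r; rewrite mulr_ge0 ?pw_ge0.
  under eq_integral do rewrite EFinM.
  apply: (@pw_integral_fin _ (p - 1) 2 M (C / q)) => //; [lra|lra| |].
    by move=> r _; rewrite /w ge_min lexx.
  by move=> r _; rewrite /w ge_min lexx orbT.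
have hw e r : pw (p - 1) r * h (S + e *: T) r <= pw (p - 1) r * w r.
  have [r0|r0] := leP r 0; first by rewrite !pwN// !mul0r.
  rewrite ler_wpM2l ?pw_ge0// le_min; have [h1 h2] := H (S + e *: T) r; rewrite h1/=.
  rewrite mulrAC ler_pdivlMr// mulrC (le_trans _ (h2 r0))// ler_wpM2r//.
have phw e r : `|pw (p - 1) r * h (S + e *: T) r| <= pw (p - 1) r * w r.
  by rewrite ger0_norm ?hw// mulr_ge0 ?pw_ge0.
apply: (@continuity_under_integral R _ _ mu (fun (e : R) r => pw (p - 1) r * h (S + e *: T) r)
  setT measurableT (c - 1) (c + 1) _ _ _ wint _ c cI).
- move=> e _; apply: (le_integrable measurableT _ _ wint).
    by apply/measurable_EFinP; exact: mph.
  by move=> r _ /=; rewrite lee_fin (le_trans (phw e r))// ler_norm.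
- apply: aeW => r _ e _; apply: cvgM; first exact: cvg_cst.
  pose k (e : R) := charpow lam K (fun x => r * dotr S x + e * (r * dotr T x)).
  have kE e' : h (S + e' *: T) r = k e'.
    by congr charpow; apply/funext => x; rewrite dotrDl dotrZl mulrDr mulrCA.
  rewrite kE (_ : (fun e : R => h (S + e *: T) r) = k); last exact/funext.
  apply: (@charpow_continuous (fun x => r * dotr S x) (fun x => r * dotr T x));
    by apply: measurable_funM => //; exact: measurable_dotr.
- by move=> e _; apply: aeW => r _; exact: phw.
Qed.

Lemma pmean_continuous_exponent y : y != 0 ->
  {for 1, continuous (fun p : R => fine (pmean K p y))}.
Proof.
move=> y0.
rewrite (_ : (fun p : R => _) = (fun p : R => \int[mu]_r (pw (p - 1) r * h y r))); last first.
  by apply/funext => p; exact: fine_pmeanE.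
have cI : 1 \in (`](1 / 2)%R, (3 / 2)%R[%classic : set R).
  by rewrite inE /= in_itv/=; apply/andP; split; lra.
(* For [p] in []1/2, 3/2[] the weight [r^(p-1)] is below [r^(-1/2)] when [r <= 1] and below
   [r^(1/2)] when [r > 1]. Both give integrable majorants, because the quadratic decay admits every
   exponent in []-1, 1[]. *)
pose w (r : R) := pw (- (1 / 2)) r * h y r + pw (1 / 2) r * h y r.
have iw s : -1 < s -> s < 1 -> mu.-integrable setT (EFin \o (fun r => pw s r * h y r)).
  move=> s1 s2; apply: ge0_integrable.
  - by apply: measurable_funM; [exact: measurable_pw|exact: mh].
  - by move=> r; rewrite mulr_ge0 ?pw_ge0.
  - by under eq_integral do rewrite EFinM; exact: charpow_ray_fin.
have wint : mu.-integrable setT (EFin \o w).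
  have w1 : mu.-integrable setT (EFin \o (fun r => pw (- (1 / 2)) r * h y r)) by apply: iw; lra.
  have w2 : mu.-integrable setT (EFin \o (fun r => pw (1 / 2) r * h y r)) by apply: iw; lra.
  exact: (integrableD measurableT w1 w2).
have phw p r : 1 / 2 < p -> p < 3 / 2 -> `|pw (p - 1) r * h y r| <= w r.
  have -> : w r = (pw (- (1 / 2)) r + pw (1 / 2) r) * h y r by rewrite /w mulrDl.
  move=> h1 h2; rewrite (ger0_norm (mulr_ge0 (pw_ge0 _ _) (h0 _ _))).
  apply: (ler_wpM2r (h0 y r)).
  have [r0|r0] := leP r 0; first by rewrite !pwN// addr0.
  have [r1|r1] := leP r 1.
    rewrite -[leLHS]addr0 lerD ?pw_ge0// !pwE//; apply: ger_powR => //; last lra.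
    by rewrite r0 r1.
  rewrite -[leLHS]add0r lerD ?pw_ge0// !pwE//; apply: ler_powR => //; last lra.
  exact: ltW.
apply: (@continuity_under_integral R _ _ mu (fun (p : R) r => pw (p - 1) r * h y r)
  setT measurableT (1 / 2) (3 / 2) _ _ _ wint _ 1 cI).
- by move=> p; rewrite /= in_itv/= => /andP[h1 h2]; apply: iw; lra.
- apply: aeW => r _ p _; apply: cvgM; last exact: cvg_cst.
  have [r0|r0] := leP r 0.
    rewrite (_ : (fun p : R => _) = cst 0); last by apply/funext => p'; rewrite pwN.
    by rewrite pwN//; exact: cvg_cst.
  rewrite (_ : (fun p : R => _) = fun p : R => expR ((p - 1) * ln r)); last first.
    by apply/funext => p'; rewrite pwE// /powR gt_eqF.
  rewrite pwE// /powR gt_eqF//.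
  apply: (@continuous_comp _ _ _ (fun p : R => (p - 1) * ln r) expR); last exact: continuous_expR.
  by apply: cvgM; [apply: cvgB; [exact: cvg_id|exact: cvg_cst]|exact: cvg_cst].
- by move=> p; rewrite /= in_itv/= => /andP[h1 h2]; apply: aeW => r _; exact: phw.
Qed.

End power_mean_regularity.

(** * From local to global convexity *)

Section local_convexity.
Context {R : realType}.

(** The weights balance [x] and [y] at [c], so the affine terms cancel, while the quadratic terms
    leave the strictly positive excess [e a (x - y)]. *)
Let quadratic_gap (u v a c x y e A B Mx My Mc : R) : 0 < u -> 0 < v -> u + v = 2 ->
  0 < e -> 0 < a -> y < x -> u * x = u * c + a -> v * y = v * c - a ->
  Mx - (A + B * x) + e * (x * x) <= Mc - (A + B * c) + e * (c * c) ->
  My - (A + B * y) + e * (y * y) <= Mc - (A + B * c) + e * (c * c) ->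
  u * Mx + v * My < 2 * Mc.
Proof.
move=> u0 v0 uv e0 a0 yx ux vy; rewrite -(ler_pM2l u0) -(ler_pM2l v0 (My - _ + _)).
have -> : u * (Mx - (A + B * x) + e * (x * x)) =
    u * Mx - (u * A + B * (u * c + a)) + e * (c * (u * c + a) + a * x).
  by rewrite mulrDr mulrBr -ux; nra.
have -> : v * (My - (A + B * y) + e * (y * y)) =
    v * My - (v * A + B * (v * c - a)) + e * (c * (v * c - a) - a * y).
  by rewrite mulrDr mulrBr -vy; nra.
have vE : v = 2 - u by lra.
have : 0 < e * (a * (x - y)) by rewrite !mulr_gt0// subr_gt0.
by rewrite vE; nra.
Qed.

(* At an interior maximum of [M] minus its chord plus [e c^2] the hypothesis is violated by the
   quadratic term. *)
Lemma local_convexity (M : R -> R) : continuous M ->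
  (forall c, exists k, forall a, `|a * k| < 1 ->
    2 * M c <= (1 + a * k) * M (c + a / (1 + a * k)) + (1 - a * k) * M (c - a / (1 - a * k))) ->
  2 * M 0 <= M 1 + M (- 1).
Proof.
move=> cM HM; rewrite leNgt; apply/negP => H.
pose A := (M 1 + M (- 1)) / 2; pose B := (M 1 - M (- 1)) / 2.
(* With this choice [D] equals [e] at both ends and [2 e] at 0, so its maximum is interior. *)
pose e := (M 0 - A) / 2.
have e0 : 0 < e by rewrite /e /A; lra.
pose D c := M c - (A + B * c) + e * (c * c).
have cD : continuous D.
  move=> c; apply: cvgD; first apply: cvgB; first exact: cM.
    by apply: cvgD; [exact: cvg_cst|apply: cvgM; [exact: cvg_cst|exact: cvg_id]].
  by apply: cvgM; [exact: cvg_cst|apply: cvgM; exact: cvg_id].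
have [|c] := @EVT_max R D (- 1) 1 _ (@continuous_subspaceT _ _ _ _ cD); first lra.
rewrite in_itv/= => /andP[c1 c2] Dc.
have D0 : D 0 <= D c by apply: Dc; rewrite in_itv/=; apply/andP; split; lra.
have D00 : D 0 = 2 * e by rewrite /D /e; field.
have c1' : c != -1.
  by apply: contraTneq D0 => ->; rewrite -ltNge D00 /D /A /B; lra.
have c2' : c != 1.
  by apply: contraTneq D0 => ->; rewrite -ltNge D00 /D /A /B; lra.
have {c1'}c1 : -1 < c by rewrite lt_neqAle eq_sym c1'.
have {c2'}c2 : c < 1 by rewrite lt_neqAle c2'.
have [k Hk] := HM c.
pose d := Num.min (1 + c) (1 - c).
have d0 : 0 < d by rewrite lt_min; apply/andP; split; lra.
have [d1 d2] : d <= 1 + c /\ d <= 1 - c by rewrite /d; split; rewrite ge_min lexx ?orbT.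
(* Small enough that [|a k| < 1/2], hence both weights exceed [1/2], and that both displaced points
   stay in [[-1, 1]]. *)
pose a := d / (2 * (1 + `|k|)).
have k1 : 0 < 1 + `|k| by rewrite ltr_pwDl.
have a0 : 0 < a by rewrite divr_gt0// mulr_gt0.
have aE : a * (1 + `|k|) = d / 2 by rewrite /a; field; rewrite gt_eqF.
have ak : `|a * k| < 1 / 2.
  rewrite normrM (gtr0_norm a0).
  have : a * `|k| < a * (1 + `|k|) by rewrite ltr_pM2l// ltrDr.
  by rewrite aE; lra.
have a2 : a <= d / 2 by rewrite -aE ler_peMr ?(ltW a0)// lerDl.
have := ak; rewrite ltr_norml => /andP[ak1 ak2].
have Hak : `|a * k| < 1 by apply: lt_trans ak _; lra.
have p1 : 1 / 2 < 1 + a * k by lra.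
have p2 : 1 / 2 < 1 - a * k by lra.
clear ak ak1 ak2 D0 D00.
move: p1 p2; set u := 1 + a * k; set v := 1 - a * k => p1 p2.
have u0 : 0 < u by apply: lt_trans p1; rewrite divr_gt0.
have v0 : 0 < v by apply: lt_trans p2; rewrite divr_gt0.
have small w : 1 / 2 < w -> 0 < a / w /\ a / w < d.
  move=> w2; have w0 : 0 < w by apply: lt_trans w2; rewrite divr_gt0.
  split; first exact: divr_gt0.
  rewrite ltr_pdivrMr//; apply: (le_lt_trans a2); rewrite ltr_pM2l//.
  by rewrite -[_^-1]mul1r.
have [r1 q1] := small u p1; have [r2 q2] := small v p2.
have := Hk a Hak; rewrite -/u -/v; set x := c + a / u; set y := c - a / v.
rewrite leNgt => /negP; apply.
have Dx : D x <= D c by apply: Dc; rewrite in_itv/= /x; clear -r1 q1 d1 d2 c1 c2; apply/andP; split; lra.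
have Dy : D y <= D c by apply: Dc; rewrite in_itv/= /y; clear -r2 q2 d1 d2 c1 c2; apply/andP; split; lra.
apply: (quadratic_gap u0 v0 _ e0 a0 _ _ _ Dx Dy).
- by rewrite /u /v; ring.
- by rewrite /x /y; clear -r1 r2; lra.
- by rewrite /x mulrDr (mulrC u (a / u)) divfK// gt_eqF.
- by rewrite /y mulrBr (mulrC v (a / v)) divfK// gt_eqF.
Qed.

(** The function [t^(-1/p)] is convex and decreasing; its convexity is [powR_perspective] with both
    [w] equal to 1. *)
Lemma powR_inv_local (p X Y Z : R) : 0 < p -> 0 < X -> 0 < Y -> 0 < Z -> X + Y <= 2 * Z ->
  2 * Z `^ (- p^-1) <= X `^ (- p^-1) + Y `^ (- p^-1).
Proof.
move=> p0 X0 Y0 Z0 XYZ; have q0 : 0 < p^-1 by rewrite invr_gt0.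
have h2 : (0 : R) < 1 / 2 by rewrite divr_gt0.
have := powR_perspective h2 h2 (@ltr01 R) (@ltr01 R) X0 Y0 q0.
rewrite !powR1 !mulr1 (_ : 1 / 2 + 1 / 2 = 1); last by field.
rewrite powR1 mul1r => H.
suff : Z `^ (- p^-1) <= (1 / 2 * X + 1 / 2 * Y) `^ (- p^-1) by lra.
have m0 : 0 < 1 / 2 * X + 1 / 2 * Y by rewrite addr_gt0// mulr_gt0.
rewrite !powRN lef_pV2 ?posrE ?powR_gt0//.
by apply: ge0_ler_powR; rewrite ?nnegrE ?(ltW m0) ?(ltW Z0) ?(ltW q0)//; lra.
Qed.

End local_convexity.

Section gauge.
Context {R : realType}.
Variables (n : nat) (p : R) (G : 'rV[R]_n -> R).
Hypotheses (p0 : 0 < p) (Gpos : forall y, y != 0 -> 0 < G y).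
Hypothesis Ghom : forall c y, c != 0 -> G (c *: y) = `|c| `^ (- p) * G y.

(** The value at 0 is imposed, since the power mean that [G] stands for is infinite there. *)
Definition gauge (y : 'rV[R]_n) : R := if y == 0 then 0 else G y `^ (- p^-1).

Lemma gauge0 : gauge 0 = 0.
Proof. by rewrite /gauge eqxx. Qed.

Lemma gauge_gt0 y : y != 0 -> 0 < gauge y.
Proof. by move=> y0; rewrite /gauge (negbTE y0) powR_gt0// Gpos. Qed.

Lemma gauge_ge0 y : 0 <= gauge y.
Proof. by have [->|/gauge_gt0/ltW//] := eqVneq y 0; rewrite gauge0. Qed.

Lemma gaugeE y : y != 0 -> gauge y = G y `^ (- p^-1).
Proof. by move=> y0; rewrite /gauge (negbTE y0). Qed.

Lemma gaugeZ c y : gauge (c *: y) = `|c| * gauge y.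
Proof.
have [->|c0] := eqVneq c 0; first by rewrite scale0r gauge0 normr0 mul0r.
have [->|y0] := eqVneq y 0; first by rewrite scaler0 gauge0 mulr0.
rewrite !gaugeE ?scaler_eq0 ?negb_or ?c0// Ghom//.
rewrite (@powRM R _ _ _ (powR_ge0 _ _) (ltW (Gpos y0))); congr (_ * _).
by rewrite -powRrM mulrNN mulfV ?powRr1 ?gt_eqF.
Qed.

Hypothesis Gloc : forall xi eta, independent xi eta -> exists k : R, forall a,
  G ((1 + a * k) *: xi + a *: eta) + G ((1 - a * k) *: xi - a *: eta) <= 2 * G xi.
Hypothesis Gcont : forall S T, independent S T -> continuous (fun c : R => G (S + c *: T)).

Lemma independent_line (S T : 'rV[R]_n) (c : R) : independent S T -> independent (S + c *: T) T.
Proof.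
move=> ind a b; rewrite scalerDr scalerA -addrA -scalerDl => /ind[-> H].
by move: H; rewrite mul0r add0r.
Qed.

Lemma independent_neq0 (S T : 'rV[R]_n) : independent S T -> S != 0.
Proof.
move=> ind; apply/eqP => S0; have [|/eqP] := ind 1 0; last by rewrite oner_eq0.
by rewrite S0 scaler0 scale0r addr0.
Qed.

(** By homogeneity [(1 + a k) M (c + a / (1 + a k))] is the gauge of [(1 + a k) (S + c T) + a T],
    the vector that [Gloc] controls; this puts [M] under the hypothesis of [local_convexity]. *)
Lemma gauge_midpoint (S T : 'rV[R]_n) : independent S T ->
  2 * gauge S <= gauge (S + T) + gauge (S - T).
Proof.
move=> ind; pose M (c : R) := gauge (S + c *: T).
have nz (c : R) : S + c *: T != 0 by exact: (independent_neq0 (independent_line (c := c) ind)).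
have := @local_convexity R M; rewrite /M scale0r addr0 scale1r scaleN1r; apply.
  move=> c; rewrite (_ : (fun c => _) = fun c : R => expR (- p^-1 * ln (G (S + c *: T)))).
    apply: (@continuous_comp _ _ _ (fun c : R => - p^-1 * ln (G (S + c *: T))) expR); last exact: continuous_expR.
    apply: cvgM; first exact: cvg_cst.
    apply: (@continuous_comp _ _ _ (fun c : R => G (S + c *: T)) (@ln R)); first exact: Gcont.
    by apply: continuous_ln; exact: Gpos.
  by apply/funext => c'; rewrite gaugeE ?nz// /powR gt_eqF ?Gpos ?nz.
move=> c; have [k Hk] := Gloc (independent_line (c := c) ind); exists k => a ak.
have := ak; rewrite ltr_norml => /andP[ak1 ak2].
have u0 : 0 < 1 + a * k by lra.
have v0 : 0 < 1 - a * k by lra.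
have step w b : 0 < w -> w *: (S + c *: T) + b *: T = w *: (S + (c + b / w) *: T).
  move=> w0; rewrite !scalerDr !scalerA -addrA -scalerDl; congr (_ + _ *: _).
  by rewrite mulrDr (mulrC w (b / w)) divfK// gt_eqF.
have := Hk a; rewrite -(scaleNr a T) (step _ _ u0) (step _ _ v0) mulNr => H.
have E w b : 0 < w -> w * gauge (S + b *: T) = G (w *: (S + b *: T)) `^ (- p^-1).
  by move=> w0; rewrite -gaugeE ?scaler_eq0 ?negb_or ?nz ?gt_eqF// gaugeZ gtr0_norm.
rewrite (E _ _ u0) (E _ _ v0) (gaugeE (nz c)); apply: powR_inv_local => //.
- by rewrite Gpos// scaler_eq0 negb_or nz gt_eqF.
- by rewrite Gpos// scaler_eq0 negb_or nz gt_eqF.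
- by rewrite Gpos.
Qed.

(** Independent vectors are [S + T] and [S - T] for their half-sum and half-difference. Dependent
    ones, in particular all vectors in dimension one, are settled by homogeneity alone. *)
Lemma gauge_triangle x y : gauge (x + y) <= gauge x + gauge y.
Proof.
have [->|x0] := eqVneq x 0; first by rewrite add0r gauge0 add0r.
have [->|y0] := eqVneq y 0; first by rewrite addr0 gauge0 addr0.
have [ind|] := pselect (independent x y).
  pose S := (1 / 2) *: (x + y); pose T := (1 / 2) *: (x - y).
  have xE : S + T = x.
    rewrite /S /T -scalerDr addrACA subrr addr0 -mulr2n -[x *+ 2]scaler_nat scalerA.
    by rewrite (_ : 1 / 2 * _ = 1) ?scale1r//; field.
  have yE : S - T = y.
    rewrite /S /T -scalerBr opprB (addrC x) addrACA subrr addr0 -mulr2n -[y *+ 2]scaler_nat scalerA.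
    by rewrite (_ : 1 / 2 * _ = 1) ?scale1r//; field.
  have indST : independent S T.
    move=> a b H; have [|h1 h2] := ind ((a + b) / 2) ((a - b) / 2); last by split; lra.
    by rewrite -[RHS]H /S /T; apply/rowP => i; rewrite !mxE; field.
  have := gauge_midpoint indST; rewrite xE yE; apply: le_trans.
  rewrite le_eqVlt; apply/orP; left; apply/eqP.
  by rewrite /S gaugeZ ger0_norm//; field.
move=> /existsNP[a /existsNP[b /not_implyP[H ab]]].
have a0 : a != 0.
  apply: contra_notN ab => /eqP a0; split=> //; move/eqP: H.
  by rewrite a0 scale0r add0r scaler_eq0 (negbTE y0) orbF => /eqP.
have xE : x = (- (b / a)) *: y.
  have : a^-1 *: (a *: x + b *: y) = 0 by rewrite H scaler0.
  rewrite scalerDr !scalerA mulVf// scale1r => /eqP.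
  by rewrite addr_eq0 -scaleNr (mulrC _ b) => /eqP.
rewrite xE -{2}[y]scale1r -scalerDl !gaugeZ -{3}[gauge y]mul1r -mulrDl.
by rewrite ler_wpM2r ?gauge_ge0// (le_trans (ler_normD _ _))// normr1.
Qed.

End gauge.

Section mean_gauge.
Context {R : realType}.
Variables (n : nat) (K : set 'rV[R]_n).
Hypothesis sK : solid K.

Let G (p : R) (y : 'rV[R]_n) : R := fine (pmean K p y).

Definition mean_gauge p : 'rV[R]_n -> R := gauge p (G p).

Let GE p y : 0 < p -> p <= 1 -> y != 0 -> pmean K p y = (G p y)%:E.
Proof. by move=> p0 p1 y0; have [A _ E] := pmean_fin sK p0 p1 y0; rewrite /G E. Qed.

Let Gpos p y : 0 < p -> p <= 1 -> y != 0 -> 0 < G p y.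
Proof. by move=> p0 p1 y0; have [A A0 E] := pmean_fin sK p0 p1 y0; rewrite /G E. Qed.

Let Ghom p c y : c != 0 -> G p (c *: y) = `|c| `^ (- p) * G p y.
Proof.
wlog c0 : c / 0 < c => [hw cn0|cn0].
  have [/hw/(_ cn0)//|c0|c0] := ltgtP 0 c; last by rewrite -c0 eqxx in cn0.
  have E : G p (c *: y) = G p ((- c) *: y) by rewrite scaleNr /G (pmeanN sK).
  have c0' : 0 < - c by rewrite oppr_gt0.
  have cn0' : - c != 0 by rewrite oppr_eq0.
  rewrite E -[X in X `^ _]normrN; exact: (hw (- c) c0' cn0').
rewrite gtr0_norm// /G -(pmeanZ sK p y c0) powRN.
have cp : 0 < c `^ p by rewrite powR_gt0.
(* At infinite values, as for [y = 0], [fine] returns 0 on both sides. *)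
case: (pmean K p (c *: y)) => [r||]/=.
- by rewrite mulKf// gt_eqF.
- by rewrite gt0_muley ?lte_fin// mulr0.
- by rewrite gt0_muleNy ?lte_fin// mulr0.
Qed.

(** The bound [q] is the squared distance from the origin to the line: the Gram determinant divided
    by [dotr T T]. *)
Lemma dotr_line_lb (S T : 'rV[R]_n) : independent S T ->
  exists2 q : R, 0 < q & forall c, q <= dotr (S + c *: T) (S + c *: T).
Proof.
move=> ind; pose s := dotr S S; pose t := dotr T T; pose m := dotr S T.
have t0 : 0 < t.
  rewrite dotr_gt0; apply/eqP => T0; have [|_ /eqP] := ind 0 1; last by rewrite oner_eq0.
  by rewrite T0 scaler0 scale0r addr0.
pose w := t *: S + (- m) *: T.
have w0 : 0 < dotr w w.
  rewrite dotr_gt0; apply/eqP => /ind[t00 _].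
  by move: t0; rewrite t00 ltxx.
have wE : dotr w w = t * (t * s - m ^+ 2).
  rewrite /w !dotrDl !dotrDr !dotrZl !dotrZr (dotrC T S) -/s -/t -/m; ring.
have D0 : 0 < t * s - m ^+ 2 by rewrite -(pmulr_rgt0 _ t0) -wE.
exists ((t * s - m ^+ 2) / t) => [|c]; first exact: divr_gt0.
rewrite ler_pdivrMr// !dotrDl !dotrDr !dotrZl !dotrZr (dotrC T S) -/s -/t -/m.
rewrite -subr_ge0 (_ : _ - _ = (m + c * t) ^+ 2) ?sqr_ge0//; ring.
Qed.

Lemma mean_gauge_gt0 p y : 0 < p -> p <= 1 -> y != 0 -> 0 < mean_gauge p y.
Proof. by move=> p0 p1 y0; apply: gauge_gt0 => // z; exact: Gpos. Qed.

Lemma mean_gaugeE p y : 0 < p -> p <= 1 -> y != 0 ->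
  exists2 A : R, 0 < A & pmean K p y = A%:E /\ mean_gauge p y = A `^ (- p^-1).
Proof.
by move=> p0 p1 y0; exists (G p y); [exact: Gpos|split; [exact: GE|exact: gaugeE]].
Qed.

Lemma mean_gaugeZ p c y : 0 < p -> p <= 1 -> mean_gauge p (c *: y) = `|c| * mean_gauge p y.
Proof.
move=> p0 p1; apply: gaugeZ => //; first by move=> z; exact: Gpos.
exact: Ghom.
Qed.

Let triangle_lt1 p x y : 0 < p -> p < 1 ->
  mean_gauge p (x + y) <= mean_gauge p x + mean_gauge p y.
Proof.
move=> p0 p1; apply: gauge_triangle => //.
- by move=> z; apply: Gpos => //; exact: ltW.
- exact: Ghom.
- move=> xi eta ind; have [k Hk] := pmean_local sK p0 p1 ind; exists k => a.
  have nz c d : (c != 0) || (d != 0) -> c *: xi + d *: eta != 0.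
    by apply: contraTneq => /ind[-> ->]; rewrite eqxx.
  have [a0|a0] := eqVneq a 0.
    by rewrite a0 !mul0r addr0 subr0 scale1r scale0r addr0 subr0; lra.
  have n1 : (1 + a * k) *: xi + a *: eta != 0 by rewrite nz// a0 orbT.
  have n2 : (1 - a * k) *: xi - a *: eta != 0.
    by rewrite -(scaleNr a eta) nz// oppr_eq0 a0 orbT.
  have n3 : xi != 0 by exact: independent_neq0 ind.
  have := Hk a; rewrite (GE p0 (ltW p1) n1) (GE p0 (ltW p1) n2) (GE p0 (ltW p1) n3).
  by rewrite -EFinD -EFinM lee_fin.
- move=> S T ind; have [q q0 Hq] := dotr_line_lb ind.
  exact: (pmean_continuous_line sK p0 (ltW p1) q0 Hq).
Qed.

(** A limit from the left, because the triangle inequality is so far available only for exponents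
    below 1. *)
Let mean_gauge_left y : mean_gauge p y @[p --> 1^'-] --> mean_gauge 1 y.
Proof.
have [->|y0] := eqVneq y 0.
  rewrite (_ : (fun p => _) = fun=> 0); last by apply/funext => p; exact: gauge0.
  by rewrite [X in _ --> X]gauge0; exact: cvg_cst.
rewrite (_ : (fun p => _) = fun p => G p y `^ (- p^-1)); last by apply/funext => p; exact: gaugeE.
have G1 : 0 < G 1 y by apply: Gpos.
have cG : G p y @[p --> 1^'-] --> G 1 y.
  exact/cvg_at_left_filter/(pmean_continuous_exponent sK y0).
have pE (a c : R) : 0 < a -> a `^ c = expR (c * ln a) by move=> a0; rewrite /powR gt_eqF.
have -> : mean_gauge 1 y = expR (- 1^-1 * ln (G 1 y)).
  exact: (etrans (gaugeE 1 (G 1) y0) (pE (G 1 y) (- 1^-1) G1)).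
have L : expR (- p^-1 * ln (G p y)) @[p --> 1^'-] --> expR (- 1^-1 * ln (G 1 y)).
  apply: continuous_cvg; first exact: continuous_expR.
  apply: cvgM; first apply: cvgN; first apply: cvgV => //.
    exact/cvg_at_left_filter/cvg_id.
  by apply: continuous_cvg => //; exact: continuous_ln.
move: L; apply: cvg_trans; apply: near_eq_cvg; near=> p.
have Gp : 0 < G p y.
  apply: (Gpos _ _ y0); first by near: p; exact: nbhs_left_gt.
  by apply: ltW; near: p; exact: nbhs_left_lt.
exact/esym/pE.
Unshelve. all: by end_near. Qed.

Lemma mean_gauge_triangle p x y : 0 < p -> p <= 1 ->
  mean_gauge p (x + y) <= mean_gauge p x + mean_gauge p y.
Proof.
move=> p0; rewrite le_eqVlt => /predU1P[->|]; last exact: triangle_lt1.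
have cxy : mean_gauge q x + mean_gauge q y @[q --> 1^'-] --> mean_gauge 1 x + mean_gauge 1 y.
  by apply: cvgD; exact: mean_gauge_left.
apply: (ler_cvg_to (@mean_gauge_left (x + y)) cxy).
near=> q; apply: triangle_lt1.
  by near: q; exact: nbhs_left_gt.
by near: q; exact: nbhs_left_lt.
Unshelve. all: by end_near. Qed.

End mean_gauge.

(** * The Fourier mean body *)

Lemma coord_le_norm (R : realType) n (x : 'rV[R]_n) i : `|x ord0 i| <= `|x|.
Proof.
rewrite [leRHS]/Num.Def.normr /= mx_normrE.
by apply/bigmax_geP; right => /=; exists (ord0, i).
Qed.

(** * Balls of a norm are symmetric convex bodies *)

Section norm_ball.
Context {R : realType}.
Variables (n : nat) (N : 'rV[R]_n -> R).
Hypotheses (Ngt0 : forall x, x != 0 -> 0 < N x)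
  (NZ : forall c x, N (c *: x) = `|c| * N x)
  (ND : forall x y, N (x + y) <= N x + N y).

Let N0 : N 0 = 0.
Proof. by rewrite -(scale0r 0) NZ normr0 mul0r. Qed.

Let NN x : N (- x) = N x.
Proof. by rewrite -scaleN1r NZ normrN1 mul1r. Qed.

Let Nge0 x : 0 <= N x.
Proof. by have [->|/Ngt0/ltW//] := eqVneq x 0; rewrite N0. Qed.

Let N_lipschitz : exists2 L : R, 0 < L & forall x, N x <= L * `|x|.
Proof.
exists (1 + \sum_i N (delta_mx ord0 i)); first by rewrite ltr_pwDl// sumr_ge0.
move=> x; have Nsum (s : seq 'I_n) (f : 'I_n -> 'rV[R]_n) :
    N (\sum_(i <- s) f i) <= \sum_(i <- s) N (f i).
  elim: s => [|i s IH]; first by rewrite !big_nil N0.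
  by rewrite !big_cons (le_trans (ND _ _))// lerD2l.
rewrite {1}[x]row_sum_delta (le_trans (Nsum _ _))// mulrDl mul1r.
rewrite -[leLHS]add0r lerD// mulr_suml ler_sum// => i _.
by rewrite NZ mulrC ler_wpM2l// coord_le_norm.
Qed.

Let N_continuous : continuous N.
Proof.
have [L L0 HL] := N_lipschitz; move=> x; apply/(@cvgrPdist_lt _ _ _ _ (nbhs_filter x)) => e e0.
apply/nbhs_ballP; exists (e / L) => /=; first exact: divr_gt0.
move=> y; rewrite -ball_normE/= => yx.
have d1 : N x <= N (x - y) + N y by rewrite -{1}(subrK y x) ND.
have d2 : N y <= N (x - y) + N x by rewrite -(NN (x - y)) opprB -{1}(subrK x y) ND.
have d3 : N (x - y) < e.
  by rewrite (le_lt_trans (HL _))// mulrC -ltr_pdivlMr.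
by rewrite ltr_norml; apply/andP; split; lra.
Qed.

(** By compactness [N] attains a positive minimum on the unit sphere of the library norm, and
    homogeneity spreads the bound. If there is no nonzero vector the sphere is empty and any [e]
    will do. *)
Let N_lower : exists2 e : R, 0 < e & forall x, e * `|x| <= N x.
Proof.
have [[x0 nx0]|all0] := pselect (exists x : 'rV[R]_n, x != 0); last first.
  exists 1 => // x; rewrite (_ : x = 0) ?normr0 ?mulr0 ?N0//.
  by apply/eqP; apply: contra_notT all0 => x0; exists x.
pose S : set 'rV[R]_n := [set x | `|x| = 1].
have unitS x : x != 0 -> S (`|x|^-1 *: x).
  by move=> nx; rewrite /S/= normrZ normrV ?unitfE ?normr_eq0// normr_id mulVf// normr_eq0.
have cS : compact S.
  apply: bounded_closed_compact.
    by exists 1; split=> [|M hM x /= ->]; [exact: num_real|exact: ltW].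
  rewrite (_ : S = (fun x : 'rV[R]_n => `|x|) @^-1` [set r | r = 1])//.
  apply: closed_comp; last exact: closed_eq.
  by move=> x _; exact: norm_continuous.
have [c] := EVT_min_rV (ex_intro _ _ (unitS _ nx0)) cS (continuous_subspaceT N_continuous).
rewrite inE /S/= => c1 Hc.
have nc : c != 0 by apply/eqP => c0; move: c1; rewrite c0 normr0 => /esym/eqP; rewrite oner_eq0.
exists (N c); first exact: Ngt0.
move=> x; have [->|nx] := eqVneq x 0; first by rewrite normr0 mulr0 N0.
have := Hc _ (mem_set (unitS x nx)); rewrite NZ normrV ?unitfE ?normr_eq0// normr_id.
by rewrite ler_pdivlMl ?normr_gt0// mulrC.
Qed.

Lemma norm_ball_convex_body (rho : R) : 0 < rho -> convex_body [set x | N x <= rho].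
Proof.
move=> rho0; split.
- apply: bounded_closed_compact.
    have [e e0 He] := N_lower; exists (rho / e); split; first exact: num_real.
    move=> M hM x /= Nx; apply: le_trans (ltW hM).
    by rewrite ler_pdivlMr// mulrC (le_trans (He x)).
  rewrite (_ : [set x | _] = N @^-1` [set r | r <= rho])//.
  by apply: closed_comp; [move=> x _; exact: N_continuous|exact: closed_le].
- move=> x y t; rewrite !inE /= => Nx Ny.
  apply: (le_trans (ND _ _)); rewrite !NZ.
  have t0 : 0 <= t%:num by [].
  have t1 : t%:num <= 1 by [].
  rewrite /unstable.onem !ger0_norm ?subr_ge0//.
  have h1 := ler_wpM2l t0 Nx.
  have h2 : (1 - t%:num) * N y <= (1 - t%:num) * rho by rewrite ler_wpM2l ?subr_ge0.
  by move: h1 h2; lra.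
- have [L L0 HL] := N_lipschitz; exists 0; apply/nbhs_ballP; exists (rho / L) => /=; first exact: divr_gt0.
  move=> y; rewrite -ball_normE/= sub0r normrN => yL.
  by rewrite (le_trans (HL y))// mulrC -ler_pdivlMr// ltW.
Qed.

Lemma norm_ball_symmetric (rho : R) : origin_symmetric [set x | N x <= rho].
Proof.
apply/seteqP; split=> [x Nx|_ [x Nx <-]]; last by rewrite /= NN.
by exists (- x); [rewrite /= NN|rewrite opprK].
Qed.

End norm_ball.

Section fourier_mean.
Context {R : realType}.
Variables (n : nat) (K : set 'rV[R]_n).
Hypothesis sK : solid K.
Local Notation lam := (lebesgue_rV R n).
Local Notation V := (fine (lam K)).

Lemma normc_fourier (y : 'rV[R]_n) :
  Normc.normc (fourier \1_K y) ^+ 2 = charpow lam K (dotr y).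
Proof.
have [mK _ _ _] := sK.
(* The Fourier transform carries [exp (- i)], hence the change of sign in the phase. *)
rewrite -(charpowN mK (solid_finite sK) (measurable_dotr y)).
rewrite /fourier /complex_integral /= sqr_sqrtr ?addr_ge0 ?sqr_ge0//.
congr (_ ^+ 2 + _ ^+ 2); rewrite [RHS]Rintegral_mkcond; apply: eq_Rintegral => x _ /=;
  rewrite patchE dotrC indicE ?mulr0 ?subr0 ?add0r; case: (x \in K);
  by rewrite ?mulr1 ?mulr0.
Qed.

Variable p : R.
Hypotheses (p0 : 0 < p) (p1 : p <= 1).

Lemma sphere_neq0 (theta : 'rV[R]_n) : sphere theta -> theta != 0.
Proof. by move=> st; rewrite -dotr_gt0 st. Qed.

Lemma fourier_mean_radialE (theta : 'rV[R]_n) : sphere theta ->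
  fourier_mean_radial p K theta =
  ((p / V) `^ p^-1 / mean_gauge K p theta)%:E.
Proof.
move=> /sphere_neq0 t0; have [A A0 [EA ->]] := mean_gaugeE sK p0 p1 t0.
have V0 := solid_volume_gt0 sK.
have VE : lam K = V%:E by rewrite fineK// ge0_fin_numE// solid_finite.
rewrite /fourier_mean_radial.
have -> : (\int[lebesgue_measure]_(r in `]0%R, +oo[)
    (Normc.normc (fourier \1_K (r *: theta)) ^+ 2 * r `^ (p - 1))%R%:E = A%:E)%E.
  rewrite -EA /pmean -integral_pw; apply: eq_integral => r _.
  rewrite normc_fourier -EFinM mulrC; congr (_ * charpow _ _ _)%:E.
  by apply/funext => x; rewrite dotrZl.
rewrite VE inver gt_eqF// -!EFinM poweR_EFin; congr (_%:E).
rewrite powRN invrK; apply: powRM; last exact: ltW.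
by rewrite divr_ge0 ?ltW.
Qed.

(** The origin enters the body only as 0 times a direction [theta], which exists because [0 < n]; a
    nonzero [x] is written with its Euclidean normalization. *)
Lemma fourier_mean_bodyE : (0 < n)%N ->
  fourier_mean_body p K = [set x | mean_gauge K p x <= (p / V) `^ p^-1].
Proof.
move=> n0; have V0 := solid_volume_gt0 sK.
have gt0 := mean_gauge_gt0 sK p0 p1; have gZ := mean_gaugeZ sK _ _ p0 p1.
set rho := (p / V) `^ p^-1.
have radialP (theta : 'rV[R]_n) t : sphere theta -> 0 <= t ->
    (t%:E <= fourier_mean_radial p K theta)%E = (mean_gauge K p (t *: theta) <= rho).
  move=> st t0; rewrite fourier_mean_radialE// lee_fin -/rho gZ ger0_norm//.
  by rewrite ler_pdivlMr// gt0// sphere_neq0.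
apply/seteqP; split=> [_ [theta [t [st t0 tr ->]]]|x] /=; first by rewrite -radialP.
move=> Nx; have [x0|x0] := eqVneq x 0.
  pose theta : 'rV[R]_n := delta_mx ord0 (Ordinal n0).
  have st : sphere theta.
    rewrite /sphere/= /dotr (bigD1 (Ordinal n0))//= big1 => [|i /negPf ne].
      by rewrite mxE !eqxx mulr1 addr0.
    by rewrite !mxE eqxx ne mulr0.
  exists theta, 0; rewrite scale0r; split; [exact: st|exact: lexx| |exact: x0].
  by rewrite (radialP theta 0 st (lexx 0)) scale0r -x0.
pose t := Num.sqrt (dotr x x).
have t0 : 0 < t by rewrite sqrtr_gt0 dotr_gt0.
have st : sphere (t^-1 *: x).
  rewrite /sphere/= dotrZl dotrZr -(sqr_sqrtr (dotr_ge0 x)) -/t.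
  by field; rewrite gt_eqF.
have xE : t *: (t^-1 *: x) = x by rewrite scalerA mulfV ?gt_eqF// scale1r.
exists (t^-1 *: x), t; split; [exact: st|exact: ltW| |exact/esym].
by rewrite (radialP _ _ st (ltW t0)) xE.
Qed.

End fourier_mean.

Theorem theorem6 (R : realType) (n : nat) (K : set 'rV[R]_n) (p : R) :
  (0 < n)%N -> convex_body K -> 0 < p -> p <= 1 ->
  origin_symmetric (fourier_mean_body p K) /\
  convex_body (fourier_mean_body p K).
Proof.
move=> n0 /convex_body_solid sK p0 p1; rewrite (fourier_mean_bodyE sK p0 p1 n0).
have rho0 : 0 < (p / fine (lebesgue_rV R n K)) `^ p^-1.
  by rewrite powR_gt0// divr_gt0// solid_volume_gt0.
have gZ c x := mean_gaugeZ sK c x p0 p1.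
split; first exact: norm_ball_symmetric.
apply: norm_ball_convex_body => //.
- by move=> x x0; exact: mean_gauge_gt0.
- by move=> x y; exact: mean_gauge_triangle.
Qed.
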